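(* Let $G=(V,E)$ be a weighted directed $n$-vertex graph, and let $1\le k\le n$. Then there is a deterministic parallel (PRAM) algorithm that computes all (exact) distances between any $u\in V$ and its $k$ nearest neighbors, that runs in parallel time $\log^{O(1)}n$, using work $\tilde{O}(k\cdot n^2)$. Furthermore, for each $i\in V$ and $j\in N_k(i)$, a shortest path can be reported in $O(\log k)$ parallel time and work proportional to the number of edges in it.
   Context: PRAM model: many processors share a single memory and operate in synchronous rounds; parallel time is the number of rounds and work is the number of processors times the number of rounds. For a vertex $v$, order all other vertices $z_1,z_2,\dots$ by non-decreasing directed distance $d_G(v,\cdot)$ (ties broken arbitrarily); the $k$ nearest neighbors of $v$ are $N_k(v)=\{z_1,\dots,z_k\}$. $\tilde O$ hides polylogarithmic factors in $n$.
   Formalization: Edge weights are assumed non-negative (with negative cycles distances are undefined), and a shortest path is reported only for those j in N_k(i) at finite distance from i, since an unreachable neighbor has no path. *)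

(* Defs.v *)
From HB Require Import structures.
From mathcomp Require Import all_boot all_order all_algebra.
From mathcomp Require Import constructive_ereal.

Set Implicit Arguments.
Unset Strict Implicit.
Unset Printing Implicit Defensive.

Import Order.TTheory GRing.Theory Num.Theory.

(** * Weighted directed graphs, distances and nearest neighbours *)

Record wdigraph (R : realDomainType) (n : nat) := WDigraph {
  edge : rel 'I_n;
  wt : 'I_n -> 'I_n -> R;
  wt_ge0 : forall u v, edge u v -> (0 <= wt u v)%R
}.

Section Graph.
Variables (R : realDomainType) (n : nat) (G : wdigraph R n).

(* As in [path], a path is given by its first vertex u and the sequence p of
   the vertices that follow it, so that it has [size p] edges. *)
Fixpoint plen (u : 'I_n) (p : seq 'I_n) : R :=
  if p is v :: q then (wt G u v + plen v q)%R else 0%R.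

Definition simple_path (u v : 'I_n) (p : seq 'I_n) : bool :=
  [&& path (edge G) u p, last u p == v & uniq (u :: p)].

(* A simple path has fewer than n edges; the distance is +oo if there is no
   path from u to v. *)
Definition dist (u v : 'I_n) : \bar R :=
  \big[Order.min/+oo%E]_(m < n)
    \big[Order.min/+oo%E]_(p : m.-tuple 'I_n | simple_path u v p) (plen u p)%:E.

Definition shortest_path (u v : 'I_n) (p : seq 'I_n) : Prop :=
  simple_path u v p /\ (plen u p)%:E = dist u v.

(* zs is a possible value of the list of the k nearest neighbours of u, for
   some way to break the ties.  There are only n - 1 vertices other than u, so
   that zs has size [minn k n.-1]. *)
Definition nearest (k : nat) (u : 'I_n) (zs : seq 'I_n) : Prop :=
  exists2 s : seq 'I_n,
    perm_eq s [seq z <- enum 'I_n | z != u] /\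
    sorted (fun x y => dist u x <= dist u y)%E s
  & zs = take k s.

End Graph.

(** * The PRAM *)

(* All processors run the same program, on natural numbers and on weights; the
   weights can only be moved, added and compared.  [r], [s], [t] and [a] are
   names of registers, and a memory access uses the address which is in
   register [a].  There are separate registers, and separate arrays in the
   shared memory, for the two types of data. *)
Inductive nop := Add | Sub | Mul | Div.

Inductive test :=
  | NLt of nat & nat
  | NEq of nat & nat
  | WLe of nat & nat.

Inductive stmt :=
  | NConst (r c : nat)
  | NOp (o : nop) (r s t : nat)
  | NLoad (r a : nat)
  | NStore (a r : nat)
  | WZero (r : nat)
  | WInf (r : nat)
  | WAdd (r s t : nat)
  | WLoad (r a : nat)
  | WStore (a r : nat)
  | If (b : test) (p q : seq stmt)
  | While (b : test) (p : seq stmt).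

Definition program := seq stmt.

Definition nop_eval (o : nop) : nat -> nat -> nat :=
  match o with Add => addn | Sub => subn | Mul => muln | Div => divn end.

Definition upd (V : Type) (f : nat -> V) (a : nat) (v : V) : nat -> V :=
  fun x => if x == a then v else f x.

Section Machine.
Variable R : realDomainType.

Record memory := Memory { nmem : nat -> nat; wmem : nat -> \bar R }.

(* [ctl] is what the processor still has to execute; it has halted when [ctl]
   is empty. *)
Record local := Local {
  ctl : program;
  nreg : nat -> nat;
  wreg : nat -> \bar R
}.

Record config (p : nat) := Config { procs : 'I_p -> local; shared : memory }.

Definition test_eval (s : local) (b : test) : bool :=
  match b with
  | NLt x y => nreg s x < nreg s y
  | NEq x y => nreg s x == nreg s y
  | WLe x y => (wreg s x <= wreg s y)%E
  end.

(* One round of one processor.  The stores have no effect here: they are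
   collected by [nwrite] and [wwrite], and done after all the loads. *)
Definition local_step (m : memory) (l : local) : local :=
  let N := nreg l in
  let W := wreg l in
  match ctl l with
  | [::] => l
  | NConst r c :: K => Local K (upd N r c) W
  | NOp o r s t :: K => Local K (upd N r (nop_eval o (N s) (N t))) W
  | NLoad r a :: K => Local K (upd N r (nmem m (N a))) W
  | NStore a r :: K => Local K N W
  | WZero r :: K => Local K N (upd W r 0%E)
  | WInf r :: K => Local K N (upd W r +oo%E)
  | WAdd r s t :: K => Local K N (upd W r (W s + W t)%E)
  | WLoad r a :: K => Local K N (upd W r (wmem m (N a)))
  | WStore a r :: K => Local K N W
  | If b p q :: K => Local ((if test_eval l b then p else q) ++ K) N W
  | While b p :: K =>
      Local (if test_eval l b then p ++ While b p :: K else K) N W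
  end.

Definition nwrite (l : local) : option (nat * nat) :=
  if ctl l is NStore a r :: _ then Some (nreg l a, nreg l r) else None.

Definition wwrite (l : local) : option (nat * \bar R) :=
  if ctl l is WStore a r :: _ then Some (nreg l a, wreg l r) else None.

Section Round.
Variable p : nat.

Definition commit (V : Type) (wr : 'I_p -> option (nat * V)) (f : nat -> V) :
    nat -> V := fun a =>
  if [pick i | omap fst (wr i) == Some a] is Some i
  then odflt (f a) (omap snd (wr i)) else f a.

Definition step (C : config p) : config p :=
  let m := shared C in
  Config (fun i => local_step m (procs C i))
    (Memory (commit (fun i => nwrite (procs C i)) (nmem m))
            (commit (fun i => wwrite (procs C i)) (wmem m))).

Definition halted (C : config p) : Prop := forall i, ctl (procs C i) = [::].

Definition exclusive (V : Type) (wr : 'I_p -> option (nat * V)) : Prop :=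
  forall i j a v w, wr i = Some (a, v) -> wr j = Some (a, w) -> i = j.

(* Concurrent reads are allowed and concurrent writes are not.  The natural
   numbers in the registers and in the memory, hence also the addresses, are
   at most B. *)
Definition legal (B : nat) (C : config p) : Prop :=
  [/\ exclusive (fun i => nwrite (procs C i)),
      exclusive (fun i => wwrite (procs C i)),
      forall i r, nreg (procs C i) r <= B
    & forall a, nmem (shared C) a <= B].

(* Register 0 holds the number of the processor, and registers 1, 2, ... hold
   the arguments. *)
Definition start (prog : program) (args : seq nat) (m : memory) : config p :=
  Config (fun i => Local prog (nth 0 (nat_of_ord i :: args)) (fun=> 0%E)) m.

End Round.

(* From memory m, p processors that run prog all halt within T rounds and
   leave memory m'. *)
Definition exec (B p T : nat) (prog : program) (args : seq nat)
    (m m' : memory) : Prop :=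
  let C t := iter t (@step p) (start p prog args m) in
  [/\ forall t, legal B (C t), halted (C T) & shared (C T) = m'].

(* The input is the weight matrix, in row-major order, with +oo for the pairs
   that are not edges. *)
Definition input (n : nat) (G : wdigraph R n) : memory :=
  Memory (fun=> 0) (fun a =>
    match insub (a %/ n), insub (a %% n) with
    | Some u, Some v => if edge G u v then (wt G u v)%:E else +oo%E
    | _, _ => +oo%E
    end).

(* The x-th nearest neighbour of u and its distance are at address
   n ^ 2 + u * k + x of the two arrays. *)
Definition stores_nearest (n k : nat) (G : wdigraph R n)
    (N : 'I_n -> seq 'I_n) (m : memory) : Prop :=
  forall (u : 'I_n) (x : nat), x < size (N u) ->
    let z := nth u (N u) x in
    nmem m (n ^ 2 + u * k + x) = z /\
    wmem m (n ^ 2 + u * k + x) = dist G u z.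

(* The number of edges, followed by the vertices, from address 0. *)
Definition stores_path (n : nat) (i : 'I_n) (q : seq 'I_n) (m : memory) :
    Prop :=
  nmem m 0 = size q /\
  forall x, x <= size q -> nmem m x.+1 = nth i (i :: q) x.

End Machine.

(* The logarithm, made positive so that O(log k) makes sense for k = 1. *)
Definition lg (n : nat) : nat := (trunc_log 2 n).+1.

(* Main.v *)
Require Import Defs.
From mathcomp Require Import all_boot all_order all_algebra.
From mathcomp Require Import constructive_ereal.
From mathcomp Require Import zify lra.
From Stdlib Require Import FunctionalExtensionality.

(** Order the vertices by (distance, number of edges, name), and let [E u w] be
    an upper bound for the key (distance, number of edges) of the pair [(u, w)].
    One round replaces [E u w] by the minimum of [E u v + E v w] over the [k + 1]
    vertices [v] that come first for [E u].  If [w] is among the [k] nearest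
    vertices of [u], then every vertex [v] of a best path from [u] to [w] is among
    the [k] nearest of [u], and [w] is among the [k] nearest of [v]; so after [t]
    rounds [E u w] is exact for all such pairs that are at most [2 ^ t] edges
    apart, and [lg n] rounds are enough.  A round costs [k n^2] operations for the
    products and [n^2] for sorting the rows, by merging with binary searches.
    Taking an argmin once more gives predecessors, and pointer doubling then tabulates
    all the paths, which take [n^2 (k + 1)] cells; a path of [s] edges is
    reported by [s / lg k + 1] processors that copy blocks of [lg k] vertices. *)

Set Implicit Arguments.
Unset Strict Implicit.
Unset Printing Implicit Defensive.

Import Order.TTheory GRing.Theory Num.Theory.

(** * Lockstep programs *)

(** The number of edges in the key handles zero weights: it grows strictly along a best path, so
    proper prefixes come strictly earlier in the order, closed subwalks never tie, and predecessor
    pointers cannot cycle. The name makes the order total. The obstacle is that the true list of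
    nearest vertices is unknown while [E] is being improved. Since [E] never underestimates,
    replacing true keys by [E] can only move vertices back; a vertex whose own entry is exact
    therefore has a rank for [E] that is at most its true rank, and the round does try it. The list
    has [k + 1] entries because [u] itself has rank 0. On the machine side, [legal] bounds every
    number at every round and forbids concurrent writes. The algorithms are therefore written in a
    small structured language. Numeric bounds are checked on the program text by computation, every
    stored number being cut at [n], and the weakest preconditions ask for exclusive writes. *)

Inductive nexp :=
  | NReg of nat
  | NC of nat
  | NBin of nop & nexp & nexp
  | NLd of nexp
  | NCmp of bool & nexp & nexp
  | NLeW of nat & nat
  | NIf of nexp & nexp & nexp.

(* All processors execute the same statement at the same time.  A memory address
   is a cell [o] of a region [q], and [SStN c q o v] stores the minimum of [v] and
   [n] if [c] is positive.  In [SLoop], the register is halved (or decremented, if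
   the flag is false) after each iteration, until it is zero. *)
Inductive stm :=
  | SSkip
  | SSeq of stm & stm
  | SN of nat & nexp
  | SWLd of nat & nexp
  | SWZero of nat
  | SWInf of nat
  | SWAdd of nat & nat & nat
  | SWIf of nexp & nat & nat
  | SStN of nexp & nat & nexp & nexp
  | SStW of nexp & nat & nexp & nat
  | SLoop of bool & nat & nexp & stm.

(** With truncated subtraction [b - (b - a)] is the minimum. In this form its static bound [ety] is
    that of [b], whatever the bound of [a]. *)
Definition n_min a b := NBin Defs.Sub b (NBin Defs.Sub b a).
Definition adr q o := NBin Add (NBin Mul (NC q) (NReg 7)) o.
Definition clamp v := n_min v (NReg 1).
Arguments adr : simpl never.
Arguments clamp : simpl never.
Definition shrink (dv : bool) r :=
  if dv then NBin Div (NReg r) (NC 2) else NBin Defs.Sub (NReg r) (NC 1).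

(* Registers 0, ..., 98 are those of the source language, register 99 is always
   zero, and the others are temporaries.  Both branches of a conditional take the
   same time, so that the processors remain synchronous. *)
Fixpoint cn (e : nexp) (t : nat) : program :=
  match e with
  | NReg r => [:: NOp Add t r 99]
  | NC c => [:: NConst t c]
  | NBin o a b => cn a t ++ cn b t.+1 ++ [:: NOp o t t t.+1]
  | NLd a => cn a t ++ [:: NLoad t t]
  | NCmp eq a b => cn a t ++ cn b t.+1 ++
      [:: If (if eq then NEq t t.+1 else NLt t t.+1)
             [:: NConst t 1] [:: NConst t 0]]
  | NLeW r s => [:: If (WLe r s) [:: NConst t 1] [:: NConst t 0]]
  | NIf c a b => cn c t ++ cn a t.+1 ++ cn b t.+2 ++
      [:: If (NLt 99 t) [:: NOp Add t t.+1 99] [:: NOp Add t t.+2 99]]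
  end.

Fixpoint tn (e : nexp) : nat :=
  match e with
  | NReg _ | NC _ => 1
  | NBin _ a b => tn a + (tn b + 1)
  | NLd a => tn a + 1
  | NCmp _ a b => tn a + (tn b + 2)
  | NLeW _ _ => 2
  | NIf c a b => tn c + (tn a + (tn b + 2))
  end.

Definition cassign r e : program := cn e 100 ++ [:: NOp Add r 100 99].

Fixpoint cs (s : stm) : program :=
  match s with
  | SSkip => [::]
  | SSeq a b => cs a ++ cs b
  | SN r e => cassign r e
  | SWLd r a => cn a 100 ++ [:: WLoad r 100]
  | SWZero r => [:: WZero r]
  | SWInf r => [:: WInf r]
  | SWAdd r s t => [:: WAdd r s t]
  | SWIf c r s => cn c 100 ++
      [:: If (NLt 99 100) [:: WAdd r s 99] [:: WAdd r r 99]]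
  | SStN c q o v => cn c 100 ++ cn (adr q o) 101 ++ cn (clamp v) 102 ++
      [:: If (NLt 99 100) [:: NStore 101 102] [:: NConst 100 0]]
  | SStW c q o r => cn c 100 ++ cn (adr q o) 101 ++
      [:: If (NLt 99 100) [:: WStore 101 r] [:: NConst 100 0]]
  | SLoop dv r e b => cassign r e ++
      [:: While (NLt 99 r) (cs b ++ cassign r (shrink dv r))]
  end.

(** [ts s * L ^ dep s] bounds the time when every loop makes at most [L] iterations, so a loop
    counts its body once. Its first summand is the initial assignment and the last test. *)
Fixpoint ts (s : stm) : nat :=
  match s with
  | SSkip => 0
  | SSeq a b => ts a + ts b
  | SN r e => tn e + 1
  | SWLd r a => tn a + 1
  | SWZero _ | SWInf _ | SWAdd _ _ _ => 1
  | SWIf c _ _ => tn c + 2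
  | SStN c q o v => tn c + (tn (adr q o) + (tn (clamp v) + 2))
  | SStW c q o _ => tn c + (tn (adr q o) + 2)
  | SLoop dv r e b => (tn e + 1 + 1) + (ts b + (tn (shrink dv r) + 2))
  end.

Fixpoint dep (s : stm) : nat :=
  match s with
  | SSeq a b => maxn (dep a) (dep b)
  | SLoop _ _ _ b => (dep b).+1
  | _ => 0
  end.

(* Static bounds: a value of exponent e is at most (n + 2) ^ e. *)
Definition rexp r :=
  if r == 0 then 3 else if r <= 4 then 1 else if r < 17 then 12 else
  if r < 30 then 40 else 60.

(** A sum costs one more exponent because [2 <= n + 2]; a constant [c] is at most [(n + 2) ^ c]; a
    load has exponent 1 because stored numbers are clamped; differences and quotients are bounded by
    their first operand. *)
Fixpoint ety (e : nexp) : nat :=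
  match e with
  | NReg r => rexp r
  | NC c => c
  | NBin Add a b => (maxn (ety a) (ety b)).+1
  | NBin Mul a b => ety a + ety b
  | NBin _ a b => ety a
  | NLd a => 1
  | NCmp _ _ _ | NLeW _ _ => 0
  | NIf _ a b => maxn (ety a) (ety b)
  end.

(** A generous exponent for all intermediate values; it is absorbed in the constant of the
    theorem. *)
Definition ecap := 100.

Fixpoint ewf (e : nexp) : bool :=
  (ety e <= ecap) &&
  match e with
  | NReg r => r < 99
  | NC c => true
  | NBin _ a b => ewf a && ewf b
  | NLd a => ewf a
  | NCmp _ a b => ewf a && ewf b
  | NLeW r s => (r < 99) && (s < 99)
  | NIf c a b => [&& ewf c, ewf a & ewf b]
  end.

Fixpoint swf (s : stm) : bool :=
  match s with
  | SSkip => true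
  | SSeq a b => swf a && swf b
  | SN r e => [&& r < 99, ewf e & ety e <= rexp r]
  | SWLd r a => (r < 99) && ewf a
  | SWZero r | SWInf r => r < 99
  | SWAdd r s t => [&& r < 99, s < 99 & t < 99]
  | SWIf c r s => [&& ewf c, r < 99 & s < 99]
  | SStN c q o v => [&& ewf c, ewf (adr q o) & ewf (clamp v)]
  | SStW c q o r => [&& ewf c, ewf (adr q o) & r < 99]
  | SLoop dv r e b => [&& r < 99, ewf e, ety e <= rexp r, ewf (shrink dv r) & swf b]
  end.

Section Eval.
Variable R : realDomainType.
Implicit Types (N : nat -> nat) (W : nat -> \bar R) (M : nat -> nat).

Fixpoint neval N W M (e : nexp) : nat :=
  match e with
  | NReg r => N r
  | NC c => c
  | NBin o a b => nop_eval o (neval N W M a) (neval N W M b)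
  | NLd a => M (neval N W M a)
  | NCmp eq a b =>
      if eq then neval N W M a == neval N W M b : nat
      else neval N W M a < neval N W M b
  | NLeW r s => (W r <= W s)%E
  | NIf c a b =>
      if 0 < neval N W M c then neval N W M a else neval N W M b
  end.

Lemma neval_ext N N' W W' M e :
  (forall r, r < 99 -> N r = N' r) -> (forall r, r < 99 -> W r = W' r) ->
  ewf e -> neval N W M e = neval N' W' M e.
Proof.
move=> hN hW; elim: e => //=.
- by move=> r /andP[_ /hN].
- by move=> o a IHa b IHb /andP[_ /andP[/IHa-> /IHb->]].
- by move=> a IHa /IHa->.
- by move=> q a IHa b IHb /andP[/IHa-> /IHb->].
- by move=> r s /andP[/hW-> /hW->].
- by move=> c IHc a IHa b IHb /andP[_ /and3P[/IHc-> /IHa-> /IHb->]].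
Qed.

Variable n : nat.
Let b := n + 2.

Lemma neval_bound N W M e :
  (forall r, r < 99 -> N r <= b ^ rexp r) -> (forall a, M a <= b) ->
  ewf e -> neval N W M e <= b ^ ety e.
Proof.
move=> hN hM.
have b1 : 0 < b by rewrite /b addn2.
have b2 : 1 < b by rewrite /b addn2.
elim: e => //=.
- by move=> r /andP[_ /hN].
- by move=> c _; apply/ltnW/ltn_expl.
- move=> o x IHx y IHy /andP[_ /andP[/IHx hx /IHy hy]].
  case: o => /=.
  + rewrite expnS; apply: (@leq_trans (2 * b ^ maxn (ety x) (ety y))).
      rewrite mul2n -addnn; apply: leq_add.
        by apply: leq_trans hx _; apply: leq_pexp2l => //; rewrite leq_maxl.
      by apply: leq_trans hy _; apply: leq_pexp2l => //; rewrite leq_maxr.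
    by rewrite leq_mul2r b2 orbT.
  + exact: leq_trans (leq_subr _ _) hx.
  + by rewrite expnD leq_mul.
  + exact: leq_trans (leq_div _ _) hx.
- by move=> q x IHx y IHy _; rewrite expn0; case: q; apply: leq_b1.
- by move=> r s _; rewrite expn0; apply: leq_b1.
- move=> c _ x IHx y IHy /andP[_ /and3P[_ /IHx hx /IHy hy]]; case: ifP => _.
    by apply: leq_trans hx _; apply: leq_pexp2l => //; rewrite leq_maxl.
  by apply: leq_trans hy _; apply: leq_pexp2l => //; rewrite leq_maxr.
Qed.

End Eval.

(** * Evaluation of one expression by one processor *)

Section Compile.
Variables (R : realDomainType) (n : nat).
Let b := n + 2.
Variable B : nat.
Hypothesis hB : b ^ ecap <= B.

Implicit Types (m : memory R) (l : local R).

(** A run of a single processor that never writes, against a fixed memory: such a run does not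
    depend on the other processors. *)
Fixpoint lrun m T l l' : Prop :=
  if T is T'.+1 then
    [/\ nwrite l = None, wwrite l = None, forall r, nreg l r <= B
      & lrun m T' (local_step m l) l']
  else l = l'.

Lemma lrun_cat m T1 T2 l1 l2 l3 :
  lrun m T1 l1 l2 -> lrun m T2 l2 l3 -> lrun m (T1 + T2) l1 l3.
Proof.
elim: T1 l1 => [|T IH] l1 /=; first by move=> ->.
by case=> h1 h2 h3 h4 h5; split=> //; apply: IH h4 h5.
Qed.

Lemma updE (V : Type) (f : nat -> V) a v : upd f a v a = v.
Proof. by rewrite /upd eqxx. Qed.

Lemma updN (V : Type) (f : nat -> V) a v x : x != a -> upd f a v x = f x.
Proof. by rewrite /upd => /negPf->. Qed.

Lemma upd_bound N r v : (forall r, N r <= B) -> v <= B ->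
  forall x, upd N r v x <= B.
Proof. by move=> h1 h2 x; rewrite /upd; case: ifP. Qed.

(** Register 99 is zero for both types of data, so that adding it serves as a move instruction. *)
Definition tyenv N (W : nat -> \bar R) :=
  [/\ forall r, r < 99 -> N r <= b ^ rexp r, N 99 = 0, W 99 = 0%E
    & forall r, N r <= B].

Lemma ety_le e : ewf e -> ety e <= ecap.
Proof. by case: e => >; case/andP. Qed.

Lemma neval_le N W M e : tyenv N W -> (forall a, M a <= b) -> ewf e ->
  neval N W M e <= B.
Proof.
move=> [hN _ _ _] hM he; apply: leq_trans hB.
apply: (leq_trans (neval_bound _ hN hM he)).
by apply: leq_pexp2l; [rewrite /b addn2 | apply: ety_le].
Qed.

Lemma tyenv_hi N N' W t : 99 < t -> tyenv N W -> (forall r, r < t -> N' r = N r) ->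
  (forall r, N' r <= B) -> tyenv N' W.
Proof.
move=> t100 [h1 h2 h3 h4] e hb; split=> //.
- by move=> r r99; rewrite e ?h1 //; lia.
- by rewrite e ?h2 //; lia.
Qed.

Lemma bool_le_B (x : bool) : x <= B.
Proof.
apply: leq_trans hB; apply: (@leq_trans 1); first by case: x.
by rewrite expn_gt0 /b addn2.
Qed.

(** The temporaries form a stack: nothing below [t] changes, so a first operand survives the
    evaluation of the second. By [neval_ext], the second operand in turn does not see the
    temporaries used by the first. *)
Lemma cn_correct m e t K N W :
  99 < t -> ewf e -> tyenv N W -> (forall a, nmem m a <= b) ->
  exists N', [/\ lrun m (tn e) (Local (cn e t ++ K) N W) (Local K N' W),
    N' t = neval N W (nmem m) e, forall r, r < t -> N' r = N r
    & forall r, N' r <= B].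
Proof.
move=> t99 he tyN hM; move: (tyN) => [hN hz hw hb].
elim: e t K N t99 he tyN hN hz hb => /=.
- move=> r t K N t99 /andP[_ r99] tyN hN hz hb.
  exists (upd N t (N r)); rewrite /= /local_step /= updE hz addn0.
  split=> //; first by move=> x xt; rewrite updN //; lia.
  exact: upd_bound.
- move=> c t K N t99 he tyN hN hz hb.
  exists (upd N t c); rewrite updE; split=> //.
    by move=> x xt; rewrite updN //; lia.
  exact: (upd_bound _ hb (neval_le (e := NC c) tyN hM he)).
- move=> o x IHx y IHy t K N t99 he tyN hN hz hb.
  move: (he) => /andP[_ /andP[hx hy]].
  rewrite -!catA.
  have [N1 [r1 e1 p1 b1]] := IHx t (cn y t.+1 ++ [:: NOp o t t t.+1] ++ K) N t99 hx tyN hN hz hb.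
  have ty1 := tyenv_hi t99 tyN p1 b1; move: (ty1) => [h11 h12 _ h13].
  have t99' : 99 < t.+1 by lia.
  have [N2 [r2 e2 p2 b2]] := IHy t.+1 ([:: NOp o t t t.+1] ++ K) N1 t99' hy ty1 h11 h12 h13.
  have e2' : N2 t.+1 = neval N W (nmem m) y.
    by rewrite e2; apply: neval_ext => // r r99; rewrite p1 //; lia.
  have bd := neval_le (e := NBin o x y) tyN hM he.
  exists (upd N2 t (nop_eval o (neval N W (nmem m) x) (neval N W (nmem m) y))).
  split; last exact: upd_bound.
  + apply: (lrun_cat r1); apply: (lrun_cat r2) => /=; split=> //.
    by rewrite /local_step /= e2' (p2 t) // e1.
  + by rewrite updE.
  + move=> r rt; rewrite updN ?p2 ?p1 //; lia.
- move=> x IHx t K N t99 he tyN hN hz hb.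
  move: (he) => hx.
  rewrite -!catA.
  have [N1 [r1 e1 p1 b1]] := IHx t ([:: NLoad t t] ++ K) N t99 hx tyN hN hz hb.
  have bd := neval_le (e := NLd x) tyN hM he.
  exists (upd N1 t (nmem m (neval N W (nmem m) x))).
  split; last exact: upd_bound.
  + by apply: (lrun_cat r1) => /=; split=> //; rewrite /local_step /= e1.
  + by rewrite updE.
  + move=> r rt; rewrite updN ?p1 //; lia.
- move=> q x IHx y IHy t K N t99 he tyN hN hz hb.
  move: (he) => /andP[hx hy].
  set I := If _ _ _.
  rewrite -!catA.
  have [N1 [r1 e1 p1 b1]] := IHx t (cn y t.+1 ++ [:: I] ++ K) N t99 hx tyN hN hz hb.
  have ty1 := tyenv_hi t99 tyN p1 b1; move: (ty1) => [h11 h12 _ h13].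
  have t99' : 99 < t.+1 by lia.
  have [N2 [r2 e2 p2 b2]] := IHy t.+1 ([:: I] ++ K) N1 t99' hy ty1 h11 h12 h13.
  have e2' : N2 t.+1 = neval N W (nmem m) y.
    by rewrite e2; apply: neval_ext => // r r99; rewrite p1 //; lia.
  exists (upd N2 t (neval N W (nmem m) (NCmp q x y))).
  split.
  + apply: (lrun_cat r1); apply: (lrun_cat r2); rewrite /I.
    have -> : [:: If (if q then NEq t t.+1 else NLt t t.+1) [:: NConst t 1] [:: NConst t 0]] ++ K =
      If (if q then NEq t t.+1 else NLt t t.+1) [:: NConst t 1] [:: NConst t 0] :: K by [].
    rewrite /= /local_step /= /test_eval; case: q {I r1 r2 he} => /=; rewrite (p2 t) // e1 e2'.
      by case: (_ == _) => /=; do !split.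
    by case: (_ < _) => /=; do !split.
  + by rewrite updE.
  + move=> r rt; rewrite updN ?p2 ?p1 //; lia.
  + apply: upd_bound => //=; case: q {I r1 r2 he}; exact: bool_le_B.
- move=> r s t K N t99 he tyN hN hz hb.
  exists (upd N t (W r <= W s)%E); rewrite updE; split=> //.
  + by rewrite /local_step /= /test_eval /=; case: (_ <= _)%E => /=; do !split.
  + by move=> x xt; rewrite updN //; lia.
  + by apply: upd_bound => //; exact: bool_le_B.
- move=> c IHc x IHx y IHy t K N t99 he tyN hN hz hb.
  move: (he) => /andP[_ /and3P[hc hx hy]].
  rewrite -!catA.
  set I := [:: If _ _ _] ++ K.
  have [N0 [r0 e0 p0 b0]] := IHc t (cn x t.+1 ++ cn y t.+2 ++ I) N t99 hc tyN hN hz hb.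
  have ty0 := tyenv_hi t99 tyN p0 b0; move: (ty0) => [h01 h02 _ h03].
  have t99' : 99 < t.+1 by lia.
  have [N1 [r1 e1 p1 b1]] := IHx t.+1 (cn y t.+2 ++ I) N0 t99' hx ty0 h01 h02 h03.
  have ty1 := tyenv_hi t99' ty0 p1 b1; move: (ty1) => [h11 h12 _ h13].
  have t99'' : 99 < t.+2 by lia.
  have [N2 [r2 e2 p2 b2]] := IHy t.+2 I N1 t99'' hy ty1 h11 h12 h13.
  have e1' : N1 t.+1 = neval N W (nmem m) x.
    by rewrite e1; apply: neval_ext => // r r99; rewrite p0 //; lia.
  have e2' : N2 t.+2 = neval N W (nmem m) y.
    by rewrite e2; apply: neval_ext => // r r99; rewrite p1 ?p0 //; lia.
  have ec : N2 t = neval N W (nmem m) c by rewrite p2 ?p1 ?e0 //; lia.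
  have z2 : N2 99 = 0 by rewrite p2 ?p1 ?p0 //; lia.
  have bd := neval_le (e := NIf c x y) tyN hM he.
  exists (upd N2 t (neval N W (nmem m) (NIf c x y))).
  split; last exact: upd_bound.
  + apply: (lrun_cat r0); apply: (lrun_cat r1); apply: (lrun_cat r2).
    rewrite /I /= /local_step /= /test_eval /= ec z2; case: ltnP => _ /=; do !split=> //=.
      by rewrite z2 addn0 (p2 t.+1) // e1'.
    by rewrite z2 addn0 e2'.
  + by rewrite updE.
  + move=> r rt; rewrite updN ?p2 ?p1 ?p0 //; lia.
Qed.

End Compile.

(** * Weakest preconditions *)

Section Semantics.
Variables (R : realDomainType) (p Z : nat).

Record state := State {
  nr : 'I_p -> nat -> nat;
  wr : 'I_p -> nat -> \bar R;
  me : memory R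
}.
Implicit Types (S : state) (Q : state -> Prop).

Definition ev S i e := neval (nr S i) (wr S i) (nmem (me S)) e.
Definition setn S r (f : 'I_p -> nat) :=
  State (fun i => upd (nr S i) r (f i)) (wr S) (me S).
Definition setw S r (f : 'I_p -> \bar R) :=
  State (nr S) (fun i => upd (wr S i) r (f i)) (me S).
Definition wrn S c q o v (i : 'I_p) :=
  if 0 < ev S i c then Some (ev S i (adr q o), ev S i (clamp v)) else None.
Definition wrw S c q o r (i : 'I_p) :=
  if 0 < ev S i c then Some (ev S i (adr q o), wr S i r) else None.
Definition storen S (w : 'I_p -> option (nat * nat)) :=
  State (nr S) (wr S) (Memory (commit w (nmem (me S))) (wmem (me S))).
Definition storew S (w : 'I_p -> option (nat * \bar R)) :=
  State (nr S) (wr S) (Memory (nmem (me S)) (commit w (wmem (me S)))).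
(** With [region_neq], this is what lets a store into one region be ignored in all the others. *)
Definition region_ok S c o := forall i : 'I_p,
  0 < ev S i c -> nr S i 7 = Z /\ ev S i o < Z.

Variable L : nat.

(** All processors must agree on every test of the loop, which keeps them in lockstep; hence a
    single number [T] of iterations. *)
Definition wploop (body : (state -> Prop) -> state -> Prop) dv r Q :=
  fix loop T S := if T is T'.+1 then
      (forall i, 0 < nr S i r) /\
      body (fun S' => loop T' (setn S' r (fun i => ev S' i (shrink dv r)))) S
    else (forall i, nr S i r = 0) /\ Q S.

Fixpoint wp (s : stm) Q S : Prop :=
  match s with
  | SSkip => Q S
  | SSeq s1 s2 => wp s1 (wp s2 Q) S
  | SN r e => Q (setn S r (fun i => ev S i e))
  | SWLd r a => Q (setw S r (fun i => wmem (me S) (ev S i a)))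
  | SWZero r => Q (setw S r (fun i => 0%E))
  | SWInf r => Q (setw S r (fun i => +oo%E))
  | SWAdd r s t => Q (setw S r (fun i => (wr S i s + wr S i t)%E))
  | SWIf c r s => Q (setw S r (fun i =>
      if 0 < ev S i c then wr S i s else wr S i r))
  | SStN c q o v => [/\ exclusive (wrn S c q o v), region_ok S c o
                      & Q (storen S (wrn S c q o v))]
  | SStW c q o r => [/\ exclusive (wrw S c q o r), region_ok S c o
                      & Q (storew S (wrw S c q o r))]
  | SLoop dv r e s => exists2 T, T <= L &
      wploop (wp s) dv r Q T (setn S r (fun i => ev S i e))
  end.

Lemma wp_mono s Q Q' S : (forall S', Q S' -> Q' S') -> wp s Q S -> wp s Q' S.
Proof.
elim: s Q Q' S => //=; try by move=> *; auto.
- by move=> s1 IH1 s2 IH2 Q Q' S h; apply: IH1 => S'; apply: IH2.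
- by move=> c q o v Q Q' S h [] *; split=> //; apply: h.
- by move=> c q o v Q Q' S h [] *; split=> //; apply: h.
- move=> dv r e s IH Q Q' S h [T hT H]; exists T => //.
  elim: T {hT} (setn S r _) H => [|T IHT] S1 [h1 h2]; split=> //; first exact: h.
  by apply: IH h2 => S'; apply: IHT.
Qed.

Fixpoint nregs (s : stm) : seq nat :=
  match s with
  | SSeq s1 s2 => nregs s1 ++ nregs s2
  | SN r _ => [:: r]
  | SLoop _ r _ s => r :: nregs s
  | _ => [::]
  end.

Fixpoint nregions (s : stm) : seq nat :=
  match s with
  | SSeq s1 s2 => nregions s1 ++ nregions s2
  | SStN _ q _ _ => [:: q]
  | SLoop _ _ _ s => nregions s
  | _ => [::]
  end.

Fixpoint wregions (s : stm) : seq nat :=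
  match s with
  | SSeq s1 s2 => wregions s1 ++ wregions s2
  | SStW _ q _ _ => [:: q]
  | SLoop _ _ _ s => wregions s
  | _ => [::]
  end.

Definition na S q o := nmem (me S) (q * Z + o).
Definition wa S q o := wmem (me S) (q * Z + o).

Definition frame (rs qs ws : seq nat) S S' :=
  [/\ forall i r, r \notin rs -> nr S' i r = nr S i r,
      forall q o, q \notin qs -> o < Z -> na S' q o = na S q o
    & forall q o, q \notin ws -> o < Z -> wa S' q o = wa S q o].

Lemma frame_trans rs qs ws S1 S2 S3 :
  frame rs qs ws S1 S2 -> frame rs qs ws S2 S3 -> frame rs qs ws S1 S3.
Proof.
case=> a1 a2 a3 [b1 b2 b3]; split.
- by move=> i r h; rewrite b1 ?a1.
- by move=> q o h1 h2; rewrite b2 ?a2.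
- by move=> q o h1 h2; rewrite b3 ?a3.
Qed.

Lemma commit_hit (V : Type) (w : 'I_p -> option (nat * V)) f i a v :
  exclusive w -> w i = Some (a, v) -> commit w f a = v.
Proof.
move=> ex wi; rewrite /commit; case: pickP => [j /eqP hj | /(_ i)]; last first.
  by rewrite wi eqxx.
case wj: (w j) hj => [[a' v']|] //= [ea].
rewrite ea in wj; have eij := ex _ _ _ _ _ wi wj.
by move: wj; rewrite -eij wi => -[].
Qed.

Lemma commit_miss (V : Type) (w : 'I_p -> option (nat * V)) f a :
  (forall i v, w i <> Some (a, v)) -> commit w f a = f a.
Proof.
move=> h; rewrite /commit; case: pickP => [j /eqP|//].
by case wj: (w j) => [[a' v]|] //= [ea]; case: (h j v); rewrite -ea.
Qed.

Lemma region_neq q q' o o' : o < Z -> o' < Z -> q != q' -> q * Z + o <> q' * Z + o'.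
Proof. nia. Qed.

(** The lists may be larger than necessary, so that the parts of a compound statement can be framed
    by the lists of the whole. *)
Lemma wp_frame_in (rs qs ws : seq nat) s Q S :
  {subset nregs s <= rs} -> {subset nregions s <= qs} -> {subset wregions s <= ws} ->
  wp s Q S -> wp s (fun S' => Q S' /\ frame rs qs ws S S') S.
Proof.
elim: s Q S => /=; try by move=> *.
- move=> s1 IH1 s2 IH2 Q S h1 h2 h3 h.
  have H : wp s1 (fun S' => wp s2 Q S' /\ frame rs qs ws S S') S.
    by apply: IH1 h => x hx; [apply: h1|apply: h2|apply: h3]; rewrite mem_cat hx.
  apply: wp_mono H => S1 [H F].
  have {}H : wp s2 (fun S' => Q S' /\ frame rs qs ws S1 S') S1.
    by apply: IH2 H => x hx; [apply: h1|apply: h2|apply: h3]; rewrite mem_cat hx orbT.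
  by apply: wp_mono H => S2 [H F2]; split=> //; apply: frame_trans F F2.
- move=> r e Q S h1 h2 h3 h; split=> //; split=> // i r' hr'.
  by rewrite /setn /= updN //; apply: contra hr' => /eqP->; apply: h1; rewrite mem_seq1.
- move=> c q o v Q S h1 h2 h3 [ex rok h]; split=> //; split=> //; split=> //.
  move=> q' o' hq' ho'; rewrite /na /= commit_miss // => i v'; rewrite /wrn.
  case: ifP => // hc [ea _]; have [e7 hZ] := rok i hc; move: ea.
  rewrite /ev /adr /= -!/(ev _ _ _) e7; apply: region_neq => //.
  by apply: contra hq' => /eqP<-; apply: h2; rewrite mem_seq1.
- move=> c q o v Q S h1 h2 h3 [ex rok h]; split=> //; split=> //; split=> //.
  move=> q' o' hq' ho'; rewrite /wa /= commit_miss // => i v'; rewrite /wrw.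
  case: ifP => // hc [ea _]; have [e7 hZ] := rok i hc; move: ea.
  rewrite /ev /adr /= -!/(ev _ _ _) e7; apply: region_neq => //.
  by apply: contra hq' => /eqP<-; apply: h3; rewrite mem_seq1.
- move=> dv r e s IH Q S h1 h2 h3 [T hT H]; exists T => //.
  have F0 v : frame rs qs ws S (setn S r v).
    split=> // i r' hr'; rewrite /setn /= updN //.
    by apply: contra hr' => /eqP->; apply: h1; rewrite mem_head.
  elim: T {hT} (setn S r _) (F0 (fun i => ev S i e)) H => [|T IHT] S1 F1 [h4 h5].
    by split.
  split=> //.
  have h1' : {subset nregs s <= rs} by move=> x hx; apply: h1; rewrite inE hx orbT.
  have := IH _ _ h1' h2 h3 h5; apply: wp_mono => S2 [h6 F2]; apply: IHT h6.
  apply: (frame_trans F1); apply: (frame_trans F2).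
  split=> // i r' hr'; rewrite /setn /= updN //.
  by apply: contra hr' => /eqP->; apply: h1; rewrite mem_head.
Qed.

(** The frame is read off the program text, so specifications need only describe what changes. *)
Lemma wp_frame s Q Q' S : wp s Q S ->
  (forall S', Q S' -> frame (nregs s) (nregions s) (wregions s) S S' -> Q' S') ->
  wp s Q' S.
Proof.
move=> h hQ; apply: (wp_mono _ (wp_frame_in (fun x hx => hx) (fun x hx => hx) (fun x hx => hx) h)).
by move=> S' [? ?]; apply: hQ.
Qed.

End Semantics.

(** * Soundness of the compilation *)

Section Soundness.
Variables (R : realDomainType) (p n Z B : nat).
Let b := n + 2.
Hypothesis hB : b ^ ecap <= B.
Implicit Types (S : state R p) (C : config R p).

Fixpoint crun T C C' : Prop :=
  if T is T'.+1 then legal B C /\ crun T' (step C) C' else C = C'.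

Lemma crun_cat T1 T2 C1 C2 C3 :
  crun T1 C1 C2 -> crun T2 C2 C3 -> crun (T1 + T2) C1 C3.
Proof.
elim: T1 C1 => [|T IH] C1 /=; first by move=> ->.
by case=> h1 h2 h3; split=> //; apply: IH h2 h3.
Qed.

Lemma commit_none (V : Type) (w : 'I_p -> option (nat * V)) f :
  (forall i, w i = None) -> commit w f = f.
Proof.
move=> h; apply: functional_extensionality => a.
by apply: commit_miss => i v; rewrite h.
Qed.

Lemma memory_eta (m : memory R) : Memory (nmem m) (wmem m) = m.
Proof. by case: m. Qed.

Lemma local_eta (l : local R) : Local (ctl l) (nreg l) (wreg l) = l.
Proof. by case: l. Qed.

Lemma config_eta C l : (forall i, procs C i = l i) -> C = Config l (shared C).
Proof. by case: C => pr sh /= h; congr Config; apply: functional_extensionality. Qed.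

(** While nobody writes, the memory is constant and the separate runs of the processors can be put
    side by side. *)
Lemma crun_local C T (l : 'I_p -> local R) :
  (forall i, lrun B (shared C) T (procs C i) (l i)) ->
  (forall a, nmem (shared C) a <= B) -> crun T C (Config l (shared C)).
Proof.
elim: T C => [|T IH] C h hm /=; first exact: config_eta.
split.
  split=> //.
  - by move=> i j a v w; case: (h i) => ->.
  - by move=> i j a v w; case: (h i) => _ ->.
  - by move=> i r; case: (h i).
have -> : step C = Config (fun i => local_step (shared C) (procs C i)) (shared C).
  rewrite /step !commit_none ?memory_eta // => i; by case: (h i).
by apply: IH => // i; case: (h i).
Qed.

(** Temporaries are not part of the source semantics, so only registers below 100 are compared; the
    bound covers all of them because [legal] does. *)
Definition matches C K S :=
  shared C = me S /\ forall i,
  [/\ ctl (procs C i) = K, forall r, r < 100 -> nreg (procs C i) r = nr S i r,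
      forall r, r < 100 -> wreg (procs C i) r = wr S i r
    & forall r, nreg (procs C i) r <= B].

Definition typed S :=
  (forall i, [/\ forall r, r < 99 -> nr S i r <= b ^ rexp r, nr S i 99 = 0
              & wr S i 99 = 0%E]) /\
  forall a, nmem (me S) a <= b.

Lemma b_le_B : b <= B.
Proof.
apply: leq_trans hB; rewrite -{1}(expn1 b); apply: leq_pexp2l => //.
by rewrite /b addn2.
Qed.

Lemma matches_tyenv C K S i : matches C K S -> typed S ->
  tyenv n B (nreg (procs C i)) (wreg (procs C i)).
Proof.
move=> [_ /(_ i)[_ h1 h2 h3]] [/(_ i)[t1 t2 t3] _]; split=> //.
- by move=> r r99; rewrite h1 ?t1 //; lia.
- by rewrite h1.
- by rewrite h2.
Qed.

Lemma crun_exp e t C K S : 99 < t -> ewf e -> typed S ->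
  matches C (cn e t ++ K) S ->
  exists C', [/\ crun (tn e) C C', matches C' K S,
    forall i, nreg (procs C' i) t = ev S i e
    & forall i r, r < t -> nreg (procs C' i) r = nreg (procs C i) r].
Proof.
move=> t99 he ty mt; move: (mt) => [hs hi].
have hm a : nmem (shared C) a <= b by rewrite hs; apply ty.
have H i := cn_correct hB K t99 he (matches_tyenv i mt ty) hm.
have [N' hN'] := fin_all_exists H.
exists (Config (fun i => Local K (N' i) (wreg (procs C i))) (shared C)).
split.
- apply: crun_local.
    move=> i; case: (hN' i) => + _ _ _; case: (hi i) => <- _ _ _.
    by rewrite local_eta.
  by move=> a; apply: leq_trans (hm a) b_le_B.
- split=> //= i; case: (hN' i) => _ _ h1 h2; case: (hi i) => _ h3 h4 _; split=> //.
  by move=> r r100; rewrite h1 ?h3 //; lia.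
- move=> i /=; case: (hN' i) => _ -> _ _; rewrite hs; case: (hi i) => _ h3 h4 _.
  by apply: neval_ext he => r r99; [apply: h3|apply: h4]; lia.
- by move=> i r /=; case: (hN' i) => _ _ h _; apply: h.
Qed.

Lemma legal_quiet C : (forall i, nwrite (procs C i) = None) ->
  (forall i, wwrite (procs C i) = None) -> (forall a, nmem (shared C) a <= B) ->
  (forall i r, nreg (procs C i) r <= B) -> legal B C.
Proof.
by move=> h1 h2 h3 h4; split=> // i j a v w; rewrite ?h1 ?h2.
Qed.

Lemma crun_quiet C : (forall i, nwrite (procs C i) = None) ->
  (forall i, wwrite (procs C i) = None) -> (forall a, nmem (shared C) a <= B) ->
  (forall i r, nreg (procs C i) r <= B) ->
  crun 1 C (Config (fun i => local_step (shared C) (procs C i)) (shared C)).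
Proof. by move=> h1 h2 h3 h4; apply: crun_local. Qed.

Lemma typed_mem S a : typed S -> nmem (me S) a <= B.
Proof. by case=> _ h; apply: leq_trans (h a) b_le_B. Qed.

Lemma crun_instr C c K S S' : matches C (c :: K) S -> typed S ->
  (forall N W, @nwrite R (Local (c :: K) N W) = None) ->
  (forall N W, @wwrite R (Local (c :: K) N W) = None) ->
  me S' = me S ->
  (forall i, let l := local_step (me S) (procs C i) in
  [/\ ctl l = K, forall r, r < 100 -> nreg l r = nr S' i r,
      forall r, r < 100 -> wreg l r = wr S' i r
    & forall r, nreg l r <= B]) ->
  exists2 C', crun 1 C C' & matches C' K S'.
Proof.
move=> [hs hi] ty h1 h2 hm h.
exists (Config (fun i => local_step (shared C) (procs C i)) (shared C)).
  apply: crun_quiet.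
  - by move=> i; case: (hi i) => hc _ _ _; rewrite -(local_eta (procs C i)) hc.
  - by move=> i; case: (hi i) => hc _ _ _; rewrite -(local_eta (procs C i)) hc.
  - by move=> a; rewrite hs; apply: typed_mem.
  - by move=> i r; case: (hi i).
by split=> [|i] /=; rewrite hs ?hm //; case: (h i).
Qed.

Lemma typed_setn S r e : r < 99 -> ewf e -> ety e <= rexp r -> typed S ->
  typed (setn S r (fun i => ev S i e)).
Proof.
move=> r99 he ht [h1 h2]; split=> // i /=; case: (h1 i) => t1 t2 t3.
split=> //; last by rewrite updN //; lia.
move=> r' r'99; rewrite /upd; case: eqP => [->|_]; last exact: t1.
apply: (@leq_trans (b ^ ety e)); first exact: neval_bound.
by apply: leq_pexp2l => //; rewrite /b addn2.
Qed.

Lemma typed_setw S r f : r < 99 -> typed S -> typed (setw S r f).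
Proof.
move=> r99 [h1 h2]; split=> // i /=; case: (h1 i) => t1 t2 t3.
by split=> //; rewrite updN //; lia.
Qed.

(** The purpose of [clamp]: a minimum with register 1 has exponent 1 whatever is stored, so the
    memory bound is preserved. *)
Lemma typed_storen S c q o v : ewf (clamp v) -> typed S ->
  typed (storen S (wrn S c q o v)).
Proof.
move=> hv [h1 h2]; split=> // a /=; rewrite /commit; case: pickP => [i|_] //.
rewrite /wrn; case: ifP => //= _ _.
have := @neval_bound R n (nr S i) (wr S i) (nmem (me S)) (clamp v).
by rewrite /clamp /= expn1; apply=> //; case: (h1 i).
Qed.

Lemma crun_assign r e C K S : r < 99 -> ewf e -> typed S ->
  matches C (cassign r e ++ K) S ->
  exists2 C', crun (tn e + 1) C C' & matches C' K (setn S r (fun i => ev S i e)).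
Proof.
move=> r99 he ty; rewrite /cassign -catA => mt.
have t99 : 99 < 100 by [].
have [C1 [r1 mt1 e1 p1]] := crun_exp t99 he ty mt.
have [C2 r2 mt2] : exists2 C', crun 1 C1 C' & matches C' K (setn S r (fun i => ev S i e)).
  apply: (crun_instr mt1) => // i; case: (mt1) => hs1 /(_ i)[c1 h1 h2 h3] l.
  have z : nreg (procs C1 i) 99 = 0.
    by rewrite h1 //; case: ty => /(_ i)[].
  have -> : l = Local K (upd (nreg (procs C1 i)) r (ev S i e)) (wreg (procs C1 i)).
    by rewrite /l /local_step c1 /= z addn0 e1.
  split=> //=.
  - by move=> x x100; rewrite /upd; case: eqP => // _; apply: h1.
  - apply: upd_bound => //; rewrite -e1; exact: h3.
by exists C2 => //; apply: crun_cat r1 r2.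
Qed.

Lemma zero_reg C K S i : matches C K S -> typed S -> nreg (procs C i) 99 = 0.
Proof. by move=> [_ /(_ i)[_ -> //]] _ _ [/(_ i)[]]. Qed.

Lemma zero_wreg C K S i : matches C K S -> typed S -> wreg (procs C i) 99 = 0%E.
Proof. by move=> [_ /(_ i)[_ _ -> //]] _ [/(_ i)[]]. Qed.

(** After this round different processors may face different instructions. No [state] matches such a
    configuration, so it is described directly. *)
Lemma crun_if C x y K S : matches C ([:: If (NLt 99 100) [:: x] [:: y]] ++ K) S ->
  typed S -> exists C', [/\ crun 1 C C', shared C' = me S,
    forall i, nreg (procs C' i) = nreg (procs C i),
    forall i, wreg (procs C' i) = wreg (procs C i)
  & forall i, ctl (procs C' i) = (if 0 < nreg (procs C i) 100 then x else y) :: K].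
Proof.
move=> mt ty; case: (mt) => [hs hi].
exists (Config (fun i => local_step (shared C) (procs C i)) (shared C)).
split=> //=.
- apply: crun_quiet.
  + by move=> i; case: (hi i) => hc _ _ _; rewrite /nwrite hc.
  + by move=> i; case: (hi i) => hc _ _ _; rewrite /wwrite hc.
  + by move=> a; rewrite hs; apply: typed_mem.
  + by move=> i r; case: (hi i).
- by move=> i; case: (hi i) => hc _ _ _; rewrite /local_step hc.
- by move=> i; case: (hi i) => hc _ _ _; rewrite /local_step hc.
- move=> i; case: (hi i) => hc _ _ _; rewrite /local_step hc /=.
  by rewrite (zero_reg i mt ty); case: ifP.
Qed.

Variable L : nat.
Hypothesis L_gt0 : 0 < L.

Lemma time_seq t1 t2 d1 d2 T1 T2 : T1 <= t1 * L ^ d1 -> T2 <= t2 * L ^ d2 ->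
  T1 + T2 <= (t1 + t2) * L ^ maxn d1 d2.
Proof.
move=> h1 h2; rewrite mulnDl; apply: leq_add.
  by apply: leq_trans h1 _; rewrite leq_mul2l leq_pexp2l ?leq_maxl ?orbT.
by apply: leq_trans h2 _; rewrite leq_mul2l leq_pexp2l ?leq_maxr ?orbT.
Qed.

Theorem wp_sound s Q S C K : swf s -> typed S -> wp Z L s Q S ->
  matches C (cs s ++ K) S ->
  exists T C' S', [/\ T <= ts s * L ^ dep s, crun T C C', matches C' K S',
                      typed S' & Q S'].
Proof.
elim: s Q S C K.
- by move=> Q S C K /= _ ty hQ mt; exists 0, C, S.
- move=> s1 IH1 s2 IH2 Q S C K /= /andP[w1 w2] ty h; rewrite -catA => mt.
  have [T1 [C1 [S1 [b1 r1 m1 ty1 h1]]]] := IH1 _ _ _ _ w1 ty h mt.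
  have [T2 [C2 [S2 [b2 r2 m2 ty2 h2]]]] := IH2 _ _ _ _ w2 ty1 h1 m1.
  exists (T1 + T2), C2, S2; split=> //; last exact: crun_cat r1 r2.
  exact: time_seq.
- move=> r e Q S C K /= /and3P[r99 he ht] ty h mt.
  have [C' r1 m1] := crun_assign r99 he ty mt.
  exists (tn e + 1), C', (setn S r (fun i => ev S i e)).
  by split=> //; [rewrite muln1 | apply: typed_setn].
- move=> r a Q S C K /= /andP[r99 ha] ty h; rewrite -catA => mt.
  have t99 : 99 < 100 by [].
  have [C1 [r1 mt1 e1 p1]] := crun_exp t99 ha ty mt.
  have [C2 r2 mt2] : exists2 C', crun 1 C1 C' &
      matches C' K (setw S r (fun i => wmem (me S) (ev S i a))).
    apply: (crun_instr mt1) => // i; case: (mt1) => hs1 /(_ i)[c1 h1 h2 h3] l.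
    have -> : l = Local K (nreg (procs C1 i)) (upd (wreg (procs C1 i)) r (wmem (me S) (ev S i a))).
      by rewrite /l /local_step c1 /= e1.
    by split=> //= x x100; rewrite /upd; case: eqP => // _; apply: h2.
  exists (tn a + 1), C2, (setw S r (fun i => wmem (me S) (ev S i a))).
  by split=> //; [rewrite muln1 | apply: crun_cat r1 r2 | apply: typed_setw].
- move=> r Q S C K /= r99 ty h mt.
  have [C2 r2 mt2] : exists2 C', crun 1 C C' & matches C' K (setw S r (fun i => 0%E)).
    apply: (crun_instr mt) => // i; case: (mt) => hs1 /(_ i)[c1 h1 h2 h3] l.
    have -> : l = Local K (nreg (procs C i)) (upd (wreg (procs C i)) r 0%E).
      by rewrite /l /local_step c1.
    by split=> //= x x100; rewrite /upd; case: eqP => // _; apply: h2.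
  exists 1, C2, (setw S r (fun i => 0%E)).
  by split=> //; apply: typed_setw.
- move=> r Q S C K /= r99 ty h mt.
  have [C2 r2 mt2] : exists2 C', crun 1 C C' & matches C' K (setw S r (fun i => +oo%E)).
    apply: (crun_instr mt) => // i; case: (mt) => hs1 /(_ i)[c1 h1 h2 h3] l.
    have -> : l = Local K (nreg (procs C i)) (upd (wreg (procs C i)) r +oo%E).
      by rewrite /l /local_step c1.
    by split=> //= x x100; rewrite /upd; case: eqP => // _; apply: h2.
  exists 1, C2, (setw S r (fun i => +oo%E)).
  by split=> //; apply: typed_setw.
- move=> r s t Q S C K /= /and3P[r99 s99 t99] ty h mt.
  have [C2 r2 mt2] : exists2 C', crun 1 C C' &
      matches C' K (setw S r (fun i => (wr S i s + wr S i t)%E)).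
    apply: (crun_instr mt) => // i; case: (mt) => hs1 /(_ i)[c1 h1 h2 h3] l.
    have -> : l = Local K (nreg (procs C i)) (upd (wreg (procs C i)) r (wr S i s + wr S i t)%E).
      by rewrite /l /local_step c1 /= !h2 //; lia.
    by split=> //= x x100; rewrite /upd; case: eqP => // _; apply: h2.
  exists 1, C2, (setw S r (fun i => (wr S i s + wr S i t)%E)).
  by split=> //; apply: typed_setw.
- move=> c r s Q S C K /= /and3P[hc r99 s99] ty h; rewrite -catA => mt.
  have t99 : 99 < 100 by [].
  have [C1 [r1 mt1 e1 p1]] := crun_exp t99 hc ty mt.
  have [C2 [r2 sh2 n2 w2 c2]] := crun_if mt1 ty.
  set S' := setw S r _ in h.
  have hm a : nmem (shared C2) a <= B by rewrite sh2; apply: typed_mem.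
  exists (tn c + (1 + 1)), (Config (fun i => local_step (shared C2) (procs C2 i)) (shared C2)), S'.
  split=> //; first by rewrite muln1.
  + apply: (crun_cat r1); apply: (crun_cat r2); apply: crun_quiet => //.
    * by move=> i; rewrite /nwrite c2; case: ifP.
    * by move=> i; rewrite /wwrite c2; case: ifP.
    * by move=> i r'; rewrite n2; case: mt1 => _ /(_ i)[].
  + split=> //= i; case: (mt1) => _ /(_ i)[_ h1 h2 h3].
    have -> : local_step (shared C2) (procs C2 i) = Local K (nreg (procs C1 i))
       (upd (wreg (procs C1 i)) r (if 0 < ev S i c then wr S i s else wr S i r)).
      rewrite /local_step c2 e1 n2 w2; case: ifP => _;
      by rewrite (zero_wreg i mt1 ty) adde0 h2 //; lia.
    by split=> //= x x100; rewrite /upd; case: eqP => // _; apply: h2.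
  + exact: typed_setw.
- move=> c q o v Q S C K hw ty [ex rok h] mt.
  have /and3P[hc hq hv] : [&& ewf c, ewf (adr q o) & ewf (clamp v)] := hw.
  have ecs : cs (SStN c q o v) = cn c 100 ++ cn (adr q o) 101 ++ cn (clamp v) 102 ++
      [:: If (NLt 99 100) [:: NStore 101 102] [:: NConst 100 0]] by [].
  rewrite ecs -(catA (cn c 100)) -(catA (cn (adr q o) 101)) -(catA (cn (clamp v) 102)) in mt.
  have t99 : 99 < 100 by [].
  have t99' : 99 < 101 by [].
  have t99'' : 99 < 102 by [].
  have [C1 [r1 mt1 e1 p1]] := crun_exp t99 hc ty mt.
  have [C2 [r2 mt2 e2 p2]] := crun_exp t99' hq ty mt1.
  have [C3 [r3 mt3 e3 p3]] := crun_exp t99'' hv ty mt2.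
  have [C4 [r4 sh4 n4 w4 c4]] := crun_if mt3 ty.
  have ec i : nreg (procs C3 i) 100 = ev S i c by rewrite p3 ?p2 ?e1.
  have ea i : nreg (procs C3 i) 101 = ev S i (adr q o) by rewrite p3 ?e2.
  have bn i r : nreg (procs C3 i) r <= B by case: (mt3) => _ /(_ i)[].
  have ew : (fun i => nwrite (procs C4 i)) = wrn S c q o v.
    apply: functional_extensionality => i; rewrite /nwrite c4 ec /wrn n4.
    by case: ifP => // _; rewrite ea e3.
  have eww i : wwrite (procs C4 i) = None by rewrite /wwrite c4; case: ifP.
  exists (tn c + (tn (adr q o) + (tn (clamp v) + (1 + 1)))), (step C4),
    (storen S (wrn S c q o v)).
  split=> //; first by rewrite [dep _]/= expn0 muln1.
  + apply: (crun_cat r1); apply: (crun_cat r2); apply: (crun_cat r3); apply: (crun_cat r4).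
    split=> //; split.
    * by rewrite ew.
    * by move=> i j a x y; rewrite eww.
    * by move=> i r; rewrite n4.
    * by move=> a; rewrite sh4; apply: typed_mem.
  + split=> /=; first by rewrite ew sh4 (commit_none _ eww).
    move=> i; case: (mt3) => _ /(_ i)[_ h1 h2 h3]; rewrite /local_step c4 n4 w4.
    case: ifP => _ /=; split=> //.
      move=> r r100; rewrite updN ?h1 //; lia.
    by apply: upd_bound.
  + exact: typed_storen.
- move=> c q o v Q S C K hw ty [ex rok h] mt.
  have /and3P[hc hq v99] : [&& ewf c, ewf (adr q o) & v < 99] := hw.
  have ecs : cs (SStW c q o v) = cn c 100 ++ cn (adr q o) 101 ++
      [:: If (NLt 99 100) [:: WStore 101 v] [:: NConst 100 0]] by [].
  rewrite ecs -(catA (cn c 100)) -(catA (cn (adr q o) 101)) in mt.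
  have t99 : 99 < 100 by [].
  have t99' : 99 < 101 by [].
  have [C1 [r1 mt1 e1 p1]] := crun_exp t99 hc ty mt.
  have [C3 [r3 mt3 e3 p3]] := crun_exp t99' hq ty mt1.
  have [C4 [r4 sh4 n4 w4 c4]] := crun_if mt3 ty.
  have ec i : nreg (procs C3 i) 100 = ev S i c by rewrite p3 ?e1.
  have bn i r : nreg (procs C3 i) r <= B by case: (mt3) => _ /(_ i)[].
  have ew : (fun i => wwrite (procs C4 i)) = wrw S c q o v.
    apply: functional_extensionality => i; rewrite /wwrite c4 ec /wrw n4 w4.
    case: ifP => // _; rewrite e3; case: (mt3) => _ /(_ i)[_ _ -> //]; lia.
  have eww i : nwrite (procs C4 i) = None by rewrite /nwrite c4; case: ifP.
  exists (tn c + (tn (adr q o) + (1 + 1))), (step C4),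
    (storew S (wrw S c q o v)).
  split=> //; first by rewrite [dep _]/= expn0 muln1.
  + apply: (crun_cat r1); apply: (crun_cat r3); apply: (crun_cat r4).
    split=> //; split.
    * by move=> i j a x y; rewrite eww.
    * by rewrite ew.
    * by move=> i r; rewrite n4.
    * by move=> a; rewrite sh4; apply: typed_mem.
  + split=> /=; first by rewrite ew sh4 (commit_none _ eww).
    move=> i; case: (mt3) => _ /(_ i)[_ h1 h2 h3]; rewrite /local_step c4 n4 w4.
    case: ifP => _ /=; split=> //.
      move=> r r100; rewrite updN ?h1 //; lia.
    by apply: upd_bound.
- move=> dv r e s IH Q S C K /= /and5P[r99 he ht hsh ws] ty [T0 hT0 h]; rewrite -catA => mt.
  have [C1 r1 mt1] := crun_assign r99 he ty mt.
  have ty1 := typed_setn r99 he ht ty.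
  set W := While _ _ in mt1.
  set S1 := setn S r _ in h mt1 ty1.
  have hsh' : ety (shrink dv r) <= rexp r by case: (dv).
  have tsh : tn (shrink dv r) = 3 by case: (dv).
  have test1 C' S' : matches C' (W :: K) S' -> typed S' ->
      forall i, test_eval (procs C' i) (NLt 99 r) = (0 < nr S' i r).
    move=> m' ty' i; rewrite /= (zero_reg i m' ty').
    case: (m') => _ /(_ i)[_ -> //]; lia.
  (* Induction on the remaining iterations, from any state that matches at the [While]. One
     iteration is a test (1), the body, and the update of the register (4); the final test is the
     last 1. *)
  suff H : forall T C1 S1, typed S1 -> matches C1 (W :: K) S1 ->
      wploop (wp Z L s) dv r Q T S1 -> exists T' C' S',
      [/\ T' <= T * (1 + ts s * L ^ dep s + 4) + 1, crun T' C1 C', matches C' K S',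
                      typed S' & Q S'].
    have [T [C2 [S2 [b2 r2 m2 ty2 h2]]]] := H _ _ _ ty1 mt1 h.
    exists (tn e + 1 + T), C2, S2; split=> //; last exact: crun_cat r1 r2.
    apply: (@leq_trans (tn e + 1 + (L * (1 + ts s * L ^ dep s + 4) + 1))).
      rewrite leq_add2l; apply: (leq_trans b2); rewrite leq_add2r.
      by rewrite leq_mul2r hT0 orbT.
    have -> : tn (shrink dv r) = 3 by case: (dv).
    have l1 : 0 < L ^ dep s by rewrite expn_gt0 L_gt0.
    rewrite expnS; nia.
  move=> {C1 r1 mt1 S1 h ty1 T0 hT0 mt S C ty} T.
  elim: T => [|T IHT] C S ty mt /= [h1 h2].
    have [C2 r2 mt2] : exists2 C', crun 1 C C' & matches C' K S.
      apply: (crun_instr mt) => // i; case: (mt) => hs1 /(_ i)[c1 h11 h12 h13] l.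
      have -> : l = Local K (nreg (procs C i)) (wreg (procs C i)).
        rewrite /l /local_step c1 /W (test1 _ _ mt ty) h1 //.
      by split.
    by exists 1, C2, S; split.
  have [C2 r2 mt2] : exists2 C', crun 1 C C' &
      matches C' (cs s ++ (cassign r (shrink dv r) ++ W :: K)) S.
    exists (Config (fun i => local_step (shared C) (procs C i)) (shared C)).
      case: (mt) => hs hi; apply: crun_quiet.
      + by move=> i; case: (hi i) => hc _ _ _; rewrite /nwrite hc.
      + by move=> i; case: (hi i) => hc _ _ _; rewrite /wwrite hc.
      + by move=> a; rewrite hs; apply: typed_mem.
      + by move=> i r'; case: (hi i).
    split; first by case: mt.
    move=> i; case: (mt) => hs1 /(_ i)[c1 h11 h12 h13].
    have -> : procs (Config (fun i0 => local_step (shared C) (procs C i0)) (shared C)) i =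
        Local (cs s ++ (cassign r (shrink dv r) ++ W :: K)) (nreg (procs C i)) (wreg (procs C i)).
      by rewrite /= /local_step c1 {1}/W (test1 _ _ mt ty) h1 -catA.
    by split.
  have [T1 [C3 [S3 [b3 r3 m3 ty3 h3]]]] := IH _ _ _ _ ws ty h2 mt2.
  have [C4 r4 mt4] := crun_assign r99 hsh ty3 m3.
  have ty4 := typed_setn r99 hsh hsh' ty3.
  have [T2 [C5 [S5 [b5 r5 m5 ty5 h5]]]] := IHT _ _ ty4 mt4 h3.
  exists (1 + (T1 + (4 + T2))), C5, S5; split=> //; first by lia.
  rewrite tsh in r4.
  by apply: (crun_cat r2); apply: (crun_cat r3); apply: (crun_cat r4).
Qed.

(** [exec] asks for legality at all times, also after [T]: a halted configuration is a fixed point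
    of [step]. *)
Lemma crun_exec T prog args m C' :
  crun T (start p prog args m) C' -> halted C' -> legal B C' ->
  exec B p T prog args m (shared C').
Proof.
move=> hr ha hl.
have it C t : crun t C C' -> iter t (@step R p) C = C'.
  by elim: t C => [|t IH] C //= [_ /IH]; rewrite -iterSr.
have st : step C' = C'.
  rewrite /step !commit_none; try by move=> i; rewrite /nwrite /wwrite ha.
  rewrite memory_eta [RHS](@config_eta C' (procs C')) //; congr Config.
  by apply: functional_extensionality => i; rewrite /local_step ha.
rewrite /exec; split; last 1 first.
- by rewrite it.
- move=> t; have [tT|Tt] := ltnP t T; last first.
    rewrite -(subnK Tt) iterD (it _ _ hr).
    have -> : iter (t - T) (@step R p) C' = C' by elim: (t - T) => //= j ->.
    exact: hl.
  elim: T t (start p prog args m) hr tT {it} => [|T IH] // t C /= [hC hr].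
  case: t => [|t] // tT; rewrite iterSr; exact: IH.
- by rewrite it.
Qed.

(** The hypotheses on [args] and [p] establish the exponents that [rexp] assigns to registers 1 to 4
    and to register 0. *)
Theorem wp_exec s Q args m : swf s ->
  (forall r, r < 4 -> nth 0 args r <= b) -> size args <= 4 -> p <= b ^ 3 ->
  (forall a, nmem m a <= b) ->
  wp Z L s Q (State (fun i : 'I_p => nth 0 (nat_of_ord i :: args)) (fun _ _ => 0%E) m) ->
  exists T S', [/\ T <= ts s * L ^ dep s, exec B p T (cs s) args m (me S'),
                   forall a, nmem (me S') a <= b & Q S'].
Proof.
move=> ws ha sa pb hm h.
set S := State _ _ _ in h.
have b1 : 0 < b by rewrite /b addn2.
have ty : typed S.
  split=> // i; split=> //=.
  - case=> [|r] r99 /=; first by apply: leq_trans pb; apply: ltnW.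
    have [r4|r4] := ltnP r 4; first by rewrite /rexp /= (_ : r.+1 <= 4) // expn1 ha.
    by rewrite nth_default //; lia.
  - by rewrite nth_default //; lia.
have mt : matches (start p (cs s) args m) (cs s ++ [::]) S.
  split=> // i; rewrite cats0; split=> //= r.
  apply: (@leq_trans (b ^ 3)); last first.
    by apply: leq_trans hB; apply: leq_pexp2l.
  case: r => [|r] /=; first by apply: leq_trans pb; apply: ltnW.
  have [r4|r4] := ltnP r 4; last by rewrite nth_default //; lia.
  by apply: leq_trans (ha _ r4) _; rewrite -{1}(expn1 b) leq_pexp2l.
have [T [C [S' [bT rT mt' ty' hQ]]]] := wp_sound ws ty h mt.
exists T, S'; split=> //; last by case: ty'.
case: (mt') => hs hi; rewrite -hs; apply: crun_exec rT _ _.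
  by move=> i; case: (hi i).
apply: legal_quiet.
- by move=> i; rewrite /nwrite; case: (hi i) => ->.
- by move=> i; rewrite /wwrite; case: (hi i) => ->.
- by move=> a; rewrite hs; apply: typed_mem.
- by move=> i r; case: (hi i).
Qed.

End Soundness.

(** * Shortest paths with the fewest edges *)

Section Keys.
Variables (R : realDomainType) (n : nat) (G : wdigraph R n).
Notation key := (\bar R *l nat)%type.
Implicit Types (u v w : 'I_n) (p q : seq 'I_n) (x y : key).

Definition walk u w p := path (edge G) u p && (last u p == w).
(** The second component [n] exceeds the number of edges of every simple path and is left unchanged
    by clamping. *)
Definition top_key : key := (+oo%E, n).
Definition pkey u p : key := ((plen G u p)%:E, size p).
Definition mkey u w : key :=
  \big[Order.min/top_key]_(m < n)
    \big[Order.min/top_key]_(p : m.-tuple 'I_n | simple_path G u w p) pkey u p.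

Lemma key_leE (a c : R) (i j : nat) :
  (((a%:E, i) : key) <= (c%:E, j))%O = ((a < c)%R || ((a == c) && (i <= j))).
Proof.
rewrite leEprodlexi /= !lee_fin leEnat; case: (ltgtP a c) => //=.
Qed.

Lemma key_ltE (a c : R) (i j : nat) :
  (((a%:E, i) : key) < (c%:E, j))%O = ((a < c)%R || ((a == c) && (i < j))).
Proof.
rewrite ltEprodlexi /= !lee_fin ltEnat; case: (ltgtP a c) => //=.
Qed.

Lemma plen_cat u p q : plen G u (p ++ q) = (plen G u p + plen G (last u p) q)%R.
Proof.
elim: p u => [|v p IH] u /=; first by rewrite add0r.
by rewrite IH addrA.
Qed.

Lemma walk_cat u v w p q : walk u v p -> walk v w q -> walk u w (p ++ q).
Proof.
move=> /andP[h1 /eqP h2] /andP[h3 /eqP h4].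
by rewrite /walk cat_path h1 last_cat h2 h3 h4 eqxx.
Qed.

Lemma plen_ge0 u p : path (edge G) u p -> (0 <= plen G u p)%R.
Proof.
elim: p u => [|v p IH] u //= /andP[h1 h2].
by apply: addr_ge0; [apply: wt_ge0 | apply: IH].
Qed.

(** A repeated vertex closes a subwalk. Weights are nonnegative, so cutting it out does not lengthen
    the walk, and it removes an edge. *)
Lemma walk_shorten1 u w p : walk u w p -> ~~ uniq (u :: p) ->
  exists q, [/\ walk u w q, size q < size p & (plen G u q <= plen G u p)%R].
Proof.
elim: p u => [|v p IH] u; first by [].
move=> hw0; case: (boolP (u \in v :: p)) => [hu _|hu hq].
  move: hw0; rewrite /walk; case/splitPr: hu => p1 p2.
  rewrite cat_path last_cat /= => /andP[/and3P[h4 h5 h6] h7].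
  exists p2; split; first by rewrite /walk h6 h7.
    by rewrite size_cat /= addnS ltnS leq_addl.
  rewrite plen_cat /= addrA lerDr addr_ge0 ?plen_ge0 //.
  exact: wt_ge0.
have [h1 h2 h3] : [/\ edge G u v, path (edge G) v p & last v p == w].
  by move: hw0; rewrite /walk /= -andbA => /and3P[].
have hq' : ~~ uniq (v :: p) by move: hq; rewrite /= hu /=.
have hw : walk v w p by rewrite /walk h2.
have [q [h4 h5 h6]] := IH v hw hq'.
exists (v :: q); split=> //=; last by rewrite lerD2l.
by move: h4; rewrite /walk /= h1.
Qed.

Lemma walk_simple u w p : walk u w p -> exists2 q, simple_path G u w q &
  (pkey u q <= pkey u p)%O.
Proof.
have [m] := ubnP (size p); elim: m p => // m IH p hm hw.
case: (boolP (uniq (u :: p))) => hu.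
  by exists p => //; move: hw => /andP[h1 h2]; apply/and3P.
have [q [h1 h2 h3]] := walk_shorten1 hw hu.
have [|r h4 h5] := IH q _ h1; first by lia.
exists r => //; apply: (le_trans h5); rewrite key_leE (ltnW h2) andbT.
by rewrite orbC -le_eqVlt.
Qed.

Lemma simple_walk u w p : simple_path G u w p -> walk u w p.
Proof. by case/and3P => h1 h2 _; apply/andP. Qed.

Lemma simple_size u w p : simple_path G u w p -> size p < n.
Proof.
case/and3P => _ _ /card_uniqP /= h; have := max_card [in u :: p].
by rewrite card_ord h.
Qed.

Lemma mkey_le_simple u w p : simple_path G u w p -> (mkey u w <= pkey u p)%O.
Proof.
move=> hp; have hs := simple_size hp.
apply: (le_trans (bigmin_le _ (Ordinal hs) _)).
exact: (@bigmin_le_cond _ _ _ top_key (in_tuple p) (fun t : (size p).-tuple 'I_n => simple_path G u w t)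
  (fun t => pkey u t) hp).
Qed.

Lemma mkey_le u w p : walk u w p -> (mkey u w <= pkey u p)%O.
Proof.
by case/walk_simple=> q h1 h2; apply: le_trans (mkey_le_simple h1) h2.
Qed.

Lemma mkeyP u w : mkey u w = top_key \/
  exists2 p, simple_path G u w p & mkey u w = pkey u p.
Proof.
have hmin (x y : key) (P : key -> Prop) : P x -> P y -> P (Order.min x y).
  by rewrite /Order.min; case: ifP.
rewrite /mkey; elim/big_ind: _ => [|x y hx hy|m _]; first by left.
  exact: (hmin x y (fun z => z = top_key \/ exists2 p, simple_path G u w p & z = pkey u p)).
elim/big_ind: _ => [|x y hx hy|p hp]; first by left.
  exact: (hmin x y (fun z => z = top_key \/ exists2 p, simple_path G u w p & z = pkey u p)).
by right; exists p.
Qed.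

(** The first component of a lexicographic minimum is the minimum of the first components. *)
Lemma mkey_dist u w : (mkey u w).1 = dist G u w.
Proof.
apply/eqP; rewrite eq_le; apply/andP; split.
  apply: le_bigmin; first exact: leey.
  move=> m _; apply: le_bigmin; first exact: leey.
  by move=> p /mkey_le_simple; rewrite leEprodlexi => /andP[].
case: (mkeyP u w) => [->|[p hp ->]]; first exact: leey.
have hs := simple_size hp.
apply: (le_trans (bigmin_le _ (Ordinal hs) _)).
exact: (@bigmin_le_cond _ _ _ +oo%E (in_tuple p) (fun t : (size p).-tuple 'I_n => simple_path G u w t)
  (fun t => (plen G u t)%:E) hp).
Qed.

Lemma mkey_fin u w : ((mkey u w).1 < +oo)%E ->
  exists2 p, simple_path G u w p & mkey u w = pkey u p.
Proof. by case: (mkeyP u w) => [->|]. Qed.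

Lemma mkey_walk u w p : walk u w p -> ((mkey u w).1 < +oo)%E.
Proof.
move=> /mkey_le; rewrite leEprodlexi /= => /andP[h _].
by apply: (le_lt_trans h); apply: ltey.
Qed.

Lemma mkey_refl u : mkey u u = (0%E, 0).
Proof.
have h : walk u u [::] by rewrite /walk /=.
have [p /and3P[h1 h2 h3] e] := mkey_fin (mkey_walk h).
have := mkey_le h; rewrite e key_leE => /orP[].
  by rewrite ltNge plen_ge0.
by rewrite leqn0 size_eq0 => /andP[_ /eqP->].
Qed.

Lemma mkey_ge0 u w : (0 <= (mkey u w).1)%E.
Proof.
case: (mkeyP u w) => [->|[p /and3P[h _ _] ->]]; first exact: leey.
exact: plen_ge0 h.
Qed.

Lemma mkey_snd u w : (mkey u w).2 <= n.
Proof. by case: (mkeyP u w) => [-> //|[p /simple_size h ->]]; apply: ltnW. Qed.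

Lemma mkey_snd_fin u w : ((mkey u w).1 < +oo)%E -> (mkey u w).2 < n.
Proof. by case/mkey_fin => p /simple_size h ->. Qed.

Lemma mkey_inf u w : ~ ((mkey u w).1 < +oo)%E -> mkey u w = top_key.
Proof. by case: (mkeyP u w) => // -[p hp ->] []; apply: ltey. Qed.

Lemma mkey_eq0 u w : ((mkey u w).1 < +oo)%E -> (mkey u w).2 = 0 -> u = w.
Proof.
case/mkey_fin=> p /and3P[_ /eqP h _] -> /= /eqP.
by rewrite size_eq0 => /eqP e; rewrite e in h.
Qed.

Lemma mkey_eq1 u w : ((mkey u w).1 < +oo)%E -> (mkey u w).2 = 1 ->
  edge G u w /\ (mkey u w).1 = (wt G u w)%:E.
Proof.
case/mkey_fin=> -[|v [|v' p]] // /and3P[h1 /eqP h2 _] -> //= _.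
by move: h1 h2; rewrite /= andbT => h1 <-; rewrite addr0.
Qed.

Lemma mkey_edge u w : edge G u w -> (mkey u w <= ((wt G u w)%:E, 1) :> key)%O.
Proof.
move=> h; have hw : walk u w [:: w] by rewrite /walk /= h eqxx.
by have := mkey_le hw; rewrite /pkey /= addr0.
Qed.

Lemma key_add_le (a a' c c' : R) (i i' j j' : nat) :
  (((a%:E, i) : key) <= (a'%:E, i'))%O -> (((c%:E, j) : key) <= (c'%:E, j'))%O ->
  ((((a + c)%:E, i + j) : key) <= ((a' + c')%:E, i' + j'))%O.
Proof.
rewrite !key_leE => /orP[h1|/andP[/eqP-> h1]] /orP[h2|/andP[/eqP-> h2]].
- by rewrite ltrD.
- by rewrite ltrD2r h1.
- by rewrite ltrD2l h2.
- by rewrite eqxx leq_add ?orbT.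
Qed.

(** Exchange argument: cut a best path after [m] edges. If one part were not best, replacing it
    would give a walk, perhaps not simple, that beats the whole path; [mkey_le] covers all walks. *)
Lemma mkey_split u w m : ((mkey u w).1 < +oo)%E -> m <= (mkey u w).2 ->
  exists v, [/\ (mkey u v).2 = m, (mkey u w).1 = ((mkey u v).1 + (mkey v w).1)%E,
    (mkey u w).2 = (mkey u v).2 + (mkey v w).2, ((mkey u v).1 < +oo)%E
  & ((mkey v w).1 < +oo)%E].
Proof.
move=> /mkey_fin[p hp e]; rewrite e /= => hm.
set v := last u (take m p).
have hw := simple_walk hp.
have h1 : walk u v (take m p).
  by move: hw; rewrite /walk -{1}(cat_take_drop m p) cat_path => /andP[/andP[-> _] _] /=.
have h2 : walk v w (drop m p).
  move: hw; rewrite /walk -{1 2}(cat_take_drop m p) cat_path last_cat.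
  by case/andP=> /andP[_ ->] ->.
have ep : pkey u p = ((plen G u (take m p) + plen G v (drop m p))%:E, size (take m p) + size (drop m p)) :> key.
  by rewrite /pkey -{1 2}(cat_take_drop m p) plen_cat size_cat.
have [q1 s1 e1] := mkey_fin (mkey_walk h1).
have [q2 s2 e2] := mkey_fin (mkey_walk h2).
have w1 := simple_walk s1; have w2 := simple_walk s2.
have l1 := mkey_le h1; rewrite e1 in l1.
have l2 := mkey_le h2; rewrite e2 in l2.
have l3 := mkey_le (walk_cat w1 h2); rewrite e ep in l3.
have l4 := mkey_le (walk_cat h1 w2); rewrite e ep in l4.
have lq1 : last u q1 = v by case/andP: w1 => _ /eqP.
rewrite /pkey plen_cat lq1 size_cat in l3.
rewrite /pkey plen_cat -/v size_cat in l4.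
have c1 : pkey u q1 = pkey u (take m p).
  apply/eqP; rewrite eq_le l1 /=; move: l3; rewrite !key_leE.
  case/orP; first by rewrite ltrD2r => ->.
  by case/andP => /eqP/addIr->; rewrite eqxx leq_add2r => ->; rewrite orbT.
have c2 : pkey v q2 = pkey v (drop m p).
  apply/eqP; rewrite eq_le l2 /=; move: l4; rewrite !key_leE.
  case/orP; first by rewrite ltrD2l => ->.
  by case/andP => /eqP/addrI->; rewrite eqxx leq_add2l => ->; rewrite orbT.
exists v; rewrite e1 e2 c1 c2; split=> //; rewrite ?ltey //.
- by rewrite /= size_takel.
- by have := congr1 fst ep.
- by have := congr1 snd ep.
Qed.

Lemma mkey_triangle u v w : ((mkey u v).1 < +oo)%E -> ((mkey v w).1 < +oo)%E ->
  (mkey u w <= (((mkey u v).1 + (mkey v w).1)%E, (mkey u v).2 + (mkey v w).2) :> key)%O.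
Proof.
move=> /mkey_fin[p h1 ->] /mkey_fin[q h2 ->].
have w1 := simple_walk h1; have w2 := simple_walk h2.
have := mkey_le (walk_cat w1 w2).
have lq1 : last u p = v by case/andP: w1 => _ /eqP.
by rewrite /pkey plen_cat lq1 size_cat.
Qed.

(** A closed subwalk of weight zero would not change the length, but it costs edges, so a walk that
    attains the key contains none. *)
Lemma walk_mkey_simple u w p : walk u w p -> pkey u p = mkey u w ->
  simple_path G u w p.
Proof.
move=> hw e; case: (boolP (uniq (u :: p))) => hu.
  by move: hw => /andP[h1 h2]; apply/and3P.
have [q [h1 h2 h3]] := walk_shorten1 hw hu.
have := mkey_le h1; rewrite -e key_leE => /orP[].
  by rewrite ltNge h3.
by rewrite leqNgt h2 andbF.
Qed.

End Keys.

(** * Ranks and approximate distances *)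

Section Rank.
Variables (d : Order.disp_t) (T : orderType d) (I : finType) (g : I -> T).
Hypothesis g_inj : injective g.
Implicit Types (A B : {set I}) (y w : I).

Definition rank A w := #|[set y in A | (g y < g w)%O]|.

Lemma rank_card A w : w \in A -> rank A w < #|A|.
Proof.
move=> hw; apply: proper_card; apply/properP; split.
  by apply/subsetP => y; rewrite inE => /andP[].
by exists w => //; rewrite inE ltxx andbF.
Qed.

Lemma rank_le A y w : (g y <= g w)%O -> rank A y <= rank A w.
Proof.
move=> h; apply: subset_leq_card; apply/subsetP => z; rewrite !inE.
by case/andP=> -> h2 /=; apply: lt_le_trans h2 h.
Qed.

Lemma rank_ltE A y w : y \in A -> (rank A y < rank A w) = (g y < g w)%O.
Proof.
move=> hy; case: (leP (g w) (g y)) => h.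
  by apply/negbTE; rewrite -leqNgt; apply: rank_le.
apply: proper_card; apply/properP; split.
  apply/subsetP => z; rewrite !inE => /andP[-> h2] /=; exact: lt_trans h2 h.
by exists y; rewrite !inE ?ltxx ?andbF // hy.
Qed.

Lemma rank_inj A : {in A &, injective (rank A)}.
Proof.
move=> y w hy hw e; apply: g_inj; apply/eqP; rewrite eq_le !leNgt.
by rewrite -!(rank_ltE _ hy) -!(rank_ltE _ hw) e ltnn.
Qed.

(** Pigeonhole: the ranks in [A] are distinct and below [#|A|]. *)
Lemma rank_surj A r : r < #|A| -> exists2 w, w \in A & rank A w = r.
Proof.
case e: #|A| => [|m] // hr.
have hF : [set (inord (rank A w) : 'I_m.+1) | w in A] = setT.
  apply/eqP; rewrite eqEcard subsetT cardsT card_ord card_in_imset ?e ?leqnn //=.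
  move=> y w hy hw /(congr1 (@nat_of_ord _)).
  rewrite !inordK -?e ?rank_card //; exact: rank_inj.
have : Ordinal hr \in [set (inord (rank A w) : 'I_m.+1) | w in A] by rewrite hF.
case/imsetP => w hw /(congr1 (@nat_of_ord _)) /= ->.
by exists w => //; rewrite inordK // -e rank_card.
Qed.

(** The basis of merging: the position in the union is the position in one's own block plus the
    number of smaller elements in the other. *)
Lemma rankU A B w : [disjoint A & B] -> rank (A :|: B) w = rank A w + rank B w.
Proof.
move=> h; rewrite /rank -cardsUI [X in _ + X](_ : _ = 0); last first.
  apply/eqP; rewrite cards_eq0; apply/eqP/setP => y; rewrite !inE.
  by case hy: (y \in A) => //=; rewrite (disjointFr h hy) andbF.
by rewrite addn0; apply: eq_card => y; rewrite !inE andb_orl.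
Qed.

End Rank.

(** * Tables of upper bounds and the effect of one round *)

Section Approx.
Variables (R : realDomainType) (n : nat) (G : wdigraph R n).
Notation key := (\bar R *l nat)%type.
Implicit Types (u v w y : 'I_n) (f h : 'I_n -> key).
Notation K := (mkey G).

(** Packs the number of edges and the name into one natural number, so that the program breaks ties
    by one comparison; names are below [n], so the order stays lexicographic. *)
Definition okey f w : key := ((f w).1, (f w).2 * n + w).

Lemma okey_ltE f h y w :
  (okey f y < okey h w)%O = (f y < h w)%O || ((f y == h w) && (y < w)).
Proof.
rewrite !ltEprodlexi /= !ltEnat /=.
have -> : ((f y).2 * n + y < (h w).2 * n + w) =
   ((f y).2 < (h w).2) || (((f y).2 == (h w).2) && (y < w)).
  by have := ltn_ord y; have := ltn_ord w; nia.
have -> : (f y == h w) = ((f y).1 == (h w).1) && ((f y).2 == (h w).2).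
  by case: (f y) => a i; case: (h w).
by case: (ltgtP (f y).1 (h w).1) => //=.
Qed.

Lemma okey_inj f : injective (okey f).
Proof.
move=> y w e; apply: val_inj => /=.
have := congr1 (fun x => x.2 %% n) e => /=.
by rewrite !modnMDl !modn_small.
Qed.

Lemma okey_mono f h w : (f w <= h w)%O -> (okey f w <= okey h w)%O.
Proof.
rewrite !leNgt; apply: contra; rewrite okey_ltE ltnn andbF orbF //.
Qed.

Definition rk f w := rank (okey f) setT w.

Lemma rk_lt f w : rk f w < n.
Proof. by have := @rank_card _ _ _ (okey f) setT w (in_setT _); rewrite cardsT card_ord. Qed.

Lemma rk_ltE f y w : (rk f y < rk f w) = (okey f y < okey f w)%O.
Proof. exact: rank_ltE. Qed.

Lemma rk_inj f : injective (rk f).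
Proof. by move=> y w; apply: (rank_inj (@okey_inj f)); rewrite inE. Qed.

Lemma rk_surj f r : r < n -> exists w, rk f w = r.
Proof.
move=> hr; have [|w _ <-] := @rank_surj _ _ _ (okey f) (@okey_inj f) setT r.
  by rewrite cardsT card_ord.
by exists w.
Qed.

Lemma rk_key_lt f y w : (f y < f w)%O -> rk f y < rk f w.
Proof. by move=> h; rewrite rk_ltE okey_ltE h. Qed.

(** From [f] to [h] no key decreases and that of [w] stays, so whatever precedes [w] for [h] already
    did for [f]. *)
Lemma rk_approx f h w : (forall y, (f y <= h y)%O) -> h w = f w -> rk h w <= rk f w.
Proof.
move=> hle e; apply: subset_leq_card; apply/subsetP => y; rewrite !inE /=.
move=> hy; apply: (le_lt_trans (okey_mono (hle y))).
by rewrite (_ : okey f w = okey h w) // /okey e.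
Qed.

(** Used at the end, to identify the neighbours found by sorting the computed table with those of
    the true keys. *)
Lemma rk_exact f h k w : (forall y, (f y <= h y)%O) ->
  (forall y, rk f y <= k -> h y = f y) -> rk f w <= k -> rk h w = rk f w.
Proof.
move=> hle hk hw; apply/eqP; rewrite eqn_leq (rk_approx hle (hk _ hw)) /=.
have e : okey f w = okey h w by rewrite /okey hk.
apply: subset_leq_card; apply/subsetP => y; rewrite !inE /= => hy.
have ey : h y = f y by apply: hk; apply: leq_trans hw; rewrite ltnW // rk_ltE.
by rewrite -e (_ : okey h y = okey f y) // /okey ey.
Qed.

(** The cut at [n] mirrors the clamping of stored numbers; true edge counts are at most [n], so
    lower bounds survive it. *)
Definition kadd (x y : key) : key := ((x.1 + y.1)%E, minn (x.2 + y.2) n).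

Lemma mkey_le_kadd u v w (x y : key) : (K u v <= x)%O -> (K v w <= y)%O ->
  (K u w <= kadd x y)%O.
Proof.
move=> hx hy.
have x0 : (0 <= x.1)%E.
  by apply: le_trans (mkey_ge0 G u v) _; move: hx; rewrite leEprodlexi => /andP[].
have y0 : (0 <= y.1)%E.
  by apply: le_trans (mkey_ge0 G v w) _; move: hy; rewrite leEprodlexi => /andP[].
have top (z : key) : (0 <= z.1)%E -> (z.1 < +oo)%E \/ z.1 = +oo%E.
  by rewrite le_eqVlt; case: (z.1) => [r| |] //; [left; apply: ltey | right].
have cases a b : ((K a b).1 < +oo)%E \/ K a b = top_key R n.
  case: (boolP ((K a b).1 < +oo)%E) => [|/negP /mkey_inf]; first by left.
  by right.
(* An infinite [K u v] forces [x] to be infinite with second component at least [n], so that the sum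
   is [top_key]. *)
case: (cases u v) => h1; last first.
  move: hx; rewrite h1 leEprodlexi /= leye_eq => /andP[/eqP e1].
  rewrite e1 lexx /= leEnat => e2.
  rewrite /kadd e1 addye ?gt_eqF ?(lt_le_trans _ y0) ?ltNy0 //.
  rewrite (minn_idPr (leq_trans e2 (leq_addr _ _))).
  rewrite leEprodlexi /= leey /= leEnat; apply/implyP => _; exact: mkey_snd.
case: (cases v w) => h2; last first.
  move: hy; rewrite h2 leEprodlexi /= leye_eq => /andP[/eqP e1].
  rewrite e1 lexx /= leEnat => e2.
  rewrite /kadd e1 addey ?gt_eqF ?(lt_le_trans _ x0) ?ltNy0 //.
  rewrite (minn_idPr (leq_trans e2 (leq_addl _ _))).
  rewrite leEprodlexi /= leey /= leEnat; apply/implyP => _; exact: mkey_snd.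
have tr := mkey_triangle h1 h2.
have h3 : ((K u w).1 < +oo)%E.
  move: tr; rewrite leEprodlexi => /andP[/= tr _]; apply: (le_lt_trans tr).
  exact: lte_add_pinfty.
have ltop z i : z = +oo%E -> (K u w <= ((z, i) : key))%O.
  by move=> ->; rewrite leEprodlexi /= leey /= leye_eq (lt_eqF h3).
case: (top x x0) => hx1; last first.
  by apply: ltop; rewrite hx1 addye // gt_eqF ?(lt_le_trans _ y0) ?ltNy0.
case: (top y y0) => hy1; last first.
  by apply: ltop; rewrite hy1 addey // gt_eqF ?(lt_le_trans _ x0) ?ltNy0.
case: x y x0 y0 hx1 hy1 hx hy => [[a| |] i] [[c| |] j] //= _ _ _ _.
move=> hx hy.
have [p1 _ e1] := mkey_fin h1; have [p2 _ e2] := mkey_fin h2.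
have [p3 s3 e3] := mkey_fin h3.
rewrite e1 in hx tr; rewrite e2 in hy tr.
have := le_trans tr (key_add_le hx hy); rewrite e3 /kadd /= !key_leE.
case/orP => [->//|/andP[-> h4]]; apply/orP; right.
by rewrite leq_min h4 ltnW // (simple_size s3).
Qed.

Lemma key_add_lt (a c c' : R) (i j j' : nat) :
  (((c%:E, j) : key) < (c'%:E, j'))%O ->
  ((((a + c)%:E, i + j) : key) < ((a + c')%:E, i + j'))%O.
Proof.
rewrite !key_ltE => /orP[h|/andP[/eqP-> h]]; first by rewrite ltrD2l h.
by rewrite eqxx ltn_add2l h orbT.
Qed.

(** For the prefix: if [v] is not [w], it is reached with strictly fewer edges and no larger
    distance. For the suffix: if [y] precedes [w] as seen from [v], going through [v] shows that [y]
    precedes [w] as seen from [u]; a tie of keys either becomes strict or is broken by the same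
    names. *)
Lemma rk_split u v w : ((K u w).1 < +oo)%E -> ((K u v).1 < +oo)%E ->
  ((K v w).1 < +oo)%E -> (K u w).1 = ((K u v).1 + (K v w).1)%E ->
  (K u w).2 = (K u v).2 + (K v w).2 ->
  rk (K u) v <= rk (K u) w /\ rk (K v) w <= rk (K u) w.
Proof.
move=> h1 h2 h3 e1 e2; split.
  have [->//|nvw] := eqVneq v w.
  apply: ltnW; apply: rk_key_lt.
  have : 0 < (K v w).2.
    by rewrite lt0n; apply: contra nvw => /eqP e; apply/eqP; apply: mkey_eq0 e.
  have := mkey_ge0 G v w; move: e1 e2.
  have [p1 _ ->] := mkey_fin h1; have [p2 _ ->] := mkey_fin h2.
  have [p3 _ ->] := mkey_fin h3; rewrite /pkey /= => -[->] -> p30 s30.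
  have {}p30 : (0 <= plen G v p3)%R by [].
  rewrite key_ltE ltrDl -(ltn_add2l (size p2)) addn0 in s30 *.
  by move: p30; rewrite le_eqVlt eq_sym => /orP[/eqP->|->//]; rewrite addr0 eqxx s30 orbT.
apply: subset_leq_card; apply/subsetP => y; rewrite !inE /= !okey_ltE.
move=> hy; have hle : (K v y <= K v w)%O.
  by case/orP: hy => [/ltW|/andP[/eqP->]].
have h4 : ((K v y).1 < +oo)%E.
  by apply: le_lt_trans h3; move: hle; rewrite leEprodlexi => /andP[].
have tr := mkey_triangle h2 h4.
have ew : K u w = (((K u v).1 + (K v w).1)%E, (K u v).2 + (K v w).2) :> key.
  by rewrite -e1 -e2; case: (K u w).
case/orP: hy => [hy|/andP[/eqP hy yw]].
  apply/orP; left; apply: (le_lt_trans tr); rewrite ew; move: hy.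
  have [p2 _ ->] := mkey_fin h2.
  have [p3 _ ->] := mkey_fin h3; have [p4 _ ->] := mkey_fin h4.
  exact: key_add_lt.
move: tr; rewrite hy -ew le_eqVlt => /orP[/eqP->|->//].
by rewrite eqxx yw orbT.
Qed.

Definition approx k H (E : 'I_n -> 'I_n -> key) :=
  [/\ forall u w, (K u w <= E u w)%O, forall u w, (E u w).2 <= n
    & forall u w, rk (K u) w <= k -> (K u w).2 <= H -> E u w = K u w].

Definition einit u w : key :=
  if u == w then (0%E, 0) else
  if edge G u w then ((wt G u w)%:E, 1) else top_key R n.

Lemma approx_init k : approx k 1 einit.
Proof.
split.
- move=> u w; rewrite /einit; case: eqP => [<-|_]; first by rewrite mkey_refl.
  case: ifP => [|_]; first exact: mkey_edge.
  rewrite leEprodlexi leey /= leEnat; apply/implyP => _; exact: mkey_snd.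
- move=> u w; rewrite /einit; case: ifP => // _; case: ifP => //= _.
  by have := ltn_ord u; lia.
- move=> u w hk hH; rewrite /einit; case: eqP => [<-|nuw]; first by rewrite mkey_refl.
  case: (boolP ((K u w).1 < +oo)%E) => h; last first.
    have e := mkey_inf (negP h); rewrite e; case: ifP => // he.
    by have := mkey_edge he; rewrite e leEprodlexi.
  have h1 : (K u w).2 = 1.
    have : (K u w).2 <> 0 by move/(mkey_eq0 h).
    lia.
  have [he e1] := mkey_eq1 h h1; rewrite he -e1 -h1; by case: (K u w).
Qed.

Lemma kadd_mkey u v w : ((K u w).1 < +oo)%E -> (K u w).1 = ((K u v).1 + (K v w).1)%E ->
  (K u w).2 = (K u v).2 + (K v w).2 -> kadd (K u v) (K v w) = K u w.
Proof.
move=> h e1 e2; rewrite /kadd -e1 -e2 (minn_idPl (mkey_snd G u w)).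
by case: (K u w).
Qed.

Lemma top_le (x : key) : x.2 <= n -> (top_key R n <= x)%O -> x = top_key R n.
Proof.
case: x => a i /= hi; rewrite leEprodlexi /= leye_eq => /andP[/eqP-> ].
by rewrite lexx /= leEnat => h; congr pair; apply/eqP; rewrite eqn_leq hi h.
Qed.

(** Cut the best path after [H] edges, or at its end if it is shorter. By [rk_split] the table is
    exact on both parts, and [rk_approx] places the cut vertex among those that are tried. *)
Lemma approx_step k H E E' : approx k H E ->
  (forall u w, exists v, E' u w = kadd (E u v) (E v w)) ->
  (forall u v w, rk (E u) v <= k -> (E' u w <= kadd (E u v) (E v w))%O) ->
  approx k (H + H) E'.
Proof.
move=> [a1 a2 a3] e1 e2.
have b1 u w : (K u w <= E' u w)%O.
  by have [v ->] := e1 u w; apply: mkey_le_kadd.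
have b2 u w : (E' u w).2 <= n by have [v ->] := e1 u w; apply: geq_minr.
split=> // u w hk hH.
case: (boolP ((K u w).1 < +oo)%E) => h; last first.
  have e := mkey_inf (negP h); rewrite e; apply: top_le => //; by rewrite -e.
have [v [s1 s2 s3 s4 s5]] := mkey_split h (geq_minr H (K u w).2).
have [r1 r2] := rk_split h s4 s5 s2 s3.
have euv : E u v = K u v by apply: a3; [lia | rewrite s1 geq_minl].
have evw : E v w = K v w.
  apply: a3; first by lia.
  have : (K v w).2 = (K u w).2 - minn H (K u w).2 by rewrite -s1 s3 addKn.
  lia.
apply/eqP; rewrite eq_le b1 andbT -(kadd_mkey h s2 s3) -euv -evw.
apply: e2; apply: leq_trans (leq_trans r1 hk).
exact: rk_approx (a1 u) euv.
Qed.

(** Unlike in [einit], the diagonal does not get key [(0, 0)]: otherwise [w] itself could be chosen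
    as its own predecessor. *)
Definition ckey v w : key := ((if edge G v w then (wt G v w)%:E else +oo%E), 1).

(** A cycle of lexicographic inequalities forces equality; [s1 < m] shows that the clamping was not
    active. *)
Lemma lex_squeeze (x y a c : R) (s1 s2 i m : nat) :
  (x < y + c)%R || (x == y + c)%R && (s1 <= s2.+1) ->
  (a + c < x)%R || (a + c == x)%R && (minn (i + 1) m <= s1) ->
  (y < a)%R || (y == a)%R && (s2 <= i) -> s1 < m ->
  (x = y + c)%R /\ s1 = s2.+1.
Proof.
case/orP=> [t1|/andP[/eqP t1 t2]]; case/orP=> [t3|/andP[/eqP t3 t4]];
  case/orP=> [t5|/andP[/eqP t5 t6]]; try (by exfalso; lra); move=> t7; split=> //; lia.
Qed.

(** The minimiser [v] need not be a vertex where [E u] is known to be exact. But a true predecessor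
    is among those tried, so [E u v] plus the edge is at most [K u w], which is at most [K u v] plus
    the edge; as [K u v <= E u v], [lex_squeeze] applies. *)
Lemma pred_spec k E u v w (D : key) :
  (forall y, (K u y <= E u y)%O) -> (forall y, rk (K u) y <= k -> E u y = K u y) ->
  D = kadd (E u v) (ckey v w) ->
  (forall v', rk (E u) v' <= k -> (D <= kadd (E u v') (ckey v' w))%O) ->
  rk (K u) w <= k -> ((K u w).1 < +oo)%E -> u <> w ->
  [/\ edge G v w, (K u w).1 = ((K u v).1 + (wt G v w)%:E)%E,
      (K u w).2 = (K u v).2.+1, rk (K u) v <= k & ((K u v).1 < +oo)%E].
Proof.
move=> hle hex eD hD hk hf nuw.
have hp : 0 < (K u w).2.
  by rewrite lt0n; apply/negP => /eqP /(mkey_eq0 hf).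
have [v0 [s1 s2 s3 s4 s5]] := mkey_split hf (leq_pred (K u w).2).
have h1 : (K v0 w).2 = 1 by lia.
have [he ec] := mkey_eq1 s5 h1.
have [r1 _] := rk_split hf s4 s5 s2 s3.
have ev0 : E u v0 = K u v0 by apply: hex; apply: leq_trans hk.
have DK : (D <= K u w)%O.
  have := hD v0 (leq_trans (rk_approx hle ev0) (leq_trans r1 hk)).
  have -> : ckey v0 w = K v0 w by rewrite /ckey he -ec -h1; case: (K v0 w).
  by rewrite ev0 (kadd_mkey hf s2 s3).
have E0 : (0 <= (E u v).1)%E.
  by apply: le_trans (mkey_ge0 G u v) _; move: (hle v); rewrite leEprodlexi => /andP[].
have D1 : (D.1 < +oo)%E.
  by apply: le_lt_trans hf; move: DK; rewrite leEprodlexi => /andP[].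
have hn := mkey_snd_fin hf.
move: D1 DK; rewrite {}eD /kadd /ckey /=; case: ifP => hvw; last first.
  by rewrite addey ?gt_eqF ?(lt_le_trans _ E0) ?ltNy0 // ltxx.
have := hle v; case: (E u v) E0 => -[a| |] i //= E0 hK _ DK.
have Kf : ((K u v).1 < +oo)%E.
  apply: (@le_lt_trans _ _ a%:E); last exact: ltey.
  by move: hK; rewrite leEprodlexi => /andP[].
have tr : (K u w <= (((K u v).1 + (wt G v w)%:E)%E, (K u v).2.+1) :> key)%O.
  have Kvw := mkey_edge hvw.
  have Kvf : ((K v w).1 < +oo)%E.
    apply: (@le_lt_trans _ _ (wt G v w)%:E); last exact: ltey.
    by move: Kvw; rewrite leEprodlexi => /andP[].
  apply: le_trans (mkey_triangle Kf Kvf) _; move: Kvw.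
  have [p2 _ ->] := mkey_fin Kf; have [p3 _ ->] := mkey_fin Kvf => Kvw.
  have := key_add_le (lexx (pkey G u p2)) Kvw; by rewrite addn1.
move: tr DK hK hn; have [p1 _ e1] := mkey_fin hf; have [p2 _ e2] := mkey_fin Kf.
rewrite e1 e2 /= !key_leE => tr DK hK hn.
have [ea ei] : (plen G u p1 = plen G u p2 + wt G v w)%R /\ size p1 = (size p2).+1.
  exact: lex_squeeze tr DK hK hn.
split=> //; last by rewrite ltey.
- by rewrite ea.
- apply: leq_trans hk; apply: ltnW; apply: rk_key_lt.
  rewrite e1 e2 key_ltE ea ei ltrDl ltnSn andbT.
  have := wt_ge0 hvw; rewrite le_eqVlt eq_sym => /orP[/eqP->|->//].
  by rewrite addr0 eqxx orbT.
Qed.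

End Approx.

(** * Nearest neighbours by rank, and paths from predecessors *)

Section Nearest.
Variables (R : realDomainType) (n : nat) (G : wdigraph R n).
Notation key := (\bar R *l nat)%type.
Implicit Types (u v w y : 'I_n).
Notation K := (mkey G).

Definition kth u r := odflt u [pick w | rk (K u) w == r].

Lemma kthK u r : r < n -> rk (K u) (kth u r) = r.
Proof.
move=> hr; rewrite /kth; case: pickP => [w /eqP //|h].
by have [w /eqP] := rk_surj (K u) hr; rewrite h.
Qed.

(** Another vertex at distance zero is still at least one edge away. Neighbours therefore start at
    rank 1. *)
Lemma rk0 u : rk (K u) u = 0.
Proof.
apply/eqP; rewrite cards_eq0; apply/eqP/setP => y; rewrite !inE /=.
apply/negbTE; rewrite okey_ltE mkey_refl; apply/negP.
case/orP=> [|/andP[/eqP e]].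
  rewrite ltEprodlexi /= => /andP[h1]; by rewrite mkey_ge0.
have := @mkey_eq0 _ _ G u y; rewrite e /= => /(_ (ltey _) erefl)->.
by rewrite ltnn.
Qed.

Definition nbrs k u := [seq kth u r.+1 | r <- iota 0 (minn k n.-1)].

Lemma size_nbrs k u : size (nbrs k u) = minn k n.-1.
Proof. by rewrite size_map size_iota. Qed.

Lemma nth_nbrs k u x z : x < minn k n.-1 -> nth z (nbrs k u) x = kth u x.+1.
Proof. by move=> hx; rewrite (nth_map 0) ?size_iota // nth_iota. Qed.

Lemma mem_nbrs k u j : j \in nbrs k u -> rk (K u) j <= k /\ u <> j.
Proof.
case/mapP=> r; rewrite mem_iota => hr ->.
have e : rk (K u) (kth u r.+1) = r.+1 by apply: kthK; lia.
by split; [lia | move=> h; move: e; rewrite -h rk0].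
Qed.

Lemma nearest_nbrs k u : nearest G k u (nbrs k u).
Proof.
exists [seq kth u r.+1 | r <- iota 0 n.-1]; last first.
  by rewrite -map_take take_iota.
have kK r : r < n.-1 -> rk (K u) (kth u r.+1) = r.+1 by move=> ?; apply: kthK; lia.
split.
  apply: uniq_perm.
  - rewrite map_inj_in_uniq ?iota_uniq // => r r'; rewrite !mem_iota => h1 h2 e.
    have := congr1 (rk (K u)) e; rewrite !kK; lia.
  - by rewrite filter_uniq // enum_uniq.
  - move=> w; rewrite mem_filter mem_enum andbT; apply/idP/idP.
      case/mapP=> r; rewrite mem_iota => hr ->; apply/eqP => e.
      have := kK r; rewrite e rk0; lia.
    move=> hw; have h0 : rk (K u) w != 0.
      by apply: contra hw; rewrite -(rk0 u) => /eqP /rk_inj ->.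
    have hn := rk_lt (K u) w.
    apply/mapP; exists (rk (K u) w).-1; first by rewrite mem_iota; lia.
    apply: (@rk_inj _ _ (K u)); rewrite kK; lia.
apply/(sortedP u) => i; rewrite size_map size_iota => hi.
rewrite !(nth_map 0) ?size_iota ?nth_iota //; try lia.
rewrite -!mkey_dist; set a := kth _ _; set c := kth _ _.
have : rk (K u) a < rk (K u) c by rewrite !kK; lia.
by rewrite rk_ltE ltEprodlexi /= => /andP[].
Qed.

(** Ranks increase strictly along a best path. Hence [k + 1] cells hold any path to be reported. *)
Lemma mkey_hops_rk u w : ((K u w).1 < +oo)%E -> (K u w).2 <= rk (K u) w.
Proof.
move e : (K u w).2 => h; elim: h w e => // h IH w e hf.
have hh : h <= (K u w).2 by rewrite e.
have [v [s1 s2 s3 s4 s5]] := mkey_split hf hh.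
have [r1 _] := rk_split hf s4 s5 s2 s3.
apply: leq_ltn_trans (IH v s1 s4) _; rewrite ltn_neqAle r1 andbT.
by apply/eqP => /rk_inj ev; move: s1; rewrite ev e; lia.
Qed.

Section Path.
Variables (k : nat) (u : 'I_n) (pr : 'I_n -> 'I_n).
Hypothesis prP : forall w, rk (K u) w <= k -> ((K u w).1 < +oo)%E -> u <> w ->
  [/\ edge G (pr w) w, (K u w).1 = ((K u (pr w)).1 + (wt G (pr w) w)%:E)%E,
      (K u w).2 = (K u (pr w)).2.+1, rk (K u) (pr w) <= k
    & ((K u (pr w)).1 < +oo)%E].

(** Pointers lead backwards: position [s] of a path with [h] edges is the [h - s]-th predecessor of
    its end, and the start is left out as in [path]. *)
Definition pathto h w := [seq iter (h - s) pr w | s <- iota 1 h].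

Lemma pathto_walk w : rk (K u) w <= k -> ((K u w).1 < +oo)%E ->
  [/\ walk G u w (pathto (K u w).2 w), pkey G u (pathto (K u w).2 w) = K u w
    & iter (K u w).2 pr w = u].
Proof.
move e : (K u w).2 => h; elim: h w e => [|h IH] w e hk hf.
  have ew := mkey_eq0 hf e; rewrite -ew; split=> //; first by rewrite /walk /=.
  by rewrite mkey_refl.
have nuw : u <> w by move=> ew; move: e; rewrite -ew mkey_refl.
have [p1 p2 p3 p4 p5] := prP hk hf nuw.
have e' : (K u (pr w)).2 = h by move: p3; rewrite e => -[].
have [i1 i2 i3] := IH _ e' p4 p5.
have ep : pathto h.+1 w = rcons (pathto h (pr w)) w.
  have ei : iota 1 h.+1 = iota 1 h ++ [:: h.+1] by have := iotaD 1 h 1; rewrite addn1 add1n.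
  rewrite /pathto ei map_cat /= -cats1; congr (_ ++ [:: _]).
    apply/eq_in_map => s; rewrite mem_iota => hs.
    by rewrite subSn -?iterSr //; lia.
  by rewrite subnn.
move: i1 => /andP[w1 /eqP w2].
split; last by rewrite iterSr.
  by rewrite ep /walk rcons_path w1 w2 p1 last_rcons eqxx.
rewrite ep /pkey -cats1 plen_cat w2 /= addr0 size_cat /= addn1.
have [e1 e2] : (plen G u (pathto h (pr w)))%:E = (K u (pr w)).1 /\
    size (pathto h (pr w)) = (K u (pr w)).2 by rewrite -i2.
by rewrite EFinD e1 -p2 e2 e' -e; case: (K u w).
Qed.

Lemma size_pathto h w : size (pathto h w) = h.
Proof. by rewrite size_map size_iota. Qed.

Lemma pathto_shortest w : rk (K u) w <= k -> ((K u w).1 < +oo)%E ->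
  shortest_path G u w (pathto (K u w).2 w).
Proof.
move=> hk hf; have [h1 h2 _] := pathto_walk hk hf; split.
  exact: walk_mkey_simple h1 h2.
by rewrite -mkey_dist; exact: (congr1 fst h2).
Qed.

Lemma nth_pathto w s : rk (K u) w <= k -> ((K u w).1 < +oo)%E -> s <= (K u w).2 ->
  nth u (u :: pathto (K u w).2 w) s = iter ((K u w).2 - s) pr w.
Proof.
move=> hk hf; case: s => [|s] hs /=.
  by rewrite subn0; have [] := pathto_walk hk hf.
by rewrite (nth_map 0) ?size_iota // nth_iota // add1n.
Qed.

End Path.
End Nearest.

(** * Proof rules *)

Section Rules.
Variables (R : realDomainType) (p n Z Lm : nat).
Notation wp := (@wp R p Z Lm).
Implicit Types (S : state R p) (Q : state R p -> Prop).
Local Notation na := (na Z).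
Local Notation wa := (wa Z).

Lemma wp_n r e s Q S (v : 'I_p -> nat) : (forall i, ev S i e = v i) ->
  wp s Q (setn S r v) -> wp (SSeq (SN r e) s) Q S.
Proof. by move=> h; rewrite /= (functional_extensionality _ _ h). Qed.

Lemma wp_wld r a s Q S (v : 'I_p -> \bar R) :
  (forall i, wmem (me S) (ev S i a) = v i) ->
  wp s Q (setw S r v) -> wp (SSeq (SWLd r a) s) Q S.
Proof. by move=> h; rewrite /= (functional_extensionality _ _ h). Qed.

Lemma wp_wadd r x y s Q S (v : 'I_p -> \bar R) :
  (forall i, (wr S i x + wr S i y)%E = v i) ->
  wp s Q (setw S r v) -> wp (SSeq (SWAdd r x y) s) Q S.
Proof. by move=> h; rewrite /= (functional_extensionality _ _ h). Qed.

Lemma wp_wif c r x s Q S (v : 'I_p -> \bar R) :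
  (forall i, (if 0 < ev S i c then wr S i x else wr S i r) = v i) ->
  wp s Q (setw S r v) -> wp (SSeq (SWIf c r x) s) Q S.
Proof. by move=> h; rewrite /= (functional_extensionality _ _ h). Qed.

Lemma wp_seq s1 s2 Q1 Q S : wp s1 Q1 S ->
  (forall S', Q1 S' -> frame Z (nregs s1) (nregions s1) (wregions s1) S S' ->
     wp s2 Q S') -> wp (SSeq s1 s2) Q S.
Proof. exact: wp_frame. Qed.

Lemma wp_winf r s Q S :
  wp s Q (setw S r (fun=> +oo%E)) -> wp (SSeq (SWInf r) s) Q S.
Proof. by []. Qed.

Lemma wp_wzero r s Q S :
  wp s Q (setw S r (fun=> 0%E)) -> wp (SSeq (SWZero r) s) Q S.
Proof. by []. Qed.

Lemma ev_adr S i q o : nr S i 7 = Z -> ev S i (adr q o) = q * Z + ev S i o.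
Proof. by rewrite /ev /adr /= => ->. Qed.

Lemma ev_clamp S i v : nr S i 1 = n -> ev S i (clamp v) = minn (ev S i v) n.
Proof. by rewrite /ev /clamp /n_min /= => ->; lia. Qed.

(** Exclusive writing becomes injectivity of [off] on the processors that store. *)
Lemma wp_stn c q o v s Q S (cd : 'I_p -> bool) (off val : 'I_p -> nat) :
  (forall i, nr S i 7 = Z) -> (forall i, nr S i 1 = n) ->
  (forall i, (0 < ev S i c) = cd i) -> (forall i, ev S i o = off i) ->
  (forall i, ev S i v = val i) -> (forall i, cd i -> off i < Z) ->
  (forall i j, cd i -> cd j -> off i = off j -> i = j) ->
  (forall S', nr S' = nr S -> wr S' = wr S ->
    (forall i, cd i -> na S' q (off i) = minn (val i) n) ->
    (forall a, a < Z -> (forall i, cd i -> off i <> a) -> na S' q a = na S q a) ->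
    (forall q' a, q' != q -> a < Z -> na S' q' a = na S q' a) ->
    wmem (me S') = wmem (me S) -> wp s Q S') ->
  wp (SSeq (SStN c q o v) s) Q S.
Proof.
move=> h7 h1 hc ho hv hZ hinj hQ.
set W := wrn S c q o v.
have eW i : W i = if cd i then Some (q * Z + off i, minn (val i) n) else None.
  by rewrite /W /wrn hc ev_adr // ev_clamp // ho hv.
have ex : exclusive W.
  move=> i j a x y; rewrite !eW; case: ifP => // ci [<- _]; case: ifP => // cj [e _].
  by apply: hinj => //; lia.
have hit f i : cd i -> commit W f (q * Z + off i) = minn (val i) n.
  by move=> ci; apply: (commit_hit _ ex (i := i)); rewrite eW ci.
have miss f a : (forall i, cd i -> q * Z + off i <> a) -> commit W f a = f a.
  move=> ha; apply: commit_miss => i x; rewrite eW; case: ifP => // ci [e _].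
  exact: (ha i ci).
split=> //.
  by move=> i; rewrite hc => ci; split=> //; rewrite ho hZ.
apply: hQ => //.
- by move=> i ci; apply: hit.
- by move=> a aZ ha; apply: miss => i ci e; apply: (ha i ci); lia.
- move=> q' a nq aZ; apply: miss => i ci.
  by apply: (region_neq (hZ i ci) aZ); rewrite eq_sym.
Qed.

Lemma wp_stw c q o r s Q S (cd : 'I_p -> bool) (off : 'I_p -> nat) (val : 'I_p -> \bar R) :
  (forall i, nr S i 7 = Z) ->
  (forall i, (0 < ev S i c) = cd i) -> (forall i, ev S i o = off i) ->
  (forall i, wr S i r = val i) -> (forall i, cd i -> off i < Z) ->
  (forall i j, cd i -> cd j -> off i = off j -> i = j) ->
  (forall S', nr S' = nr S -> wr S' = wr S ->
    (forall i, cd i -> wa S' q (off i) = val i) ->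
    (forall a, a < Z -> (forall i, cd i -> off i <> a) -> wa S' q a = wa S q a) ->
    (forall q' a, q' != q -> a < Z -> wa S' q' a = wa S q' a) ->
    nmem (me S') = nmem (me S) -> wp s Q S') ->
  wp (SSeq (SStW c q o r) s) Q S.
Proof.
move=> h7 hc ho hv hZ hinj hQ.
set W := wrw S c q o r.
have eW i : W i = if cd i then Some (q * Z + off i, val i) else None.
  by rewrite /W /wrw hc ev_adr // ho hv.
have ex : exclusive W.
  move=> i j a x y; rewrite !eW; case: ifP => // ci [<- _]; case: ifP => // cj [e _].
  by apply: hinj => //; lia.
have hit f i : cd i -> commit W f (q * Z + off i) = val i.
  by move=> ci; apply: (commit_hit _ ex (i := i)); rewrite eW ci.
have miss f a : (forall i, cd i -> q * Z + off i <> a) -> commit W f a = f a.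
  move=> ha; apply: commit_miss => i x; rewrite eW; case: ifP => // ci [e _].
  exact: (ha i ci).
split=> //.
  by move=> i; rewrite hc => ci; split=> //; rewrite ho hZ.
apply: hQ => //.
- by move=> i ci; apply: hit.
- by move=> a aZ ha; apply: miss => i ci e; apply: (ha i ci); lia.
- move=> q' a nq aZ; apply: miss => i ci.
  by apply: (region_neq (hZ i ci) aZ); rewrite eq_sym.
Qed.

Lemma lg_gt v : v < 2 ^ lg v.
Proof. exact: trunc_log_ltn. Qed.

Lemma lg_le v j : 0 < v -> j < lg v -> 2 ^ j <= v.
Proof.
move=> v0 hj; apply: (@leq_trans (2 ^ trunc_log 2 v)); first by rewrite leq_exp2l.
exact: trunc_logP.
Qed.

Lemma lg_exp j : lg (2 ^ j) = j.+1.
Proof. by rewrite /lg trunc_expnK. Qed.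

(** [v %/ 2 ^ j] is positive exactly for [j < lg v]. The invariant must ignore [r], which is updated
    after the body. *)
Lemma wp_halve r e s Q S v (I : nat -> state R p -> Prop) :
  0 < v -> lg v <= Lm -> r \notin nregs s ->
  (forall i, ev S i e = v) ->
  (forall j S f, I j S -> I j (setn S r f)) ->
  I 0 S ->
  (forall j S, j < lg v -> (forall i, nr S i r = v %/ 2 ^ j) -> I j S -> wp s (I j.+1) S) ->
  (forall S, I (lg v) S -> Q S) ->
  wp (SLoop true r e s) Q S.
Proof.
move=> v0 hL hr he hI I0 hs hQ; exists (lg v) => //.
set S0 := setn S r _.
have e0 i : nr S0 i r = v %/ 2 ^ 0 by rewrite /S0 /= updE he divn1.
have {}I0 : I 0 S0 by apply: hI.
suff H T j S1 : j + T = lg v -> (forall i, nr S1 i r = v %/ 2 ^ j) -> I j S1 ->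
    wploop (wp s) true r Q T S1 by apply: (H _ 0).
elim: T j S1 {e0 I0} => [|T IH] j S1 hT e0 Ij.
  rewrite addn0 in hT; split; last by apply: hQ; rewrite -hT.
  by move=> i; rewrite e0 hT divn_small ?lg_gt.
split.
  move=> i; rewrite e0 divn_gt0 ?expn_gt0 //; apply: lg_le => //; lia.
have jl : j < lg v by lia.
apply: wp_frame (hs _ _ jl e0 Ij) _ => S' IS' [F1 _ _].
apply: (IH j.+1); first by rewrite addSnnS.
  by move=> i; rewrite /= updE /ev /= F1 // e0 -divnMA -expnSr.
exact: hI.
Qed.

Lemma wp_count r e s Q S v (I : nat -> state R p -> Prop) :
  v <= Lm -> r \notin nregs s ->
  (forall i, ev S i e = v) ->
  (forall j S f, I j S -> I j (setn S r f)) ->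
  I v S ->
  (forall j S, j < v -> (forall i, nr S i r = j.+1) -> I j.+1 S -> wp s (I j) S) ->
  (forall S, I 0 S -> Q S) ->
  wp (SLoop false r e s) Q S.
Proof.
move=> hL hr he hI I0 hs hQ; exists v => //.
set S0 := setn S r _.
have e0 i : nr S0 i r = v by rewrite /S0 /= updE he.
have {}I0 : I v S0 by apply: hI.
suff H T S1 : T <= v -> (forall i, nr S1 i r = T) -> I T S1 ->
    wploop (wp s) false r Q T S1 by apply: H.
elim: T S1 {e0 I0} => [|T IH] S1 hT e0 Ij.
  by split=> //; apply: hQ.
split; first by move=> i; rewrite e0.
apply: wp_frame (hs _ _ hT e0 Ij) _ => S' IS' [F1 _ _].
apply: IH; first exact: ltnW.
  by move=> i; rewrite /= updE /ev /= F1 // e0 subn1.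
exact: hI.
Qed.

End Rules.

(** * The programs *)

Declare Scope nexp_scope.
Delimit Scope nexp_scope with nexp.
Notation "a + b" := (NBin Add a b) : nexp_scope.
Notation "a - b" := (NBin Defs.Sub a b) : nexp_scope.
Notation "a * b" := (NBin Mul a b) : nexp_scope.
Notation "a / b" := (NBin Div a b) : nexp_scope.
Notation "a < b" := (NCmp false a b) : nexp_scope.
Notation "a == b" := (NCmp true a b) : nexp_scope.
Notation "$ r" := (NReg r) (at level 5, format "$ r").
Notation "s1 ;; s2" := (SSeq s1 s2) (at level 81, right associativity).

(* Registers: 0 is the number (u * n + w) * (k + 1) + x of the processor, 1 and 2
   are n and k, 5, 6 and 8 are u, w and x, 7 is the size (n + 2) ^ 3 of a region,
   9 is k + 1 and 10 is 2 ^ lg n.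
   Regions: 0 is the input and the output, 1 is E, 2 and 3 are the candidates for
   a minimum and their middle vertices, 4 and 5 are the ranks and the sorted rows,
   6 has the pointers to predecessors, 7 has the paths, and 8 has lg k. *)
Definition ld q e := NLd (adr q e).
Definition cell e := ($5 * $1 + e)%nexp.
(** The register runs through [2 ^ (lg n - 1), ..., 2, 1], so the loop counter also serves as the
    step of a binary search or the distance in a tree reduction. *)
Definition halving r s := SLoop true r ($10 / NC 2)%nexp s.

(** The cap at [2 n] never takes effect, since [2 ^ lg n <= 2 n]; it gives the doubling a static
    bound. Other [n_min] in loops have the same purpose. *)
Definition p_setup :=
  SN 7 (($1 + NC 2) * ($1 + NC 2) * ($1 + NC 2))%nexp ;;
  SN 9 ($2 + NC 1)%nexp ;;
  SN 5 ($0 / $9 / $1)%nexp ;;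
  SN 6 ($0 / $9 - $5 * $1)%nexp ;;
  SN 8 ($0 - $0 / $9 * $9)%nexp ;;
  SN 10 (NC 1) ;;
  SLoop true 11 ($1) (SN 10 (n_min ($10 + $10) ($1 + $1))%nexp ;; SSkip).

(** A missing edge is recognised by [+oo] being at most the loaded weight. *)
Definition p_init :=
  SWLd 0 (adr 0 (cell $6)) ;;
  SWInf 1 ;;
  SWZero 2 ;;
  SN 14 (NIf ($5 == $6) (NC 0) (NIf (NLeW 1 0) ($1) (NC 1)))%nexp ;;
  SWIf ($5 == $6)%nexp 0 2 ;;
  SStN ($8 < NC 1)%nexp 1 (cell $6) ($14) ;;
  SStW ($8 < NC 1)%nexp 1 (cell $6) 0 ;; SSkip.

(** The count is built from its highest bit down. A strict comparison of weights takes two tests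
    because only [<=] is available. *)
Definition p_search :=
  halving 13 (
    SN 14 (ld 5 (cell ($17 + ($19 + $13 - NC 1))))%nexp ;;
    SWLd 1 (adr 1 (cell $14)) ;;
    SN 22 (ld 1 (cell $14) * $1 + $14)%nexp ;;
    SN 19 (NIf (NIf ($18 < $19 + $13) (NC 0)
                (NIf (NLeW 1 0) (NIf (NLeW 0 1) ($22 < $20) (NC 1)) (NC 0)))
              (n_min ($19 + $13) ($1)) ($19))%nexp ;; SSkip).

(** Register 15 is the block length, recovered from the loop register; 17 and 18 are the start and
    the size of the neighbouring block, where truncated subtraction gives 0 for a block beyond
    [n]. *)
Definition p_merge :=
  SN 15 ($10 / $12 / NC 2)%nexp ;;
  SN 16 ($6 / $15)%nexp ;;
  SN 17 (NIf ($16 - $16 / NC 2 * NC 2) (($16 - NC 1) * $15) (($16 + NC 1) * $15))%nexp ;;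
  SN 18 (n_min ($15) ($1 - $17))%nexp ;;
  SN 19 (NC 0) ;;
  SWLd 0 (adr 1 (cell $6)) ;;
  SN 20 (ld 1 (cell $6) * $1 + $6)%nexp ;;
  p_search ;;
  SN 30 (ld 4 (cell $6) + $19)%nexp ;;
  SStN ($8 < NC 1)%nexp 4 (cell $6) ($30) ;;
  SStN ($8 < NC 1)%nexp 5 (cell ($16 / NC 2 * (NC 2 * $15) + $30)%nexp) ($6) ;; SSkip.

Definition p_sort :=
  SStN ($8 < NC 1)%nexp 4 (cell $6) (NC 0) ;;
  SStN ($8 < NC 1)%nexp 5 (cell $6) ($6) ;;
  halving 12 p_merge ;; SSkip.

(** Candidates are indexed by processor number, so those of one pair are consecutive; the test
    against register 9 keeps the partner in the same group. *)
Definition p_reduce_step :=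
  SWLd 0 (adr 2 ($0)) ;;
  SWLd 1 (adr 2 ($0 + $12)%nexp) ;;
  SN 14 (ld 2 ($0)) ;;
  SN 15 (ld 2 ($0 + $12)%nexp) ;;
  SN 16 (ld 3 ($0 + $12)%nexp) ;;
  SN 17 (NIf ($8 + $12 < $9)
          (NIf (NLeW 1 0) (NIf (NLeW 0 1) ($15 < $14) (NC 1)) (NC 0)) (NC 0))%nexp ;;
  SStN ($17) 2 ($0) ($15) ;;
  SStW ($17) 2 ($0) 1 ;;
  SStN ($17) 3 ($0) ($16) ;; SSkip.

(** The rank is cut at [n - 1] because there are more than [n] candidates when [k = n]. The second
    factor is [E] in the rounds, and the input matrix with one edge for the predecessors. *)
Definition p_cand q h2 :=
  SN 14 (ld 5 (cell (n_min ($8) ($1 - NC 1))))%nexp ;;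
  SWLd 0 (adr 1 (cell $14)) ;;
  SWLd 1 (adr q ($14 * $1 + $6)%nexp) ;;
  SWAdd 0 0 1 ;;
  SN 15 (ld 1 (cell $14) + h2)%nexp ;;
  SStN (NC 1) 2 ($0) ($15) ;;
  SStW (NC 1) 2 ($0) 0 ;;
  SStN (NC 1) 3 ($0) ($14) ;;
  halving 12 p_reduce_step ;; SSkip.

Definition p_round :=
  p_sort ;;
  p_cand 1 (ld 1 ($14 * $1 + $6)%nexp) ;;
  SWLd 0 (adr 2 ($0)) ;;
  SStN ($8 < NC 1)%nexp 1 (cell $6) (ld 2 ($0)) ;;
  SStW ($8 < NC 1)%nexp 1 (cell $6) 0 ;; SSkip.

(** The number of steps back is consumed bit by bit from the lowest, while the pointer table is
    composed with itself. Past the end of a path the truncated subtraction gives 0 steps. *)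
Definition p_paths :=
  p_cand 0 (NC 1) ;;
  SStN ($8 < NC 1)%nexp 6 (cell $6) (ld 3 ($0)) ;;
  SN 14 ($6) ;;
  SN 15 (ld 1 (cell $6) - $8)%nexp ;;
  halving 12 (
    SN 14 (NIf ($15 - $15 / NC 2 * NC 2) (ld 6 (cell $14)) ($14))%nexp ;;
    SN 15 ($15 / NC 2)%nexp ;;
    SStN ($8 < NC 1)%nexp 6 (cell $6) (ld 6 (cell (ld 6 (cell $6)))) ;; SSkip) ;;
  SStN (NC 1) 7 ($0) ($14) ;; SSkip.

Definition p_lgk :=
  SN 14 (NC 0) ;;
  SLoop true 12 ($2) (SN 14 (n_min ($14 + NC 1) ($1))%nexp ;; SSkip) ;;
  SStN ($0 < NC 1)%nexp 8 (NC 0) ($14) ;; SSkip.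

(** Rank 0 is [u] itself, hence the shift by one. Only processors with [w = 0] store. *)
Definition p_output :=
  SN 14 (ld 5 (cell $8)) ;;
  SWLd 0 (adr 1 (cell $14)) ;;
  SN 15 (($6 < NC 1) * ((NC 0 < $8) * ($8 < $1)))%nexp ;;
  SN 24 ($1 * $1 + $5 * $2 + ($8 - NC 1))%nexp ;;
  SStN ($15) 0 ($24) ($14) ;;
  SStW ($15) 0 ($24) 0 ;; SSkip.

Definition p_pre :=
  p_setup ;; p_init ;; halving 11 p_round ;; p_sort ;; p_paths ;; p_lgk ;; p_output.

(** The number of iterations is also cut at the number of vertices, so that a path shorter than
    [lg k] costs no more than its size. *)
Definition p_rep :=
  SN 7 (($1 + NC 2) * ($1 + NC 2) * ($1 + NC 2))%nexp ;;
  SN 14 (ld 1 ($3 * $1 + $4)%nexp) ;;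
  SN 15 (ld 8 (NC 0)) ;;
  SStN ($0 < NC 1)%nexp 0 (NC 0) ($14) ;;
  SLoop false 12 (n_min ($14 + NC 1) ($15))%nexp (
    SN 24 ($0 * $15 + ($12 - NC 1))%nexp ;;
    SStN ($24 < $14 + NC 1)%nexp 0 ($24 + NC 1)%nexp
      (ld 7 (($3 * $1 + $4) * ($2 + NC 1) + $24)%nexp) ;; SSkip) ;;
  SSkip.

Lemma pre_wf : swf p_pre.
Proof. by vm_compute. Qed.

Lemma rep_wf : swf p_rep.
Proof. by vm_compute. Qed.

(** Rounds, levels of merging, and steps of the binary search. *)
Lemma pre_dep : dep p_pre = 3.
Proof. by vm_compute. Qed.

Lemma rep_dep : dep p_rep = 1.
Proof. by vm_compute. Qed.

(** * Correctness of the preprocessing *)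

Lemma sub_divn m d : m - m %/ d * d = m %% d.
Proof. by rewrite {1}(divn_eq m d) addKn. Qed.

Lemma sum_interval m a b : a <= b ->
  \sum_(y < m) (a <= y < b) = minn b m - minn a m.
Proof.
move=> ab; elim: m => [|m IH]; first by rewrite big_ord0; lia.
by rewrite big_ord_recr /= IH; lia.
Qed.

Lemma modn_exp2S r t : r %% 2 ^ t.+1 = r %/ 2 ^ t %% 2 * 2 ^ t + r %% 2 ^ t.
Proof.
rewrite {1}(divn_eq r (2 ^ t)) {1}(divn_eq (r %/ 2 ^ t) 2) mulnDl -addnA -mulnA -expnS.
rewrite modnMDl modn_small // expnS mul2n -addnn.
have := ltn_pmod r (expn_gt0 2 t : 0 < 2 ^ t).
have : r %/ 2 ^ t %% 2 <= 1 by rewrite -ltnS ltn_pmod.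
nia.
Qed.

Lemma iter_div2 (T : Type) (f : T -> T) r t (z : T) :
  iter (r %% 2 ^ t.+1) f z = if odd (r %/ 2 ^ t)
    then iter (2 ^ t) f (iter (r %% 2 ^ t) f z) else iter (r %% 2 ^ t) f z.
Proof. by rewrite modn_exp2S modn2; case: (odd _); rewrite ?mul1n ?mul0n // iterD. Qed.

Lemma lg_le_self m : 0 < m -> lg m <= m.
Proof.
move=> m0; apply: leq_trans (lg_le m0 (ltnSn _)).
exact: ltn_expl.
Qed.

Lemma mul_add_lt (a c x z : nat) : x < a -> z < c -> x * c + z < a * c.
Proof. nia. Qed.

Section Preprocessing.
Variables (R : realDomainType) (n k : nat) (G : wdigraph R n).
Hypotheses (k_gt0 : 0 < k) (k_le_n : k <= n).
Notation key := (\bar R *l nat)%type.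
Local Notation p := (n * n * k.+1).
Local Notation Z := ((n + 2) * (n + 2) * (n + 2)).
Local Notation L := (lg n).
Local Notation wp := (@wp R p Z L).
Local Notation na := (na Z).
Local Notation wa := (wa Z).
Local Notation kadd := (kadd n).
Implicit Types (S : state R p) (u v w y : 'I_n) (i : 'I_p).

Lemma n_gt0 : 0 < n. Proof. exact: leq_trans k_gt0 k_le_n. Qed.

Lemma pu_lt i : i %/ k.+1 %/ n < n.
Proof.
rewrite ltn_divLR ?n_gt0 // ltn_divLR //.
Qed.

Lemma pw_lt i : i %/ k.+1 %% n < n.
Proof. by rewrite ltn_mod n_gt0. Qed.

Lemma px_lt i : i %% k.+1 < k.+1.
Proof. by rewrite ltn_mod. Qed.

Definition pu i : 'I_n := Ordinal (pu_lt i).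
Definition pw i : 'I_n := Ordinal (pw_lt i).
Definition px i : 'I_k.+1 := Ordinal (px_lt i).

Definition proc u w (x : 'I_k.+1) : 'I_p :=
  Ordinal (mul_add_lt (mul_add_lt (ltn_ord u) (ltn_ord w)) (ltn_ord x)).

Lemma pu_proc u w x : pu (proc u w x) = u.
Proof.
apply: val_inj => /=; rewrite divnMDl // (divn_small (ltn_ord x)) addn0.
by rewrite divnMDl ?n_gt0 // (divn_small (ltn_ord w)) addn0.
Qed.

Lemma pw_proc u w x : pw (proc u w x) = w.
Proof.
apply: val_inj => /=; rewrite divnMDl // (divn_small (ltn_ord x)) addn0.
by rewrite modnMDl modn_small.
Qed.

Lemma px_proc u w x : px (proc u w x) = x.
Proof. by apply: val_inj => /=; rewrite modnMDl modn_small. Qed.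

Lemma pidE i : (i : nat) = (pu i * n + pw i) * k.+1 + px i.
Proof. by rewrite /= -divn_eq -divn_eq. Qed.

Lemma procK i : proc (pu i) (pw i) (px i) = i.
Proof. by apply: val_inj; rewrite [RHS]pidE. Qed.

Lemma proc_inj (i j : 'I_p) : pu i = pu j -> pw i = pw j -> px i = px j -> i = j.
Proof. by move=> h1 h2 h3; rewrite -(procK i) h1 h2 h3 procK. Qed.

Lemma cell_inj u w u' w' : u * n + w = u' * n + w' -> u = u' /\ w = w'.
Proof.
move=> e; split; apply: val_inj.
  have := congr1 (fun x => x %/ n) e.
  by rewrite !divnMDl ?n_gt0 // !divn_small // !addn0.
by have := congr1 (fun x => x %% n) e; rewrite /= !modnMDl !modn_small.
Qed.

Lemma cell_lt u w : u * n + w < n * n.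
Proof. exact: mul_add_lt. Qed.

Lemma p_lt_Z : p < Z.
Proof. nia. Qed.

Lemma nn_lt_Z : n * n < Z.
Proof. nia. Qed.

Lemma pid_lt i : i < Z.
Proof. exact: ltn_trans (ltn_ord i) p_lt_Z. Qed.

Lemma cell_Z u w : u * n + w < Z.
Proof. exact: ltn_trans (cell_lt u w) nn_lt_Z. Qed.

Definition envregs := [:: 0; 1; 2; 5; 6; 7; 8; 9; 10].
Definition envf i := nth 0 [:: nat_of_ord i; n; k; 0; 0; nat_of_ord (pu i);
  nat_of_ord (pw i); Z; nat_of_ord (px i); k.+1; 2 ^ L].
Definition env S := forall i r, r \in envregs -> nr S i r = envf i r.

Lemma envE S : env S ->
  (((forall i, nr S i 0 = i) * (forall i, nr S i 1 = n) * (forall i, nr S i 2 = k) *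
   (forall i, nr S i 5 = pu i) * (forall i, nr S i 6 = pw i) * (forall i, nr S i 7 = Z) *
   (forall i, nr S i 8 = px i) * (forall i, nr S i 9 = k.+1) *
   (forall i, nr S i 10 = (2 ^ L)%N)))%type.
Proof. by move=> h; do !split; move=> i; rewrite h. Qed.

Lemma env_frame rs qs ws S S' : env S -> frame Z rs qs ws S S' ->
  all (fun r => r \notin rs) envregs -> env S'.
Proof.
move=> h [h1 _ _] /allP ha i r hr; rewrite h1 ?h //; exact: ha.
Qed.

Lemma env_setn S r f : r \notin envregs -> env S -> env (setn S r f).
Proof.
move=> hr h i r' hr' /=; rewrite updN ?h //.
by apply: contra hr => /eqP<-.
Qed.

Lemma env_setw S r f : env S -> env (setw S r f).
Proof. by []. Qed.

Lemma env_eq S S' : nr S' = nr S -> env S -> env S'.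
Proof. by move=> e h i r; rewrite e; apply: h. Qed.

Lemma L_gt0 : 0 < L. Proof. by []. Qed.

Lemma half_pw : 2 ^ L %/ 2 = 2 ^ L.-1.
Proof. by rewrite -{1}(prednK L_gt0) expnS mulKn. Qed.

Lemma wp_halving r s Q S (I : nat -> state R p -> Prop) :
  env S -> r \notin nregs s ->
  (forall j S f, I j S -> I j (setn S r f)) ->
  I 0 S ->
  (forall j S, j < L -> (forall i, nr S i r = 2 ^ (L.-1 - j)) -> I j S ->
     wp s (I j.+1) S) ->
  (forall S, I L S -> Q S) ->
  wp (halving r s) Q S.
Proof.
move=> hS hr hI I0 hs hQ.
have e : lg (2 ^ L.-1) = L by rewrite lg_exp.
apply: (@wp_halve _ _ _ _ _ _ _ _ _ (2 ^ L.-1) I) => //; rewrite ?e //.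
- by rewrite expn_gt0.
- by move=> i; rewrite /ev /= (envE hS) half_pw.
- move=> j S' hj h; apply: hs => // i; rewrite h.
  by rewrite -{1}(subnK (_ : j <= L.-1)) ?expnD ?mulnK ?expn_gt0 //; lia.
Qed.

Lemma puE i : pu i = i %/ k.+1 %/ n :> nat. Proof. by []. Qed.
Lemma pwE i : pw i = i %/ k.+1 %% n :> nat. Proof. by []. Qed.
Lemma pxE i : px i = i %% k.+1 :> nat. Proof. by []. Qed.
Opaque pu pw px.

Lemma setup_ok m : wp p_setup env
  (State (fun i : 'I_p => nth 0 [:: nat_of_ord i; n; k]) (fun _ _ => 0%E) m).
Proof.
set S0 := State _ _ _.
apply: (wp_n (v := fun _ => Z)) => //.
apply: (wp_n (v := fun _ => k.+1)) => [i|]; first by rewrite /ev /= /upd /= addn1.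
apply: (wp_n (v := fun i => pu i)) => [i|]; first by rewrite puE.
apply: (wp_n (v := fun i => pw i)) => [i|].
  by rewrite /ev /= /upd /= puE pwE sub_divn.
apply: (wp_n (v := fun i => px i)) => [i|].
  by rewrite /ev /= /upd /= pxE sub_divn.
apply: (wp_n (v := fun i => 1)) => //.
set S1 := setn _ _ _.
apply: (@wp_halve _ _ _ _ _ _ _ _ _ n (fun j S => forall i r, r \in envregs ->
   nr S i r = if r == 10 then 2 ^ j else envf i r)) => //.
- exact: n_gt0.
- move=> j S f h i r hr; rewrite /= updN ?h //.
  by apply: contraTneq hr => ->.
- move=> i r; rewrite !inE; do 8![case/orP => [/eqP->//|]]; by move=> /eqP->.
- move=> j S hj _ h.
  apply: (wp_n (v := fun i => 2 ^ j.+1)) => [i|].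
    rewrite /ev /= /n_min /= !(h i) //= /envf /= expnS.
    have := lg_le n_gt0 hj; lia.
  move=> i r hr /=; rewrite /upd; case: eqP => // /eqP /negPf e.
  by rewrite h // e.
- by move=> S h i r hr; rewrite h //; case: eqP => // ->.
Qed.

Definition inp S := forall u w, wa S 0 (u * n + w) = (ckey G u w).1.
Definition tabE (E : 'I_n -> 'I_n -> key) S := forall u w,
  na S 1 (u * n + w) = (E u w).2 /\ wa S 1 (u * n + w) = (E u w).1.

Definition x0 i := (px i < 1).

Lemma cell_proc_inj (i j : 'I_p) : x0 i -> x0 j ->
  pu i * n + pw i = pu j * n + pw j -> i = j.
Proof.
move=> hi hj /cell_inj[h1 h2]; apply: proc_inj => //; apply: val_inj.
by move: hi hj; rewrite /x0; case: (px i) => -[|a] ha; case: (px j) => -[|c] hc.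
Qed.

Lemma x0_proc u w : x0 (proc u w ord0).
Proof. by rewrite /x0 px_proc. Qed.

Lemma stn_cell q e s Q S (f : 'I_n -> 'I_n -> nat) : env S ->
  (forall i, x0 i -> ev S i e = f (pu i) (pw i)) ->
  (forall S', nr S' = nr S -> wr S' = wr S ->
    (forall u w, na S' q (u * n + w) = minn (f u w) n) ->
    (forall q' a, q' != q -> a < Z -> na S' q' a = na S q' a) ->
    wmem (me S') = wmem (me S) -> wp s Q S') ->
  wp (SSeq (SStN ($8 < NC 1)%nexp q (cell $6) e) s) Q S.
Proof.
move=> hS he hQ; have E := envE hS.
apply: (wp_stn (n := n) (cd := x0) (off := fun i => pu i * n + pw i)
  (val := fun i => ev S i e)) => //.
- by move=> i; rewrite E.
- by move=> i; rewrite E.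
- by move=> i; rewrite /ev /= E lt0b.
- by move=> i; rewrite /ev /cell /= !E.
- by move=> i _; apply: cell_Z.
- exact: cell_proc_inj.
move=> S' h1 h2 h3 h4 h5 h6; apply: hQ => // u w.
have := h3 _ (x0_proc u w); rewrite he ?x0_proc // pu_proc pw_proc //.
Qed.

Lemma stw_cell q r s Q S (f : 'I_n -> 'I_n -> \bar R) : env S ->
  (forall i, x0 i -> wr S i r = f (pu i) (pw i)) ->
  (forall S', nr S' = nr S -> wr S' = wr S ->
    (forall u w, wa S' q (u * n + w) = f u w) ->
    (forall q' a, q' != q -> a < Z -> wa S' q' a = wa S q' a) ->
    nmem (me S') = nmem (me S) -> wp s Q S') ->
  wp (SSeq (SStW ($8 < NC 1)%nexp q (cell $6) r) s) Q S.
Proof.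
move=> hS he hQ; have E := envE hS.
apply: (wp_stw (cd := x0) (off := fun i => pu i * n + pw i)
  (val := fun i => wr S i r)) => //.
- by move=> i; rewrite E.
- by move=> i; rewrite /ev /= E lt0b.
- by move=> i; rewrite /ev /cell /= !E.
- by move=> i _; apply: cell_Z.
- exact: cell_proc_inj.
move=> S' h1 h2 h3 h4 h5 h6; apply: hQ => // u w.
have := h3 _ (x0_proc u w); rewrite he ?x0_proc // pu_proc pw_proc //.
Qed.

Lemma init_ok S : env S -> inp S -> wp p_init (tabE (einit G)) S.
Proof.
move=> hS hin; have E := envE hS.
apply: (wp_wld (v := fun i => (ckey G (pu i) (pw i)).1)) => [i|].
  by rewrite -hin /ev /adr /cell /= !E.
apply: wp_winf; apply: wp_wzero.
apply: (wp_n (v := fun i => (einit G (pu i) (pw i)).2)) => [i|].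
  rewrite /ev /= /upd /= !E /einit /ckey /=.
  case: (pu i =P pw i) => [->|/eqP hn]; first by rewrite eqxx.
  have -> : (nat_of_ord (pu i) == pw i) = false by apply/negbTE.
  by case: (edge _ _ _); rewrite ?lexx.
apply: (wp_wif (v := fun i => (einit G (pu i) (pw i)).1)) => [i|].
  rewrite /ev /= /upd /= !E /einit /ckey /=.
  case: (pu i =P pw i) => [->|/eqP hn]; first by rewrite eqxx.
  have -> : (nat_of_ord (pu i) == pw i) = false by apply/negbTE.
  by case: (edge _ _ _).
set S1 := setw _ _ _; have hS1 : env S1 by apply: env_setw; apply: env_setn.
apply: (stn_cell (f := fun u w => (einit G u w).2)) => //.
move=> S2 n2 w2 h2 _ m2.
apply: (stw_cell (f := fun u w => (einit G u w).1)).
- exact: env_eq hS1.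
- by move=> i _; rewrite w2.
move=> S3 n3 w3 h3 _ m3 u w; split=> //.
rewrite /na m3 -/(na S2 1 _) h2; apply/minn_idPl.
by case: (approx_init G 0) => _ h _.
Qed.

(** * Sorting the rows by parallel merging *)

Lemma card_block d q : 0 < d ->
  #|[set y : 'I_n | y %/ d == q]| = minn d (n - q * d).
Proof.
move=> d0; transitivity (\sum_(y < n) (q * d <= y < q * d + d)).
  rewrite -sum1dep_card big_mkcond /=; apply: eq_bigr => y _.
  have -> : (y %/ d == q) = (q * d <= y < q * d + d).
    by rewrite eqn_leq -ltnS ltn_divLR // leq_divRL // mulSn addnC andbC.
  by case: (_ && _).
rewrite sum_interval; lia.
Qed.

Definition blk j q := [set y : 'I_n | y %/ 2 ^ j == q].
Definition brank E j u w := rank (okey (E u : 'I_n -> key)) (blk j (w %/ 2 ^ j)) w.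
(** The block number with its last bit flipped: the other half of the block one level up. *)
Definition sib b := if odd b then b.-1 else b.+1.

Lemma mem_blk j w : w \in blk j (w %/ 2 ^ j).
Proof. by rewrite inE. Qed.

Lemma div2_sib a b : (a %/ 2 == b %/ 2) = (a == b) || (a == sib b).
Proof. by rewrite /sib; case: ifP => ob; lia. Qed.

Lemma blkS j w : blk j.+1 (w %/ 2 ^ j.+1) =
  blk j (w %/ 2 ^ j) :|: blk j (sib (w %/ 2 ^ j)).
Proof. by apply/setP => y; rewrite !inE expnSr !divnMA div2_sib. Qed.

Lemma blk_disjoint j b : [disjoint blk j b & blk j (sib b)].
Proof.
apply/pred0P => y /=; rewrite !inE; apply/negbTE/negP => /andP[/eqP-> /eqP].
by rewrite /sib; case: ifP; lia.
Qed.

Lemma brankS E j u w : brank E j.+1 u w = brank E j u w +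
  rank (okey (E u)) (blk j (sib (w %/ 2 ^ j))) w.
Proof. by rewrite /brank blkS rankU // blk_disjoint. Qed.

(** The last block may be cut off at [n]; the second bound says that positions remain within the
    row. *)
Lemma brank_lt E j u w :
  brank E j u w < 2 ^ j /\ w %/ 2 ^ j * 2 ^ j + brank E j u w < n.
Proof.
have := @rank_card _ _ _ (okey (E u)) _ _ (mem_blk j w).
rewrite card_block ?expn_gt0 // -/(brank E j u w); lia.
Qed.

Lemma card_le_n (A : {set 'I_n}) : #|A| <= n.
Proof. by have := max_card (mem A); rewrite card_ord. Qed.

Definition sorting E j S := [/\ env S, tabE E S,
  forall u w, na S 4 (u * n + w) = brank E j u w
  & forall u w, na S 5 (u * n + (w %/ 2 ^ j * 2 ^ j + brank E j u w)) = w].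

(* The number of elements of a sorted block that precede w is found by binary
   search: it is at least a iff the element of rank a - 1 precedes w. *)
Lemma block_test E j S u w q a : sorting E j S ->
  let A := blk j q in
  let y := na S 5 (u * n + (q * 2 ^ j + (a - 1))) in 0 < a ->
  (a <= rank (okey (E u)) A w) =
  (a <= #|A|) && (((wa S 1 (u * n + y), na S 1 (u * n + y) * n + y) : key) < okey (E u) w)%O.
Proof.
move=> [hS hE h4 h5] A y a0.
case: (leqP a #|A|) => ha /=; last first.
  apply/negbTE; rewrite -ltnNge; apply: leq_trans ha.
  by rewrite ltnS; apply: subset_leq_card; apply/subsetP => z; rewrite inE => /andP[].
have hr : a - 1 < #|A| by lia.
have [z zA ez] := rank_surj (@okey_inj _ _ (E u)) hr.
have zq : z %/ 2 ^ j = q by move: zA; rewrite inE => /eqP.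
have ey : y = z.
  by rewrite /y -(h5 u z) /brank zq ez.
have [e1 e2] := hE u z.
by rewrite ey e1 e2 -/(okey (E u) z) -(rank_ltE _ _ zA) ez; lia.
Qed.

Lemma sorting_setn E j S r f : r \notin envregs -> sorting E j S ->
  sorting E j (setn S r f).
Proof. by move=> hr [h1 h2 h3 h4]; split=> //; apply: env_setn. Qed.

Lemma sorting_setw E j S r f : sorting E j S -> sorting E j (setw S r f).
Proof. by case. Qed.

Definition sibcount E j i :=
  rank (okey (E (pu i) : 'I_n -> key)) (blk j (sib (pw i %/ 2 ^ j))) (pw i).

Lemma search_ok E j S : sorting E j S ->
  (forall i, nr S i 17 = sib (pw i %/ 2 ^ j) * 2 ^ j) ->
  (forall i, nr S i 18 = #|blk j (sib (pw i %/ 2 ^ j))|) ->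
  (forall i, nr S i 19 = 0) ->
  (forall i, nr S i 20 = (E (pu i) (pw i)).2 * n + pw i) ->
  (forall i, wr S i 0 = (E (pu i) (pw i)).1) ->
  wp p_search (fun S' => forall i, nr S' i 19 = sibcount E j i) S.
Proof.
move=> hs h17 h18 h19 h20 hw.
(* After [t] steps the count lies in a window of length [2 ^ (L - t)] that starts at register 19. *)
pose I t S1 := [/\ sorting E j S1,
  forall i, [/\ nr S1 i 17 = sib (pw i %/ 2 ^ j) * 2 ^ j,
      nr S1 i 18 = #|blk j (sib (pw i %/ 2 ^ j))|,
      nr S1 i 20 = (E (pu i) (pw i)).2 * n + pw i
    & wr S1 i 0 = (E (pu i) (pw i)).1]
  & forall i, nr S1 i 19 <= sibcount E j i < nr S1 i 19 + 2 ^ (L - t)].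
have cnt_n i : sibcount E j i <= n.
  apply: leq_trans (card_le_n (blk j (sib (pw i %/ 2 ^ j)))).
  by apply: subset_leq_card; apply/subsetP => z; rewrite inE => /andP[].
apply: (wp_halving (I := I)) => //.
- by case: hs.
- move=> t S1 f [H1 H2 H3]; split=> //; exact: sorting_setn.
- split=> // i; rewrite h19 subn0 add0n /=.
  exact: leq_ltn_trans (cnt_n i) (lg_gt n).
- move=> t S1 ht h13 [H1 H2 H3].
  have E1 := envE (let: And4 h _ _ _ := H1 in h).
  pose st := 2 ^ (L.-1 - t).
  pose yy i := na S1 5 (pu i * n + (sib (pw i %/ 2 ^ j) * 2 ^ j + (nr S1 i 19 + st - 1))).
  apply: (wp_n (v := yy)) => [i|].
    rewrite /ev /ld /cell /adr /= !E1 h13; case: (H2 i) => -> _ _ _ //.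
  apply: (wp_wld (v := fun i => wa S1 1 (pu i * n + yy i))) => [i|].
    by rewrite /ev /cell /adr /= /upd /= !E1.
  apply: (wp_n (v := fun i => na S1 1 (pu i * n + yy i) * n + yy i)) => [i|].
    by rewrite /ev /ld /cell /adr /= /upd /= !E1.
  apply: (wp_n (v := fun i => if nr S1 i 19 + st <= sibcount E j i then nr S1 i 19 + st
    else nr S1 i 19)) => [i|].
    rewrite /ev /n_min /= /upd /= !E1 h13 -/st; case: (H2 i) => e17 e18 e20 e0.
    have st0 : 0 < nr S1 i 19 + st by rewrite /st addn_gt0 expn_gt0 orbT.
    have := block_test (pu i) (pw i) (sib (pw i %/ 2 ^ j)) H1 st0.
    rewrite -/(sibcount E j i) -/(yy i) e18 e20 e0 ltEprodlexi /= ltEnat /= ltnNge.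
    have cn := cnt_n i; set c := nr S1 i 19.
    case: (leqP (c + st) #|_|) => hl /=; last by move=> ->.
    case: (wa S1 1 _ <= _)%E => /=; last by move=> ->.
    case: (_ <= wa S1 1 _)%E => /=; last by move=> h; rewrite h; lia.
    by case: (~~ _) => /= h; rewrite h //; lia.
  split.
  + by do ?[apply: sorting_setn => // | apply: sorting_setw].
  + by move=> i /=; rewrite /upd /=; apply: H2.
  + move=> i /=; rewrite /upd /=; have := H3 i.
    have -> : L - t = (L.-1 - t).+1 by lia.
    have -> : L - t.+1 = L.-1 - t by lia.
    rewrite expnS -/st; case: (leqP (nr S1 i 19 + st) (sibcount E j i)); lia.
- move=> S1 [_ _ H3] i; have := H3 i; rewrite subnn expn0; lia.
Qed.

Definition merge_q E j i := pw i %/ 2 ^ j.+1 * 2 ^ j.+1 + brank E j.+1 (pu i) (pw i).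

Lemma merge_ok E j S : j < L -> (forall i, nr S i 12 = 2 ^ (L.-1 - j)) ->
  sorting E j S -> wp p_merge (sorting E j.+1) S.
Proof.
move=> jL h12 hs; case: (hs) => hS hE h4 h5; have E1 := envE hS.
apply: (wp_n (v := fun i => 2 ^ j)) => [i|].
  rewrite /ev /= !E1 h12.
  have -> : 2 ^ L = 2 ^ j.+1 * 2 ^ (L.-1 - j) by rewrite -expnD; congr (_ ^ _); lia.
  by rewrite mulnK ?expn_gt0 // expnSr mulnK.
apply: (wp_n (v := fun i => pw i %/ 2 ^ j)) => [i|].
  by rewrite /ev /= /upd /= !E1.
apply: (wp_n (v := fun i => sib (pw i %/ 2 ^ j) * 2 ^ j)) => [i|].
  rewrite /ev /= /upd /= sub_divn modn2 lt0b /sib; case: ifP => _; rewrite ?addn1 ?subn1 //.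
apply: (wp_n (v := fun i => #|blk j (sib (pw i %/ 2 ^ j))|)) => [i|].
  rewrite /ev /n_min /= /upd /= !E1 card_block ?expn_gt0 //; lia.
apply: (wp_n (v := fun i => 0)) => //.
apply: (wp_wld (v := fun i => (E (pu i) (pw i)).1)) => [i|].
  by rewrite /ev /cell /adr /= /upd /= !E1; case: (hE (pu i) (pw i)).
apply: (wp_n (v := fun i => (E (pu i) (pw i)).2 * n + pw i)) => [i|].
  rewrite /ev /ld /cell /adr /= /upd /= !E1; case: (hE (pu i) (pw i)) => e _.
  by rewrite -e.
set S1 := setn _ _ _.
have hs1 : sorting E j S1.
  by do ?[apply: sorting_setn => // | apply: sorting_setw].
have h16 i : nr S1 i 16 = pw i %/ 2 ^ j by [].
have h15 i : nr S1 i 15 = 2 ^ j by [].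
have hsr : wp p_search (fun S' => forall i, nr S' i 19 = sibcount E j i) S1.
  by apply: search_ok.
apply: (wp_seq hsr) => {hsr} S2 h19 F.
case: (F) => Fr Fn Fw.
have hS2 : env S2 by apply: env_frame F _; [case: hs1 | ].
have E2 := envE hS2.
have m4 u w : na S2 4 (u * n + w) = brank E j u w.
  by rewrite Fn //; first [exact: h4 | exact: cell_Z].
have hE2 : tabE E S2.
  move=> u w; have [e1 e2] := hE u w.
  by split; rewrite (Fn, Fw) //; first [exact: e1 | exact: e2 | exact: cell_Z].
apply: (wp_n (v := fun i => brank E j.+1 (pu i) (pw i))) => [i|].
  by rewrite /ev /ld /cell /adr /= !E2 -/(na S2 4 _) m4 h19 brankS.
set S3 := setn _ _ _.
have hS3 : env S3 by apply: env_setn.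
apply: (stn_cell (f := fun u w => brank E j.+1 u w)) => //.
move=> S4 n4 w4 m44 o4 wm4.
have hS4 : env S4 by apply: env_eq hS3.
have E4 := envE hS4.
have qlt i : merge_q E j i < n by case: (brank_lt E j.+1 (pu i) (pw i)).
(* The quotient of a position by the block length determines the block, and ranks within a block are
   distinct. *)
have minj i i' : x0 i -> x0 i' -> pu i * n + merge_q E j i = pu i' * n + merge_q E j i' -> i = i'.
  move=> xi xi' e; apply: cell_proc_inj => //.
  have [eu eq] := @cell_inj (pu i) (Ordinal (qlt i)) (pu i') (Ordinal (qlt i')) e.
  have {}eq : merge_q E j i = merge_q E j i' := congr1 (@nat_of_ord n) eq.
  have [b1 _] := brank_lt E j.+1 (pu i) (pw i).
  have [b2 _] := brank_lt E j.+1 (pu i') (pw i').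
  have e1 : pw i %/ 2 ^ j.+1 = pw i' %/ 2 ^ j.+1.
    have := congr1 (fun x => x %/ 2 ^ j.+1) eq.
    by rewrite /merge_q !divnMDl ?expn_gt0 // (divn_small b1) (divn_small b2) !addn0.
  have e2 : brank E j.+1 (pu i) (pw i) = brank E j.+1 (pu i) (pw i').
    by move: eq; rewrite /merge_q e1 -eu => /addnI.
  have -> : pw i = pw i'; last by rewrite eu.
  apply: (rank_inj (@okey_inj _ _ (E (pu i))) (A := blk j.+1 (pw i %/ 2 ^ j.+1))).
  - exact: mem_blk.
  - rewrite e1; exact: mem_blk.
  - by move: e2; rewrite /brank e1.
apply: (wp_stn (n := n) (cd := x0) (off := fun i => pu i * n + merge_q E j i)
  (val := fun i => pw i)).
- by move=> i; rewrite E4.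
- by move=> i; rewrite E4.
- by move=> i; rewrite /ev /= E4 lt0b.
- move=> i; rewrite /ev /cell /= !E4 n4 /= /upd /= !Fr // h15 h16.
  by rewrite /merge_q -divnMA -expnSr -expnS.
- by move=> i; rewrite /ev /= E4.
- by move=> i _; apply: ltn_trans nn_lt_Z; apply: (cell_lt (pu i) (Ordinal (qlt i))).
- exact: minj.
move=> S5 n5 w5 h55 _ o5 wm5; split.
- exact: env_eq hS4.
- move=> u w; rewrite o5 ?o4 //; try exact: cell_Z.
  by have := hE2 u w; rewrite /wa wm5 wm4.
- move=> u w; rewrite o5 ?m44 //; last exact: cell_Z.
  apply/minn_idPl; case: (brank_lt E j.+1 u w) => _ h.
  exact: leq_trans (leq_addl _ _) (ltnW h).
- move=> u w; have := h55 _ (x0_proc u w); rewrite /merge_q pu_proc pw_proc => ->.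
  by apply/minn_idPl; apply: ltnW.
Qed.

Definition sortedt (E : 'I_n -> 'I_n -> key) S := forall u w, na S 5 (u * n + rk (E u) w) = w.

Lemma sort_ok E S : env S -> tabE E S -> wp p_sort (sortedt E) S.
Proof.
move=> hS hE; have E1 := envE hS.
apply: (stn_cell (f := fun u w => 0)) => //.
move=> S1 n1 w1 h1 o1 m1.
have hS1 : env S1 by apply: env_eq hS.
apply: (stn_cell (f := fun u w => w)) => //.
  by move=> i _; rewrite /ev /= (envE hS1).
move=> S2 n2 w2 h2 o2 m2.
have hS2 : env S2 by apply: env_eq hS1.
have b0 u w : brank E 0 u w = 0.
  by have [] := brank_lt E 0 u w; rewrite expn0 ltnS leqn0 => /eqP.
change (wp (halving 12 p_merge) (sortedt E) S2).
apply: (wp_halving (I := sorting E)) => //.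
- by move=> j S' f; apply: sorting_setn.
- split=> //.
  + move=> u w; rewrite o2 ?o1 //; try exact: cell_Z.
    by have := hE u w; rewrite /wa m2 m1.
  + by move=> u w; rewrite o2 ?h1 ?b0 ?min0n //; exact: cell_Z.
  + move=> u w; rewrite b0 expn0 divn1 muln1 addn0 h2.
    by apply/minn_idPl; apply: ltnW.
- by move=> j S' hj h12 hs; apply: merge_ok.
move=> S' [_ _ _ h5] u w; rewrite -[RHS](h5 u w); congr (na _ _ (_ + _)).
(* Since [n < 2 ^ L], the only block left is the whole row, where [brank] is [rk]. *)
have d0 y : y %/ 2 ^ L = 0.
  by apply: divn_small; apply: ltn_trans (ltn_ord y) (lg_gt n).
rewrite d0 mul0n add0n /brank d0 /rk; congr (rank _ _ _).
by apply/setP => y; rewrite !inE d0 eqxx.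
Qed.

(** * Minimum over the middle vertices by tree reduction *)

Lemma stn_pid c q e s Q S (cd : 'I_p -> bool) : env S ->
  (forall i, (0 < ev S i c) = cd i) ->
  (forall S', nr S' = nr S -> wr S' = wr S ->
    (forall i, na S' q i = if cd i then minn (ev S i e) n else na S q i) ->
    (forall q' a, q' != q -> a < Z -> na S' q' a = na S q' a) ->
    wmem (me S') = wmem (me S) -> wp s Q S') ->
  wp (SSeq (SStN c q ($0) e) s) Q S.
Proof.
move=> hS hc hQ; have E := envE hS.
apply: (wp_stn (n := n) (cd := cd) (off := fun i => i) (val := fun i => ev S i e)) => //.
- by move=> i; rewrite E.
- by move=> i; rewrite E.
- by move=> i; rewrite /ev /= E.
- by move=> i _; apply: pid_lt.
- by move=> i i' _ _ /val_inj.
move=> S' h1 h2 h3 h4 h5 h6; apply: hQ => // i.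
case: ifP => hi; first exact: h3.
apply: h4; first exact: pid_lt.
by move=> i' hi' /val_inj ei; rewrite ei hi in hi'.
Qed.

Lemma stw_pid c q r s Q S (cd : 'I_p -> bool) : env S ->
  (forall i, (0 < ev S i c) = cd i) ->
  (forall S', nr S' = nr S -> wr S' = wr S ->
    (forall i, wa S' q i = if cd i then wr S i r else wa S q i) ->
    (forall q' a, q' != q -> a < Z -> wa S' q' a = wa S q' a) ->
    nmem (me S') = nmem (me S) -> wp s Q S') ->
  wp (SSeq (SStW c q ($0) r) s) Q S.
Proof.
move=> hS hc hQ; have E := envE hS.
apply: (wp_stw (cd := cd) (off := fun i => i) (val := fun i => wr S i r)) => //.
- by move=> i; rewrite E.
- by move=> i; rewrite /ev /= E.
- by move=> i _; apply: pid_lt.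
- by move=> i i' _ _ /val_inj.
move=> S' h1 h2 h3 h4 h5 h6; apply: hQ => // i.
case: ifP => hi; first exact: h3.
apply: h4; first exact: pid_lt.
by move=> i' hi' /val_inj ei; rewrite ei hi in hi'.
Qed.

Definition skey S (a : nat) : key := (wa S 2 a, na S 2 a).

Section Reduce.
Variables (c : 'I_p -> key) (vx : 'I_p -> 'I_n).
Hypothesis c_le : forall i, (c i).2 <= n.

Definition same_cell i (i' : 'I_p) := pu i' = pu i /\ pw i' = pw i.

(** Each cell holds a genuine candidate of its own pair, with its middle vertex; and every candidate
    is matched or beaten by a cell in a prefix whose length halves at each step. *)
Definition reducing t S := [/\ env S,
  forall i, exists i', [/\ same_cell i i', skey S i = c i' & na S 3 i = vx i']
  & forall i, exists i', [/\ same_cell i i', px i' < 2 ^ (L - t) & (skey S i' <= c i)%O]].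

Lemma reduce_step_ok t S : t < L -> (forall i, nr S i 12 = 2 ^ (L.-1 - t)) ->
  reducing t S -> wp p_reduce_step (reducing t.+1) S.
Proof.
move=> tL; set m := 2 ^ (L.-1 - t) => h12 [hS hA hB]; have E := envE hS.
pose cd i := (px i + m < k.+1) && (skey S (i + m) < skey S i)%O.
apply: (wp_wld (v := fun i => wa S 2 i)) => [i|].
  by rewrite /ev /adr /= !E.
apply: (wp_wld (v := fun i => wa S 2 (i + m))) => [i|].
  by rewrite /ev /adr /= !E h12.
apply: (wp_n (v := fun i => na S 2 i)) => [i|].
  by rewrite /ev /ld /adr /= !E.
apply: (wp_n (v := fun i => na S 2 (i + m))) => [i|].
  by rewrite /ev /ld /adr /= /upd /= !E h12.
apply: (wp_n (v := fun i => na S 3 (i + m))) => [i|].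
  by rewrite /ev /ld /adr /= /upd /= !E h12.
apply: (wp_n (v := cd)) => [i|].
  rewrite /ev /= /upd /= !E h12 /cd /skey ltEprodlexi /= ltEnat /=.
  case: (_ < k.+1) => //=.
  case: (wa S 2 (i + m) <= _)%E => //=; case: (_ <= wa S 2 (i + m))%E => //=.
set S1 := setn _ _ _.
have hS1 : env S1 by do ?[apply: env_setn => // | apply: env_setw].
have partner i : px i + m < k.+1 -> exists i', [/\ same_cell i i', px i' = px i + m :> nat &
    i + m = i' :> nat].
  move=> hm; exists (proc (pu i) (pw i) (Ordinal hm)).
  rewrite /same_cell pu_proc pw_proc px_proc; split=> //=.
  by rewrite {1}(pidE i) addnA.
apply: (stn_pid (cd := cd)) => //.
  by move=> i; rewrite /ev /= /upd /= lt0b.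
move=> S2 n2 w2 a2 o2 m2.
have hS2 : env S2 by apply: env_eq hS1.
apply: (stw_pid (cd := cd)) => //.
  by move=> i; rewrite /ev /= n2 /= /upd /= lt0b.
move=> S3 n3 w3 a3 o3 m3.
have hS3 : env S3 by apply: env_eq hS2.
apply: (stn_pid (cd := cd)) => //.
  by move=> i; rewrite /ev /= n3 n2 /= /upd /= lt0b.
move=> S4 n4 w4 a4 o4 m4.
have na_le i : na S 2 i <= n.
  by have [i' [_ e _]] := hA i; rewrite (congr1 snd e : na S 2 i = _).
have k4 i : skey S4 i = if cd i then skey S (i + m) else skey S i.
  rewrite /skey (_ : wa S4 2 i = wa S3 2 i); last by rewrite /wa m4.
  rewrite o4 ?pid_lt // (_ : na S3 2 i = na S2 2 i); last by rewrite /na m3.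
  rewrite a3 a2 w2 /= /upd /= (_ : wa S2 2 i = wa S 2 i); last by rewrite /wa m2.
  case: ifP => // /andP[hm _]; congr pair; rewrite /ev /= /upd /=.
  by have [i' [_ _ ->]] := partner _ hm; apply/minn_idPl.
have v4 i : na S4 3 i = if cd i then na S 3 (i + m) else na S 3 i.
  rewrite a4 (_ : na S3 3 i = na S2 3 i); last by rewrite /na m3.
  rewrite o2 ?pid_lt //; case: ifP => // /andP[hm _].
  rewrite /ev /= n3 n2 /= /upd /=.
  have [i' [_ _ ->]] := partner _ hm; have [i'' [_ _ ->]] := hA i'.
  by apply/minn_idPl; apply: ltnW.
have le4 i : (skey S4 i <= skey S i)%O.
  by rewrite k4; case: ifP => // /andP[_ /ltW].
split; first exact: env_eq hS3.
- move=> i; rewrite k4 v4; case: ifP => [/andP[hm _]|_]; last exact: hA.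
  have [i1 [[u1 w1] _ ->]] := partner _ hm; have [i2 [[u2 w2'] e1 e2]] := hA i1.
  by exists i2; rewrite /same_cell u2 w2' u1 w1.
- move=> i; have [i1 [[u1 w1] x1 l1]] := hB i.
  have -> : L - t.+1 = L.-1 - t by lia.
  have eL : 2 ^ (L - t) = m + m.
    have -> : L - t = (L.-1 - t).+1 by lia.
    by rewrite expnS -/m mul2n addnn.
  rewrite eL -/m in x1 *.
  (* A good cell in the upper half hands its value over to the cell [m] below it, unless that one is
     at least as good. *)
  case: (ltnP (px i1) m) => hx.
    by exists i1; split=> //; apply: le_trans l1.
  have hx' : px i1 - m < k.+1 by have := ltn_ord (px i1); lia.
  pose i2 := proc (pu i1) (pw i1) (Ordinal hx').
  have x2 : px i2 = px i1 - m :> nat by rewrite px_proc.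
  have hm : px i2 + m < k.+1 by rewrite x2 subnK.
  have [i3 [[u3 w3'] x3 e3]] := partner _ hm.
  have e31 : i3 = i1.
    apply: proc_inj; rewrite ?u3 ?w3' ?pu_proc ?pw_proc //.
    by apply: val_inj; rewrite /= x3 x2 subnK.
  exists i2; split; first by rewrite /same_cell pu_proc pw_proc.
    by rewrite x2; lia.
  apply: le_trans l1; rewrite k4 /cd hm e3 e31 /=.
  by case: ltP.
Qed.

End Reduce.

Definition cand_spec E (M : 'I_n -> 'I_n -> key) S := forall u w, exists v,
  [/\ na S 3 (proc u w ord0) = v, skey S (proc u w ord0) = kadd (E u v : key) (M v w)
    & forall v', rk (E u) v' <= k ->
        (kadd (E u v) (M v w) <= kadd (E u v') (M v' w))%O].

Lemma cand_ok q h2 E M S : env S -> tabE E S -> sortedt E S ->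
  (forall v w, wa S q (v * n + w) = (M v w).1) ->
  (forall S1 i v, env S1 -> me S1 = me S -> nr S1 i 14 = v ->
     ev S1 i h2 = (M v (pw i)).2) ->
  wp (p_cand q h2) (cand_spec E M) S.
Proof.
move=> hS hE hs hq hh; have E1 := envE hS.
have [vx hvx] : exists vx : 'I_p -> 'I_n, forall i,
    rk (E (pu i)) (vx i) = minn (px i) n.-1.
  apply: (@fin_all_exists _ (fun=> 'I_n) (fun i v => rk (E (pu i)) v = minn (px i) n.-1)) => i.
  by apply: rk_surj; have := n_gt0; lia.
pose c i := kadd (E (pu i) (vx i)) (M (vx i) (pw i)).
have c_le i : (c i).2 <= n by apply: geq_minr.
apply: (wp_n (v := fun i => vx i)) => [i|].
  rewrite /ev /ld /cell /adr /n_min /= !E1.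
  have -> : n - 1 - (n - 1 - px i) = minn (px i) n.-1 by lia.
  by rewrite -hvx; apply: hs.
apply: (wp_wld (v := fun i => (E (pu i) (vx i)).1)) => [i|].
  by rewrite /ev /cell /adr /= /upd /= !E1; case: (hE (pu i) (vx i)).
apply: (wp_wld (v := fun i => (M (vx i) (pw i)).1)) => [i|].
  by rewrite /ev /adr /= /upd /= !E1 -hq.
apply: (wp_wadd (v := fun i => (c i).1)) => [i|].
  by rewrite /= /upd.
set S1 := setw _ _ _.
have hS1 : env S1 by do ?[apply: env_setn => // | apply: env_setw].
apply: (wp_n (v := fun i => (E (pu i) (vx i)).2 + (M (vx i) (pw i)).2)) => [i|].
  rewrite /ev /= -/(ev S1 i h2) (hh S1 i (vx i)) // /ld /adr /cell /= /upd /= !E1.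
  by case: (hE (pu i) (vx i)) => <- _.
set S2 := setn _ _ _.
have hS2 : env S2 by apply: env_setn.
apply: (stn_pid (cd := fun=> true)) => //.
move=> S3 n3 w3 a3 o3 m3.
have hS3 : env S3 by apply: env_eq hS2.
apply: (stw_pid (cd := fun=> true)) => //.
move=> S4 n4 w4 a4 o4 m4.
have hS4 : env S4 by apply: env_eq hS3.
apply: (stn_pid (cd := fun=> true)) => //.
move=> S5 n5 w5 a5 o5 m5.
have hS5 : env S5 by apply: env_eq hS4.
have k5 i : skey S5 i = c i.
  rewrite /skey (_ : wa S5 2 i = wa S4 2 i); last by rewrite /wa m5.
  by rewrite a4 w3 o5 ?pid_lt // (_ : na S4 2 i = na S3 2 i) /na ?m4 // -/(na S3 2 i) a3.
have v5 i : na S5 3 i = vx i.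
  rewrite a5 /ev /= n4 n3 /= /upd /=; apply/minn_idPl; exact: ltnW.
change (wp (halving 12 p_reduce_step) (cand_spec E M) S5).
apply: (wp_halving (I := reducing c vx)) => //.
- by move=> t S' f [H1 H2 H3]; split=> //; apply: env_setn.
- split=> //.
    by move=> i; exists i.
  move=> i; exists i; rewrite k5 subn0; split=> //.
  apply: leq_trans (ltn_ord _) _; exact: leq_ltn_trans k_le_n (lg_gt n).
- by move=> t S' tL h12 hr; apply: reduce_step_ok.
move=> S' [_ hA hB] u w.
have [i1 [[u1 w1] e1 e2]] := hA (proc u w ord0).
rewrite pu_proc in u1; rewrite pw_proc in w1.
exists (vx i1); split=> //; first by rewrite e1 /c u1 w1.
move=> v' hv'.
have hx : rk (E u) v' < k.+1 by [].
pose i2 := proc u w (Ordinal hx).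
(* Ranks are at most [n - 1], so the cut does not affect the processor numbered by the rank of
   [v']. *)
have e3 : vx i2 = v'.
  apply: (@rk_inj _ _ (E u)); have := hvx i2; rewrite pu_proc px_proc /= => ->.
  by have := rk_lt (E u) v'; lia.
have [i3 [[u3 w3'] x3 l3]] := hB i2.
have e4 : i3 = proc u w ord0.
  apply: proc_inj; rewrite ?u3 ?w3' ?pu_proc ?pw_proc ?px_proc //.
  by apply: val_inj; move: x3; rewrite subnn expn0 ltnS leqn0 => /eqP.
by move: l3; rewrite e4 e1 /c u1 w1 e3 pu_proc pw_proc.
Qed.

Lemma pid0 i : x0 i -> (i : nat) = proc (pu i) (pw i) ord0.
Proof.
move=> xi; rewrite -{1}(procK i); congr (nat_of_ord (proc _ _ _)).
by apply: val_inj => /=; move: xi; rewrite /x0; case: (nat_of_ord (px i)).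
Qed.

Lemma round_ok H E S : env S -> tabE E S -> approx G k H E ->
  wp p_round (fun S' => exists2 E', tabE E' S' & approx G k (H + H) E') S.
Proof.
move=> hS hE ha.
apply: (wp_seq (sort_ok hS hE)) => S1 hs1 F1.
have hS1 : env S1 by apply: env_frame F1 _.
have hE1 : tabE E S1.
  case: F1 => _ Fn Fw u w; have [e1 e2] := hE u w.
  by split; rewrite (Fn, Fw) //; exact: cell_Z.
have hc : wp (p_cand 1 (ld 1 ($14 * $1 + $6)%nexp)) (cand_spec E E) S1.
  apply: cand_ok => //.
    by move=> v w; case: (hE1 v w).
  move=> S' i v hS' m' h14; rewrite /ev /ld /adr /= !(envE hS') h14 m'.
  by case: (hE1 v (pw i)) => <- _.
apply: (wp_seq hc) => S2 hc2 F2.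
have hS2 : env S2 by apply: env_frame F2 _.
have E2 := envE hS2.
have [E' hE'] : exists E' : 'I_n * 'I_n -> key, forall x, skey S2 (proc x.1 x.2 ord0) = E' x.
  by exists (fun x => skey S2 (proc x.1 x.2 ord0)).
apply: (wp_wld (v := fun i => wa S2 2 i)) => [i|].
  by rewrite /ev /adr /= !E2.
apply: (stn_cell (f := fun u w => (E' (u, w)).2)) => //.
  move=> i xi; rewrite /ev /ld /adr /= !E2 -hE' /=.
  by rewrite [X in nmem _ (_ + X)](pid0 xi).
move=> S3 n3 w3 a3 o3 m3.
have hS3 : env S3 by apply: env_eq hS2.
apply: (stw_cell (f := fun u w => (E' (u, w)).1)) => //.
  by move=> i xi; rewrite w3 /= /upd /= -hE' /= (pid0 xi).
move=> S4 n4 w4 a4 o4 m4.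
have hk u w : exists v, E' (u, w) = kadd (E u v) (E v w) /\
    forall v', rk (E u) v' <= k -> (E' (u, w) <= kadd (E u v') (E v' w))%O.
  have [v [_ e hle]] := hc2 u w; exists v; rewrite -hE' /= e; by split.
exists (fun u w => E' (u, w)).
  move=> u w; rewrite a4; split=> //.
  rewrite /na m4 -/(na S3 1 _) a3; apply/minn_idPl.
  by have [v [-> _]] := hk u w; apply: geq_minr.
apply: (approx_step ha).
  by move=> u w; have [v [e _]] := hk u w; exists v.
by move=> u v w hv; have [v0 [_ h]] := hk u w; apply: h.
Qed.

(** * Predecessors, path tables and output *)

Definition exact_upto (E : 'I_n -> 'I_n -> key) :=
  [/\ forall u w, (mkey G u w <= E u w)%O, forall u w, (E u w).2 <= n
    & forall u w, rk (mkey G u) w <= k -> E u w = mkey G u w].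

Definition pred_ok u (pr : 'I_n -> 'I_n) := forall w,
  rk (mkey G u) w <= k -> ((mkey G u w).1 < +oo)%E -> u <> w ->
  [/\ edge G (pr w) w, (mkey G u w).1 = ((mkey G u (pr w)).1 + (wt G (pr w) w)%:E)%E,
      (mkey G u w).2 = (mkey G u (pr w)).2.+1, rk (mkey G u) (pr w) <= k
    & ((mkey G u (pr w)).1 < +oo)%E].

Lemma paths_ok E S : env S -> tabE E S -> sortedt E S -> inp S -> exact_upto E ->
  wp p_paths (fun S' => exists pr : 'I_n -> 'I_n -> 'I_n,
    (forall u, pred_ok u (pr u)) /\
    forall i, na S' 7 i = iter ((E (pu i) (pw i)).2 - px i) (pr (pu i)) (pw i)) S.
Proof.
move=> hS hE hs hin [a1 a2 a3].
have hc : wp (p_cand 0 (NC 1)) (cand_spec E (ckey G)) S by apply: cand_ok.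
apply: (wp_seq hc) => {hc} S1 hc1 F1.
have hS1 : env S1 by apply: env_frame F1 _.
have E1 := envE hS1.
have hE1 : tabE E S1.
  case: F1 => _ Fn Fw u w; have [e1 e2] := hE u w.
  by split; rewrite (Fn, Fw) //; exact: cell_Z.
have [pr0 hpr0] := @fin_all_exists ('I_n * 'I_n)%type (fun=> 'I_n) _ (fun x => hc1 x.1 x.2).
pose pr u w := pr0 (u, w).
have hpr u w : na S1 3 (proc u w ord0) = pr u w by case: (hpr0 (u, w)).
have prok u : pred_ok u (pr u).
  move=> w hk hf nuw; have [_ _ h] := hpr0 (u, w).
  by apply: (pred_spec (k := k) (a1 u) (a3 u) erefl h).
apply: (stn_cell (f := fun u w => pr u w)) => //.
  move=> i xi; rewrite /ev /ld /adr /= !E1 -hpr /na.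
  by rewrite [X in nmem _ (_ + X)](pid0 xi).
move=> S2 n2 w2 h6 o2 m2.
have hS2 : env S2 by apply: env_eq hS1.
have E2 := envE hS2.
apply: (wp_n (v := fun i => pw i)) => [i|]; first by rewrite /ev /= E2.
pose r0 i := (E (pu i) (pw i)).2 - px i.
apply: (wp_n (v := r0)) => [i|].
  rewrite /ev /ld /adr /cell /= /upd /= !E2 -/(na S2 1 _) o2 ?cell_Z //.
  by case: (hE1 (pu i) (pw i)) => -> _.
set S3 := setn _ _ _.
have hS3 : env S3 by do ?[apply: env_setn => // | apply: env_setw].
(* Region 6 holds the [2 ^ t]-fold pointers, register 14 the vertex reached with the low [t] bits,
   and register 15 the remaining bits. *)
pose I t S' := [/\ env S', forall u w, na S' 6 (u * n + w) = iter (2 ^ t) (pr u) w,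
  forall i, nr S' i 14 = iter (r0 i %% 2 ^ t) (pr (pu i)) (pw i)
  & forall i, nr S' i 15 = r0 i %/ 2 ^ t].
match goal with |- context [halving 12 ?b] => set body := b end.
have hl : wp (halving 12 body) (I L) S3.
  apply: (wp_halving (I := I)) => //.
  - by move=> t S' f [H1 H2 H3 H4]; split=> //; apply: env_setn.
  - split=> //.
    + move=> u w; rewrite expn0 /= -[na S3 6 _]/(na S2 6 _) h6.
      by apply/minn_idPl; apply: ltnW.
    + by move=> i; rewrite expn0 modn1.
    + by move=> i; rewrite expn0 divn1.
  - move=> t S' tL h12 [H1 H2 H3 H4]; have E' := envE H1.
    apply: (wp_n (v := fun i => iter (r0 i %% 2 ^ t.+1) (pr (pu i)) (pw i))) => [i|].
      rewrite /ev /ld /cell /adr /= !E' H3 H4 iter_div2 sub_divn modn2 lt0b.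
      by case: ifP => // _; apply: H2.
    apply: (wp_n (v := fun i => r0 i %/ 2 ^ t.+1)) => [i|].
      by rewrite /ev /= /upd /= H4 -divnMA -expnSr.
    set S4 := setn _ _ _.
    have hS4 : env S4 by do ?[apply: env_setn => // | apply: env_setw].
    apply: (stn_cell (f := fun u w => iter (2 ^ t.+1) (pr u) w)) => //.
      move=> i _; rewrite /ev /ld /cell /adr /= /upd /= !E'.
      have e1 := H2 (pu i) (pw i); rewrite /na in e1; rewrite e1.
      by rewrite expnS mul2n -addnn iterD; apply: H2.
    move=> S5 n5 w5 h5 o5 m5; split.
    + exact: env_eq hS4.
    + by move=> u w; rewrite h5; apply/minn_idPl; apply: ltnW.
    + by move=> i; rewrite n5.
    + by move=> i; rewrite n5.
apply: (wp_seq hl) => {hl} S4 [hS4 _ h14 _] F4.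
apply: (stn_pid (cd := fun=> true)) => //.
move=> S5 n5 w5 h5 o5 m5; exists pr; split=> // i.
rewrite h5 /ev /= h14 modn_small.
  by apply/minn_idPl; apply: ltnW.
(* The number of steps is at most [n < 2 ^ L], so all bits have been consumed. *)
by apply: leq_ltn_trans (lg_gt n); apply: leq_trans (leq_subr _ _) (a2 _ _).
Qed.

Lemma leq_lg : lg k <= L.
Proof. by rewrite ltnS; apply: leq_trunc_log. Qed.

Lemma p_gt0 : 0 < p.
Proof. by rewrite !muln_gt0 n_gt0. Qed.

Lemma lgk_ok S : env S -> wp p_lgk (fun S' => na S' 8 0 = lg k) S.
Proof.
move=> hS.
apply: (wp_n (v := fun=> 0)) => //.
match goal with |- context [SLoop true 12 ?e ?b] => set lp := SLoop true 12 e b end.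
have lkn : lg k <= n by apply: leq_trans k_le_n; apply: lg_le_self.
have hl : wp lp (fun S' => env S' /\ forall i, nr S' i 14 = lg k) (setn S 14 (fun=> 0)).
  apply: (@wp_halve _ _ _ _ _ _ _ _ _ k
    (fun j S' => env S' /\ forall i, nr S' i 14 = j)) => //.
  - exact: leq_lg.
  - by move=> i; rewrite /ev /= /upd /= (envE hS).
  - by move=> j S' f [H1 H2]; split=> //; apply: env_setn.
  - by split=> //; apply: env_setn.
  - move=> j S' hj _ [H1 H2].
    apply: (wp_n (v := fun=> j.+1)) => [i|].
      rewrite /ev /n_min /= !(envE H1) H2; lia.
    by split; [apply: env_setn | move=> i].
apply: (wp_seq hl) => {hl} S1 [hS1 h14] _.
have E1 := envE hS1.
apply: (wp_stn (n := n) (cd := fun i : 'I_p => i < 1) (off := fun=> 0) (val := fun=> lg k)) => //.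
- by move=> i; rewrite E1.
- by move=> i; rewrite E1.
- by move=> i; rewrite /ev /= E1 lt0b.
- by move=> i _; exact: leq_ltn_trans (leq0n _) p_lt_Z.
- by move=> i i' hi hi' _; apply: val_inj => /=; lia.
move=> S2 _ _ h2 _ _ _.
by have := h2 (Ordinal p_gt0) isT => /= ->; apply/minn_idPl.
Qed.

Lemma output_ok E S : env S -> tabE E S -> sortedt E S ->
  wp p_output (fun S' => forall u x, x < minn k n.-1 -> exists v,
    [/\ rk (E u) v = x.+1, na S' 0 (n * n + u * k + x) = v
      & wa S' 0 (n * n + u * k + x) = (E u v).1]) S.
Proof.
move=> hS hE hs; have E1 := envE hS.
pose v i := na S 5 (pu i * n + px i).
apply: (wp_n (v := v)) => [i|]; first by rewrite /ev /ld /cell /adr /= !E1.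
apply: (wp_wld (v := fun i => wa S 1 (pu i * n + v i))) => [i|].
  by rewrite /ev /cell /adr /= /upd /= !E1.
pose cd i := [&& pw i < 1, 0 < px i & px i < n].
apply: (wp_n (v := fun i => cd i)) => [i|].
  by rewrite /ev /= /upd /= !E1 /cd !mulnb.
pose off i := n * n + pu i * k + (px i - 1).
apply: (wp_n (v := off)) => [i|].
  by rewrite /ev /= /upd /= !E1.
set S1 := setn _ _ _.
have hS1 : env S1 by do ?[apply: env_setn => // | apply: env_setw].
have offZ i : cd i -> off i < Z.
  case/and3P=> _ h1 h2; rewrite /off; have := ltn_ord (pu i); have := ltn_ord (px i).
  move: k_le_n; nia.
have offinj i i' : cd i -> cd i' -> off i = off i' -> i = i'.
  case/and3P=> w1 x1 y1 /and3P[w2 x2 y2]; rewrite /off => e.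
  have hx := ltn_ord (px i); have hx' := ltn_ord (px i').
  have eu : pu i = pu i'.
    apply: val_inj => /=.
    have : pu i * k + (px i - 1) = pu i' * k + (px i' - 1) by lia.
    move/(congr1 (fun x => x %/ k)); rewrite !divnMDl // !divn_small ?addn0 //; lia.
  apply: proc_inj => //; apply: val_inj => /=; first by lia.
  move: e; rewrite eu; lia.
apply: (wp_stn (n := n) (cd := cd) (off := off) (val := v)) => //.
- by move=> i; rewrite (envE hS1).
- by move=> i; rewrite (envE hS1).
- by move=> i; rewrite /ev /= /upd /= lt0b.
move=> S2 n2 w2 h2 _ _ m2.
apply: (wp_stw (cd := cd) (off := off) (val := fun i => wa S 1 (pu i * n + v i))) => //.
- by move=> i; rewrite n2 (envE hS1).
- by move=> i; rewrite /ev /= n2 /= /upd /= lt0b.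
- by move=> i; rewrite /ev /= n2.
- by move=> i; rewrite w2.
move=> S3 n3 w3 h3 _ _ m3 u x hx.
have hx1 : x.+1 < k.+1 by lia.
have hxn : x.+1 < n by lia.
have [y ey] := rk_surj (E u) hxn.
pose i := proc u (Ordinal n_gt0) (Ordinal hx1).
have ci : cd i by rewrite /cd pw_proc px_proc /= hxn.
have oi : off i = n * n + u * k + x by rewrite /off pu_proc px_proc /= subn1.
have vi : v i = y by rewrite /v pu_proc px_proc /= -ey hs.
exists y; split=> //.
- rewrite /na m3 -/(na S2 0 _) -oi h2 // vi; apply/minn_idPl; exact: ltnW.
- by rewrite -oi h3 // vi pu_proc; case: (hE u y).
Qed.

Lemma inp_frame rs qs ws S S' : inp S -> frame Z rs qs ws S S' -> 0 \notin ws -> inp S'.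
Proof. by move=> h [_ _ Fw] hw u w; rewrite Fw // cell_Z. Qed.

Lemma tabE_frame E rs qs ws S S' : tabE E S -> frame Z rs qs ws S S' ->
  (1 \notin qs) && (1 \notin ws) -> tabE E S'.
Proof.
move=> h [_ Fn Fw] /andP[h1 h2] u w; have [e1 e2] := h u w.
by split; rewrite (Fn, Fw) // cell_Z.
Qed.

Lemma sortedt_frame E rs qs ws S S' : sortedt E S -> frame Z rs qs ws S S' ->
  5 \notin qs -> sortedt E S'.
Proof.
move=> h [_ Fn _] hq u w; rewrite Fn //.
exact: (@cell_Z u (Ordinal (rk_lt (E u) w))).
Qed.

Definition pre_post (S : state R p) := exists pr : 'I_n -> 'I_n -> 'I_n,
  [/\ forall u, pred_ok u (pr u),
      forall u w, rk (mkey G u) w <= k -> na S 1 (u * n + w) = (mkey G u w).2,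
      forall u w (x : 'I_k.+1), rk (mkey G u) w <= k ->
        na S 7 ((u * n + w) * k.+1 + x) = iter ((mkey G u w).2 - x) (pr u) w,
      na S 8 0 = lg k
    & forall u x, x < minn k n.-1 ->
        na S 0 (n * n + u * k + x) = kth G u x.+1 /\
        wa S 0 (n * n + u * k + x) = dist G u (kth G u x.+1)].

Lemma pre_ok : wp p_pre pre_post
  (State (fun i : 'I_p => nth 0 [:: nat_of_ord i; n; k]) (fun _ _ => 0%E) (input G)).
Proof.
set S0 := State _ _ _.
have in0 : inp S0.
  move=> u w; rewrite /wa /= mul0n add0n divnMDl ?n_gt0 // modnMDl.
  by rewrite divn_small ?addn0 // modn_small // !valK.
apply: (wp_seq (setup_ok (input G))) => S1 hS1 F1.
have in1 : inp S1 by apply: inp_frame F1 _.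
apply: (wp_seq (init_ok hS1 in1)) => S2 hE2 F2.
have hS2 : env S2 by apply: env_frame F2 _.
have in2 : inp S2 by apply: inp_frame F2 _.
(* The input stays in the invariant because the predecessors are computed from it after the
   rounds. *)
pose I j S := [/\ env S, inp S & exists2 E, tabE E S & approx G k (2 ^ j) E].
have hl : wp (halving 11 p_round) (I L) S2.
  apply: (wp_halving (I := I)) => //.
  - by move=> j S f [H1 H2 H3]; split=> //; apply: env_setn.
  - by split=> //; exists (einit G) => //; apply: approx_init.
  - move=> j S _ _ [H1 H2 [E H3 H4]].
    apply: (wp_frame (round_ok H1 H3 H4)) => S' [E' H5 H6] F; split.
    + exact: env_frame F _.
    + exact: inp_frame F _.
    + by exists E' => //; rewrite expnS mul2n -addnn.
apply: (wp_seq hl) => {hl} S3 [hS3 in3 [E hE3 [a1 a2 a3]]] _.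
(* [2 ^ L] exceeds every edge count, so the restriction on the number of edges disappears. *)
have a3' u w : rk (mkey G u) w <= k -> E u w = mkey G u w.
  move=> hk; apply: a3 => //.
  exact: leq_trans (mkey_snd G u w) (ltnW (lg_gt n)).
have ex : exact_upto E by split.
apply: (wp_seq (sort_ok hS3 hE3)) => S4 hs4 F4.
have hS4 : env S4 by apply: env_frame F4 _.
have in4 : inp S4 by apply: inp_frame F4 _.
have hE4 : tabE E S4 by apply: tabE_frame F4 _.
apply: (wp_seq (paths_ok hS4 hE4 hs4 in4 ex)) => S5 [pr [hpr h7]] F5.
have hS5 : env S5 by apply: env_frame F5 _.
have hE5 : tabE E S5 by apply: tabE_frame F5 _.
have hs5 : sortedt E S5 by apply: sortedt_frame F5 _.
apply: (wp_seq (lgk_ok hS5)) => S6 h8 F6.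
have hS6 : env S6 by apply: env_frame F6 _.
have hE6 : tabE E S6 by apply: tabE_frame F6 _.
have hs6 : sortedt E S6 by apply: sortedt_frame F6 _.
apply: (wp_frame (output_ok hS6 hE6 hs6)) => S7 ho F7.
have hE7 : tabE E S7 by apply: tabE_frame F7 _.
case: F6 => _ F6 _; case: F7 => _ F7 _.
exists pr; split=> //.
- by move=> u w hk; rewrite -a3' //; case: (hE7 u w).
- move=> u w x hk; have := h7 (proc u w x).
  rewrite pu_proc pw_proc px_proc a3' // => <-.
  by rewrite F7 ?F6 ?(pid_lt (proc u w x)).
- by rewrite F7 ?h8 //; apply: leq_ltn_trans p_lt_Z.
- move=> u x hx; have [v [e1 e2 e3]] := ho u x hx.
  have hxn : x.+1 < n by lia.
  have ek : rk (mkey G u) (kth G u x.+1) = x.+1 by apply: kthK.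
  have hk : rk (mkey G u) (kth G u x.+1) <= k by rewrite ek; lia.
  (* The program sorts by [E]; up to rank [k] this gives the same ranks as the true keys. *)
  have ev : v = kth G u x.+1.
    apply: (@rk_inj _ _ (E u)); rewrite e1.
    by rewrite (rk_exact (a1 u) (a3' u) hk) ek.
  by rewrite e2 e3 ev a3' // mkey_dist.
Qed.

End Preprocessing.

(** * Correctness of the reporting *)

Section Reporting.
Variables (R : realDomainType) (n k : nat) (iv jv : 'I_n) (m : memory R).
Variables (s l : nat) (q : nat -> nat).
Hypotheses (l_gt0 : 0 < l) (s_le_n : s <= n) (s_le_k : s <= k) (k_le_n : k <= n).
Local Notation Z := ((n + 2) * (n + 2) * (n + 2)).
Local Notation p := (s %/ l).+1.
Local Notation v := (minn s.+1 l).
Local Notation wp := (@wp R p Z v).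
Local Notation na := (@na R p Z).

Local Notation mem a o := (nmem m (a * Z + o)).
Hypotheses (m1 : mem 1 (iv * n + jv) = s) (m8 : mem 8 0 = l).
Hypothesis m7 : forall x, x <= s -> mem 7 ((iv * n + jv) * k.+1 + x) = q x.
Hypothesis q_le : forall x, q x <= n.

Definition renv (S : state R p) :=
  (((forall i, nr S i 0 = i) * (forall i, nr S i 1 = n) * (forall i, nr S i 2 = k) *
   (forall i, nr S i 3 = iv) * (forall i, nr S i 4 = jv) * (forall i, nr S i 7 = Z) *
   (forall i, nr S i 14 = s) * (forall i, nr S i 15 = l)))%type.

(** The loop register counts down, so in each block the offsets from [j] on are done. *)
Definition reporting j (S : state R p) := [/\ renv S,
  forall x, x <= s -> na S 7 ((iv * n + jv) * k.+1 + x) = q x,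
  na S 0 0 = s
  & forall (i : 'I_p) y, j <= y < v -> i * l + y <= s -> na S 0 (i * l + y).+1 = q (i * l + y)].

Lemma path_Z x : x <= s -> (iv * n + jv) * k.+1 + x < Z.
Proof.
move=> hx; have h := mul_add_lt (mul_add_lt (ltn_ord iv) (ltn_ord jv)) (_ : x < k.+1).
by apply: leq_trans (h _) _; [lia | nia].
Qed.

Lemma block_inj a c y z : y < l -> z < l -> a * l + y = c * l + z -> a = c /\ y = z.
Proof.
move=> hy hz e; split.
  by have := congr1 (fun x => x %/ l) e; rewrite /= !divnMDl // !divn_small // !addn0.
by have := congr1 (fun x => x %% l) e; rewrite /= !modnMDl !modn_small.
Qed.

Lemma report_ok : wp p_rep
  (fun S => na S 0 0 = s /\ forall x, x <= s -> na S 0 x.+1 = q x)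
  (State (fun i : 'I_p => nth 0 [:: nat_of_ord i; n; k; nat_of_ord iv; nat_of_ord jv])
     (fun _ _ => 0%E) m).
Proof.
apply: (wp_n (v := fun=> Z)) => //.
apply: (wp_n (v := fun=> s)) => [i|].
  by rewrite /ev /ld /adr /= /upd /= m1.
apply: (wp_n (v := fun=> l)) => [i|].
  by rewrite /ev /ld /adr /= /upd /= m8.
set S1 := setn _ _ _.
have e1 : renv S1 by do !split.
apply: (wp_stn (n := n) (cd := fun i : 'I_p => i < 1) (off := fun=> 0) (val := fun=> s)) => //.
- by move=> i; rewrite /ev /= /upd /= lt0b.
- by move=> i _; nia.
- by move=> i i' hi hi' _; apply: val_inj => /=; lia.
move=> S2 n2 _ h2 _ o2 _.
have e2 : renv S2 by rewrite /renv n2.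
match goal with |- context [SLoop false 12 ?e ?b] => set lp := SLoop false 12 e b end.
change (wp lp (fun S => na S 0 0 = s /\ forall x, x <= s -> na S 0 x.+1 = q x) S2).
apply: (@wp_count _ _ _ _ _ _ _ _ _ v reporting) => //.
- by move=> i; rewrite /ev /n_min /= !e2; lia.
- split=> //.
  + by move=> x hx; rewrite o2 ?path_Z // -m7.
  + have := h2 ord0 isT => /= ->; exact/minn_idPl.
  + move=> i y; lia.
- move=> j S hj h12 [H1 H2 H3 H4].
  pose off (i : 'I_p) := i * l + j.
  apply: (wp_n (v := off)) => [i|].
    by rewrite /ev /= !H1 h12 subn1.
  apply: (wp_stn (n := n) (cd := fun i => off i <= s) (off := fun i => (off i).+1)
     (val := fun i => na S 7 ((iv * n + jv) * k.+1 + off i))).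
  + by move=> i; rewrite /= /upd /= H1.
  + by move=> i; rewrite /= /upd /= H1.
  + by move=> i; rewrite /ev /= /upd /= H1 lt0b addn1.
  + by move=> i; rewrite /ev /= /upd /= addn1.
  + by move=> i; rewrite /ev /ld /adr /= /upd /= !H1 addn1.
  + by move=> i hi; nia.
  + move=> i i' _ _ [] /block_inj h; apply: val_inj; apply h; lia.
  move=> S3 n3 _ h3 x3 o3 _; split.
  + rewrite /renv n3 /=; do !split; by move=> i; rewrite /upd /= !H1.
  + by move=> x hx; rewrite o3 ?path_Z //; apply: H2.
  + rewrite x3 //; nia.
  + move=> i y hy hs.
    have [ey|ny] := eqVneq y j.
      rewrite ey in hs *; rewrite -/(off i) h3 // H2 //; exact/minn_idPl.
    rewrite x3; first by apply: H4 => //; lia.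
      by nia.
    by move=> i' _ [] /block_inj[]; lia.
move=> S [_ _ H3 H4]; split=> // x hx.
have hp : x %/ l < p by rewrite ltnS leq_div2r.
have := H4 (Ordinal hp) (x %% l); rewrite /= -divn_eq; apply=> //.
rewrite leq_min ltn_pmod // andbT ltnS.
exact: leq_trans (leq_mod _ _) hx.
Qed.

End Reporting.

(** * Constants and resource bounds *)

Theorem theorem13 :
  exists (pre rep : program) (P : nat -> nat -> nat)
         (Q : nat -> nat -> nat -> nat) (c : nat),
  forall (R : realDomainType) (n k : nat) (G : wdigraph R n),
  1 <= k <= n ->
  exists (T : nat) (m : memory R) (N : 'I_n -> seq 'I_n),
    [/\ T <= c * lg n ^ c,
        P n k * T <= c * (k * n ^ 2) * lg n ^ c,
        exec ((n + 2) ^ c) (P n k) T pre [:: n; k] (input G) m,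
        (forall u : 'I_n, nearest G k u (N u)) /\ stores_nearest k G N m
      & forall i j : 'I_n, j \in N i -> (dist G i j < +oo)%E ->
        exists (q : seq 'I_n) (T' : nat) (m' : memory R),
          [/\ shortest_path G i j q,
              T' <= c * lg k,
              Q n k (size q) * T' <= c * size q,
              exec ((n + 2) ^ c) (Q n k (size q)) T' rep
                   [:: n; k; nat_of_ord i; nat_of_ord j] m m'
            & stores_path i q m']].
Proof.
exists (cs p_pre), (cs p_rep), (fun n k => n * n * k.+1), (fun n k s => (s %/ lg k).+1).
(* The factor 2 pays for [k + 1 <= 2 k] processors per pair, the factor 3 for the work of
   reporting. *)
have [c [c1 c2 c3]] : exists c, [/\ ecap <= c, 2 * ts p_pre <= c & 3 * ts p_rep <= c].
  exists (ecap + 2 * ts p_pre + 3 * ts p_rep).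
  move: (ts p_pre) (ts p_rep) ecap => a b d; split; lia.
move: (pre_dep) (rep_dep) (pre_wf) (rep_wf) => d1 d2 w1 w2.
have cc : 3 <= c by apply: leq_trans c1.
exists c => R n k G /andP[k0 kn].
have n0 : 0 < n by exact: leq_trans kn.
pose b := n + 2.
have b0 : 0 < b by rewrite /b addn2.
have hB : (n + 2) ^ ecap <= (n + 2) ^ c by apply: leq_pexp2l.
have L0 : 0 < lg n by [].
have pb : n * n * k.+1 <= (n + 2) ^ 3.
  have -> : (n + 2) ^ 3 = (n + 2) * (n + 2) * (n + 2) by rewrite !expnS expn0 muln1 mulnA.
  exact: ltnW (p_lt_Z k0 kn).
have ha r : r < 4 -> nth 0 [:: n; k] r <= n + 2.
  by case: r => [|[|r]] //=; rewrite ?nth_nil; lia.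
have hm0 a : nmem (input G) a <= n + 2 by [].
have [T [S [hT hex hm [pr [pr1 pr2 pr3 pr4 pr5]]]]] :=
  wp_exec hB L0 w1 ha isT pb hm0 (pre_ok G k0 kn).
exists T, (me S), (nbrs G k).
rewrite d1 in hT.
have lc : lg n ^ 3 <= lg n ^ c by apply: leq_pexp2l.
split=> //.
- apply: (leq_trans hT); apply: leq_mul => //; lia.
- apply: (@leq_trans (n * n * k.+1 * (ts p_pre * lg n ^ c))).
    by rewrite leq_mul2l (leq_trans hT) ?orbT // leq_mul2l lc orbT.
  rewrite mulnA leq_mul2r; apply/orP; right.
  rewrite -mulnn; apply: (@leq_trans (n * n * (2 * k) * ts p_pre)); last by nia.
  rewrite leq_mul2r leq_mul2l; apply/orP; right; apply/orP; right; lia.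
- split; first by move=> u; apply: nearest_nbrs.
  move=> u x; rewrite size_nbrs => hx /=; rewrite nth_nbrs //.
  by rewrite -mulnn; have := pr5 u x hx; rewrite /na /wa mul0n add0n.
move=> i j hj hf.
have [hk nij] := mem_nbrs hj.
rewrite -mkey_dist in hf.
set s := (mkey G i j).2.
(* There is at least one processor, so the work is linear in the path only because the path has an
   edge. *)
have s0 : 0 < s by rewrite lt0n; apply/eqP => e; exact: nij (mkey_eq0 hf e).
have sk : s <= k by apply: leq_trans hk; apply: mkey_hops_rk.
have sn : s <= n by apply: leq_trans kn.
pose q := pathto (pr i) s j.
have hq : shortest_path G i j q by apply: pathto_shortest hk hf; apply: pr1.
have sq : size q = s by apply: size_pathto.
pose qf x := nat_of_ord (iter (s - x) (pr i) j).
have qn x : qf x <= n by apply/ltnW/ltn_ord.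
have l0 : 0 < lg k by [].
have v0 : 0 < minn s.+1 (lg k) by rewrite leq_min.
have pb' : (s %/ lg k).+1 <= (n + 2) ^ 3.
  apply: (@leq_trans (n + 2)).
    have := leq_div s (lg k); lia.
  by rewrite -{1}(expn1 (n + 2)); apply: leq_pexp2l.
have e7 x : x <= s -> nmem (me S) (7 * ((n + 2) * (n + 2) * (n + 2)) + ((i * n + j) * k.+1 + x)) = qf x.
  move=> hx; have hx' : x < k.+1 by lia.
  exact: (pr3 i j (Ordinal hx') hk).
have ha' r : r < 4 -> nth 0 [:: n; k; nat_of_ord i; nat_of_ord j] r <= n + 2.
  by have := ltn_ord i; have := ltn_ord j; case: r => [|[|[|[|r]]]] //=; lia.
(* Of the two bounds in the minimum, [lg k] gives the time and [s + 1] the work. *)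
have [T' [S' [hT' hex' _ [h0 h1]]]] := wp_exec hB v0 w2 ha' isT pb' hm
    (report_ok l0 sn sk kn (pr2 i j hk) pr4 e7 qn).
exists q, T', (me S'); rewrite sq; split=> //.
- apply: (leq_trans hT'); rewrite d2 expn1; apply: leq_mul; first by lia.
  exact: geq_minr.
- rewrite d2 expn1 in hT'.
  apply: (@leq_trans ((s %/ lg k).+1 * (ts p_rep * minn s.+1 (lg k)))).
    by rewrite leq_mul2l hT' orbT.
  rewrite mulnCA; apply: (@leq_trans (ts p_rep * (3 * s))).
    (* One processor costs at most [s + 1], the other [s %/ lg k] cost at most [s] together, and
       [2 s + 1 <= 3 s]. *)
    rewrite leq_mul2l; apply/orP; right; rewrite mulSn.
    have h2 : s %/ lg k * minn s.+1 (lg k) <= s.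
      by apply: leq_trans (leq_trunc_div s (lg k)); rewrite leq_mul2l geq_minr orbT.
    have := geq_minl s.+1 (lg k); lia.
  by rewrite mulnCA mulnA leq_mul2r c3 orbT.
- split; first by have := h0; rewrite /na mul0n add0n sq.
  move=> x; rewrite sq => hx; have := h1 x hx; rewrite /na mul0n add0n => ->.
  by rewrite (nth_pathto (pr1 i) hk hf hx).
Qed.
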